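(* Let $L$ be a plane in $\mathbb{P}^n$. The defining ideal $I\subset\mathbb{C}[x_0,\ldots,x_n]$ of $L^{\circ2}$ depends on the geometry of the planar configuration $Z\subset\mathbb{P}W^*$ as follows: (i) If $Z$ is not contained in any conic, then $I$ is minimally generated by $n-5$ linear forms and $6$ quadratic forms. (ii) If $Z$ is contained in a unique conic $Q\subset\mathbb{P}W^*$, we distinguish two cases: (a) If $Q$ is irreducible, then $I$ is minimally generated by $n-4$ linear forms and $7$ cubic forms. (b) If $Q$ is reducible, then $L^{\circ2}$ is the complete intersection of $n-4$ hyperplanes and $2$ quadrics. (iii) If $Z$ is contained in several conics, we distinguish three cases: (a) If $|Z|=3$, then $I$ is minimally generated by $n-2$ linear forms. (b) If $|Z|=4$ and no three points of $Z$ are collinear, then $I$ is minimally generated by $n-3$ linear forms and one quartic form. (c) If $|Z|\ge4$ and all but one of the points of $Z$ lie on a line, then $I$ is minimally generated by $n-3$ linear forms and one quadratic form.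
   Context: We work over $\mathbb{C}$. $L^{\circ2}$ denotes the coordinate-wise square of $L$: the image of $L$ under the morphism $\varphi_2\colon\mathbb{P}^n\to\mathbb{P}^n$, $[x_0:\ldots:x_n]\mapsto[x_0^2:\ldots:x_n^2]$; its defining ideal is its homogeneous vanishing ideal. The plane $L$ is viewed as the image of a chosen linear embedding $[\ell_0:\ldots:\ell_n]\colon\mathbb{P}W\hookrightarrow\mathbb{P}^n$, where $W$ is a $3$-dimensional vector space and $\ell_0,\ldots,\ell_n\in W^*$ are linear forms; $Z:=\{[\ell_i]\in\mathbb{P}W^*\mid 0\le i\le n,\ \ell_i\ne0\}$ is the associated finite set of points (without repetitions), which spans the projective plane $\mathbb{P}W^*$. Conics in $\mathbb{P}W^*$ are zero loci of non-zero quadratic forms in $\mathrm{Sym}^2W$ (up to scaling). *)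

(* Defs.v *)
From HB Require Import structures.
From mathcomp Require Import all_boot all_order all_algebra.
From mathcomp Require Export reals complex mpoly.

Set Implicit Arguments.
Unset Strict Implicit.
Unset Printing Implicit Defensive.

Import GRing.Theory.
Local Open Scope ring_scope.

(* Points of the projective space P(V) are the lines (one-dimensional
   subspaces) of V, so equality of points is equality of subspaces. *)

Definition point_set (K : fieldType) (n : nat) := {vspace 'rV[K]_n} -> Prop.

Section Ideals.
Variables (K : fieldType) (n : nat).
Implicit Types (s : seq {mpoly K[n]}) (f g : {mpoly K[n]}).

Definition ideal_of_seq s f : Prop :=
  exists a : nat -> {mpoly K[n]}, f = \sum_(i < size s) a i * s`_i.

Definition ideal_gen (S : {mpoly K[n]} -> Prop) f : Prop :=
  exists2 s, {in s, forall g, S g} & ideal_of_seq s f.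

(* Meaningful for homogeneous f: then it does not depend on the choice of a
   nonzero representative x of the point p. *)
Definition vanishes_at f (p : {vspace 'rV[K]_n}) : Prop :=
  forall x, x \in p -> f.@[fun i => x 0 i] = 0.

Definition vanishing_ideal (X : point_set K n) : {mpoly K[n]} -> Prop :=
  ideal_gen (fun f => f \is homog mdeg /\ (forall p, X p -> vanishes_at f p)).

Definition forms_of_degrees (ds : seq nat) s : Prop :=
  size s = size ds /\ (forall i, (i < size s)%N -> s`_i \is (nth 0%N ds i).-homog).

Definition irredundant s : Prop :=
  forall i, (i < size s)%N ->
    ~ ideal_of_seq (take i s ++ drop i.+1 s) s`_i.

Definition minimally_generated (I : {mpoly K[n]} -> Prop) (ds : seq nat) :
    Prop :=
  exists s, [/\ forms_of_degrees ds s,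
                forall f, I f <-> ideal_of_seq s f
              & irredundant s].

Definition regular_sequence s : Prop :=
  ~ ideal_of_seq s 1 /\
  (forall i, (i < size s)%N -> forall g,
     ideal_of_seq (take i s) (g * s`_i) -> ideal_of_seq (take i s) g).

(* X is the common zero locus of hypersurfaces of degrees ds, their equations
   generate the vanishing ideal of X, and the codimension is the number of
   equations.  The codimension condition is expressed by regularity of the
   sequence of equations. *)
Definition complete_intersection (X : point_set K n) (ds : seq nat) : Prop :=
  exists s, [/\ forms_of_degrees ds s,
                regular_sequence s,
                forall f, vanishing_ideal X f <-> ideal_of_seq s f
              & forall p, \dim p = 1%N ->
                  (X p <-> {in s, forall f, vanishes_at f p})].

End Ideals.

(* The image of P(L) under [x_0 : ... : x_n] |-> [x_0^2 : ... : x_n^2]. *)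
Definition coord_square (K : fieldType) (n : nat) (L : {vspace 'rV[K]_n}) :
    point_set K n :=
  fun p => exists x : 'rV[K]_n,
    [/\ x \in L, x != 0 & p = <[map_mx (fun a => a ^+ 2) x]>%VS].

Section Configuration.
Variables (K : fieldType) (W : vectType K).

Definition dual := 'Hom(W, K^o).

(* The set {[ell_i] | ell_i != 0}, as a list without repetitions. *)
Definition configuration (m : nat) (ell : 'I_m -> dual) : seq {vspace dual} :=
  undup [seq <[ell i]>%VS | i <- enum 'I_m & ell i != 0].

(* Choosing a basis e of W identifies Sym W with the polynomial ring in the
   e_j; e_j is the function f |-> f e_j on the dual of W. *)
Definition Sym := {mpoly K[\dim {:W}]}.

Definition sym_eval (q : Sym) (f : dual) : K :=
  q.@[fun j => f (vbasis {:W})`_j].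

(* The equation of a conic. *)
Definition conic (q : Sym) : Prop := q != 0 /\ q \is 2.-homog.

Definition conic_through (Z : seq {vspace dual}) (q : Sym) : Prop :=
  conic q /\ (forall (p : {vspace dual}) (f : dual),
                   p \in Z -> f \in p -> sym_eval q f = 0).

Definition same_conic (q q' : Sym) : Prop :=
  exists2 c : K, c != 0 & q' = c *: q.

Definition irreducible_conic (q : Sym) : Prop :=
  conic q /\ (forall f g : Sym, q = f * g ->
    (f \is a GRing.unit) \/ (g \is a GRing.unit)).

Definition in_no_conic (Z : seq {vspace dual}) : Prop :=
  forall q, ~ conic_through Z q.

Definition unique_conic_through (Z : seq {vspace dual}) (q : Sym) : Prop :=
  conic_through Z q /\ (forall q', conic_through Z q' -> same_conic q q').

Definition in_several_conics (Z : seq {vspace dual}) : Prop :=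
  exists q q', [/\ conic_through Z q, conic_through Z q' & ~ same_conic q q'].

Definition collinear (s : seq {vspace dual}) : Prop :=
  exists2 M : {vspace dual}, \dim M = 2%N & {in s, forall p, (p <= M)%VS}.

Definition no_three_collinear (Z : seq {vspace dual}) : Prop :=
  forall p q r, p \in Z -> q \in Z -> r \in Z -> uniq [:: p; q; r] ->
    ~ collinear [:: p; q; r].

Definition all_but_one_on_line (Z : seq {vspace dual}) : Prop :=
  exists2 M : {vspace dual}, \dim M = 2%N
    & exists2 p0, p0 \in Z
      & {in Z, forall p, (p <= M)%VS <-> p != p0}.

End Configuration.

(* Main.v *)
(* Expand w in a basis e0, e1, e2 of W with coordinates t0, t1, t2: the ideal I
   is the kernel of the substitution x_i |-> (ell_i w)^2.  Conics through Z are
   the linear forms on Sym^2 W^* that vanish on all squares ell_i^2, so these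
   squares span a space of quadrics of dimension 6 minus the number of
   independent conics through Z.  Writing the squares in a basis g_1, ..., g_r of
   that space splits off N - r linear forms (N = n + 1), and the other generators
   of I are those of the kernel of y_j |-> g_j.

   For a basis of W adapted to Z, the g_j are t0^2, t1^2, t2^2 together with
   - t0 t1, t0 t2, t1 t2 if Z lies on no conic;
   - t1 (t0 - t2), t2 (t0 - t1) if Z lies only on an irreducible conic, which can
     be written e0 e1 + e0 e2 + e1 e2 since it contains three points of Z that
     are not collinear;
   - t0 t2, t1 t2 if Z lies only on the reducible conic e0 e1;
   - nothing, t0 t1 + t0 t2 + t1 t2 or t0 t1 in the cases (a), (b), (c) of
     several conics.
   In each case K[y] modulo the claimed generators is spanned by a few elements
   over T = K[y_1, y_2, y_3], and the images of these elements are compared using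
   that 1, t0 t1, t0 t2, t1 t2 are linearly independent over
   K[t0^2, t1^2, t2^2].  For an irreducible conic the quotient is not free over T:
   it is T + T u + T v + (y_1, y_2, y_3) t1 t2, and the Koszul relations of
   (y_1, y_2, y_3) account for three of the seven cubics. *)

From HB Require Import structures.
Require Import Defs.
From mathcomp Require Import all_boot all_order all_algebra.
From mathcomp Require Import ring.
From mathcomp Require boolp.

Set Implicit Arguments.
Unset Strict Implicit.
Unset Printing Implicit Defensive.

Import Order.TTheory GRing.Theory Num.Theory.
Local Open Scope ring_scope.

(** * Polynomials, ideals and their lowest-degree parts *)

(** Polynomials are compared through their values. [K] has characteristic zero, so a polynomial with
    all values zero vanishes; it is algebraically closed, so every point has square roots of its
    coordinates, and an identity in the [t_i] can be split by replacing [t_i] with [- t_i]. Square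
    roots also absorb scalings of homogeneous coordinates. Generation is only half of each claim.
    [irredundant] allows arbitrary, possibly inhomogeneous coefficients, so a relation is cut down
    to the degree of the generator in question: there only constant terms of coefficients survive,
    and a combination of point evaluations separating this generator from the others refutes the
    relation. A complete intersection asks for a regular sequence and for the zero locus itself, so
    every common zero must be lifted to a parameter. The bounds [r <= N], which make the truncated
    subtraction honest, come from the rank of the matrix of the squares. With at most one conic, a
    vector in its kernel is a quadratic form vanishing on [Z], and the missing monomials forbid it;
    with several conics, suitable points of [Z] are tested directly. *)

Lemma mpoly_var_ind (R : comNzRingType) n (P : {mpoly R[n]} -> Prop) :
    (forall c, P c%:MP) -> (forall p q, P p -> P q -> P (p + q)) ->
    (forall i p, P p -> P ('X_i * p)) ->
  forall p, P p.
Proof.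
move=> PC PD PX; apply: mpolyind => [|c m p _ _ Pp].
  by rewrite -mpolyC0; apply: PC.
apply: PD => //; rewrite -mul_mpolyC mulrC mpolyXE_id.
elim/big_rec: _ => [|i q _ Pq]; first by rewrite mul1r; apply: PC.
rewrite -mulrA; elim: (m i) => [|d IHd]; first by rewrite expr0 mul1r.
by rewrite exprS -mulrA; apply: PX.
Qed.

Lemma poly_eval0 (K : numDomainType) (p : {poly K}) :
  (forall c, p.[c] = 0) -> p = 0.
Proof.
move=> p0; apply/eqP/negPn/negP => nz_p.
have := @max_poly_roots K p [seq k%:R | k <- iota 0 (size p)] nz_p.
rewrite size_map size_iota ltnn map_inj_uniq ?iota_uniq; last first.
  by move=> a b /eqP; rewrite eqr_nat => /eqP.
by move=> h; suff: false by []; apply: h => //; apply/allP=> c _; apply/eqP.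
Qed.

Lemma mpoly_eval0 (K : numDomainType) n (p : {mpoly K[n]}) :
  (forall v, p.@[v] = 0) -> p = 0.
Proof.
move=> p0; apply/mpolyP => m0; rewrite mcoeff0.
(* The exponents of the variables in s are fixed to those of m0. *)
have slice (s : seq 'I_n) v :
    \sum_(m <- msupp p | all (fun i => m i == m0 i) s)
       p@_m * \prod_i v i ^+ m i = 0.
  elim: s v => [|i s IHs] v; first by rewrite /= -mevalE.
  pose q : {poly K} := \sum_(m <- msupp p | all (fun i => m i == m0 i) s)
    (p@_m * \prod_(j | j != i) v j ^+ m j) *: 'X^(m i).
  have q0 : q = 0.
    apply: poly_eval0 => c; rewrite /q horner_sum.
    rewrite -[RHS](IHs (fun j => if j == i then c else v j)).
    apply: eq_bigr => m _; rewrite hornerZ hornerXn -mulrA; congr (_ * _).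
    rewrite [RHS](bigD1 i) //= eqxx mulrC; congr (_ * _).
    by apply: eq_bigr => j /negbTE ->.
  have := congr1 (fun q : {poly K} => q`_(m0 i) * v i ^+ m0 i) q0.
  rewrite coef0 mul0r /q coef_sum mulr_suml => hq; rewrite -[RHS]hq.
  rewrite big_mkcond [RHS]big_mkcond /=; apply: eq_bigr => m _.
  rewrite coefZ coefXn [m0 i == m i]eq_sym andbC; case: (all _ s) => //=.
  case: eqP => [e|ne] /=; last by rewrite mulr0 mul0r.
  by rewrite mulr1 (bigD1 i) //= e [in RHS]mulrAC mulrA.
have := slice (enum 'I_n) (fun _ => 1).
case: (boolP (m0 \in msupp p)) => [m0p|/memN_msupp_eq0 -> //].
rewrite (eq_bigl (pred1 m0)).
  rewrite -big_filter filter_pred1_uniq ?msupp_uniq // big_seq1.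
  by rewrite big1 ?mulr1 // => i _; rewrite expr1n.
move=> m /=; apply/allP/eqP => [h|-> //].
by apply/mnmP => i; apply/eqP/h; rewrite mem_enum.
Qed.

Section Ideals.
Variables (K : fieldType) (n : nat).
Implicit Types (s : seq {mpoly K[n]}) (f g : {mpoly K[n]}).

Definition is_ideal (J : {mpoly K[n]} -> Prop) : Prop :=
  [/\ J 0, forall f g, J f -> J g -> J (f + g) & forall a f, J f -> J (a * f)].

Lemma ideal_seq_is_ideal s : is_ideal (ideal_of_seq s).
Proof.
split=> [|f g [a ->] [b ->]|c f [a ->]].
- by exists (fun _ => 0); rewrite big1 // => i _; rewrite mul0r.
- by exists (fun i => a i + b i); rewrite -big_split; apply: eq_bigr => i _; rewrite mulrDl.
- by exists (fun i => c * a i); rewrite mulr_sumr; apply: eq_bigr => i _; rewrite mulrA.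
Qed.

Lemma ideal_seq0 s : ideal_of_seq s 0.
Proof. by case: (ideal_seq_is_ideal s). Qed.

Lemma ideal_seqD s f g : ideal_of_seq s f -> ideal_of_seq s g -> ideal_of_seq s (f + g).
Proof. by case: (ideal_seq_is_ideal s) => _ + _; apply. Qed.

Lemma ideal_seqM s a f : ideal_of_seq s f -> ideal_of_seq s (a * f).
Proof. by case: (ideal_seq_is_ideal s) => _ _; apply. Qed.

Lemma ideal_seqN s f : ideal_of_seq s f -> ideal_of_seq s (- f).
Proof. by rewrite -mulN1r; apply: ideal_seqM. Qed.

Lemma ideal_seqB s f g : ideal_of_seq s f -> ideal_of_seq s g -> ideal_of_seq s (f - g).
Proof. by move=> ? /ideal_seqN; apply: ideal_seqD. Qed.

Lemma mem_ideal_seq s f : f \in s -> ideal_of_seq s f.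
Proof.
move=> fs; exists (fun i => (i == index f s)%:R).
have lt : (index f s < size s)%N by rewrite index_mem.
rewrite (bigD1 (Ordinal lt)) //= eqxx mul1r nth_index // big1 ?addr0 //.
move=> i; rewrite -val_eqE /= => /negbTE ->; exact: mul0r.
Qed.

Lemma is_ideal_sum J (I : Type) (r : seq I) (P : pred I) (F : I -> {mpoly K[n]}) :
  is_ideal J -> (forall i, P i -> J (F i)) -> J (\sum_(i <- r | P i) F i).
Proof. by move=> [J0 JD _] JF; elim/big_rec: _ => // i x /JF; apply: JD. Qed.

Lemma ideal_seq_min J s f :
  is_ideal J -> {in s, forall g, J g} -> ideal_of_seq s f -> J f.
Proof.
move=> Jid Js [a ->]; apply: is_ideal_sum => // i _.
by case: Jid => _ _; apply; apply/Js/mem_nth.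
Qed.

Lemma ideal_seq_sub s s' f :
  {in s, forall g, ideal_of_seq s' g} -> ideal_of_seq s f -> ideal_of_seq s' f.
Proof. by apply: ideal_seq_min; apply: ideal_seq_is_ideal. Qed.

Lemma ideal_seq_nil f : ideal_of_seq [::] f <-> f = 0.
Proof.
split=> [[a ->]|->]; first by rewrite big_ord0.
exact: ideal_seq0.
Qed.

End Ideals.

Lemma preim_ideal (K : fieldType) n k (phi : {rmorphism {mpoly K[n]} -> {mpoly K[k]}}) J :
  is_ideal J -> is_ideal (fun f => J (phi f)).
Proof.
move=> [J0 JD JM]; split=> [|f g|a f]; first by rewrite rmorph0.
  by rewrite rmorphD; apply: JD.
by rewrite rmorphM; apply: JM.
Qed.

Lemma ideal_seq_morph (K : fieldType) n k
    (phi : {rmorphism {mpoly K[n]} -> {mpoly K[k]}}) s s' f :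
  {in s, forall g, ideal_of_seq s' (phi g)} ->
  ideal_of_seq s f -> ideal_of_seq s' (phi f).
Proof.
by apply: ideal_seq_min; apply: preim_ideal; apply: ideal_seq_is_ideal.
Qed.

Lemma mulrB_split (A : comPzRingType) (a b x y : A) :
  a * x - b * y = a * (x - y) + y * (a - b).
Proof. by ring. Qed.

(** By induction on multiplication by one variable. Taken with the identity as one of the two
    substitutions, it shows that a polynomial killed by the other one lies in the ideal of the
    changes made to the variables; kernels of linear substitutions are computed this way. *)
Lemma comp_mpoly_congr (K : fieldType) n k (J : {mpoly K[k]} -> Prop)
    (lp lq : n.-tuple {mpoly K[k]}) (p : {mpoly K[n]}) :
  is_ideal J -> (forall i, J (tnth lp i - tnth lq i)) ->
  J ((p \mPo lp) - (p \mPo lq)).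
Proof.
move=> Jid Jpq; have [J0 JD JM] := Jid.
elim/mpoly_var_ind: p => [c|p q Jp Jq|i p Jp].
- by rewrite !comp_mpolyC subrr.
- by rewrite !comp_mpolyD opprD addrACA; apply: JD.
rewrite !rmorphM /= !comp_mpolyXU -!tnth_nth.
set a := tnth lp i; set b := tnth lq i.
rewrite mulrB_split; apply: JD; apply: JM => //; apply: Jpq.
Qed.

Lemma homog_evalZ (K : fieldType) n d (p : {mpoly K[n]}) c v :
  p \is d.-homog -> p.@[fun i => c * v i] = c ^+ d * p.@[v].
Proof.
move=> hp; rewrite !mevalE mulr_sumr [LHS]big_seq [RHS]big_seq.
apply: eq_bigr => m mp; rewrite mulrCA; congr (_ * _).
under eq_bigr do rewrite exprMn.
by rewrite big_split /= prodrXr -mdegE (dhomog_mf hp mp).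
Qed.

Section LowDegree.
Variables (K : fieldType) (n : nat).
Implicit Types (s : seq {mpoly K[n]}) (f g : {mpoly K[n]}).

Lemma homog_eval0 d f : (0 < d)%N -> f \is d.-homog -> f.@[fun _ => 0] = 0.
Proof.
move=> d0 /dhomogP hf; rewrite mevalE big_seq big1 // => m /hf dm.
suff -> : \prod_(i < n) (0 : K) ^+ m i = 0 by rewrite mulr0.
case: (pickP (fun i => m i != 0%N)) => [i mi|m0].
  by rewrite (bigD1 i) //= expr0n (negbTE mi) mul0r.
move: d0; rewrite -dm /= mdegE big1 // => i _; apply/eqP.
by have /negbFE := m0 i.
Qed.

(** The component of degree [k] of [a] contributes to degree [k + e >= d], so only [k = 0] can reach
    degree [d], and only when [e = d]. *)
Lemma pihomogM d e a g : g \is e.-homog -> (d <= e)%N ->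
  pihomog mdeg d (a * g) = if e == d then a.@[fun _ => 0] *: g else 0.
Proof.
move=> hg le_de.
rewrite {1}[a](pihomog_partitionE (mf := mdeg) (ssrnat.leqnSn (msize a))) mulr_suml.
have hk (k : nat) : pihomog mdeg k a * g \is (k + e)%N.-homog.
  by apply: dhomogM => //; apply: pihomogP.
rewrite linear_sum /= big_ord_recl /= big1 ?addr0; last first.
  move=> i _; apply: pihomog_ne0 (hk _).
  rewrite neq_ltn orbC; apply/orP; left; rewrite (leq_ltn_trans le_de) //.
  by rewrite /bump /= -addn1 addnC leq_add2r.
case: eqP => [ed|/eqP ed]; last by apply: pihomog_ne0 (hk _).
(* Forms of positive degree vanish at the origin, so the value there is the constant term. *)
have -> : pihomog mdeg 0 a = (a.@[fun _ => 0])%:MP.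
  have := @pihomogP _ K mdeg 0 a => h0.
  have h : (msize (pihomog mdeg 0 a) <= 1)%N.
    rewrite msizeE; apply/bigmax_leqP_seq => m mP _.
    by rewrite (dhomog_mf h0).
  rewrite {1}(msize1_polyC h); congr mpolyC.
  transitivity (pihomog mdeg 0 a).@[fun _ => 0].
    by rewrite [in RHS](msize1_polyC h) mevalC.
  rewrite [in RHS](pihomog_partitionE (mf := mdeg) (ssrnat.leqnSn (msize a))).
  rewrite [RHS]raddf_sum big_ord_recl /= big1 ?addr0 // => i _.
  exact: homog_eval0 (pihomogP _ _ _).
by rewrite mul_mpolyC -ed; apply: pihomog_dE; apply: dhomogZ.
Qed.

Lemma ideal_seq_pihomog d s (P : {mpoly K[n]} -> Prop) f :
    P 0 -> (forall g h, P g -> P h -> P (g + h)) -> (forall c g, P g -> P (c *: g)) ->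
    {in s, forall g, exists e, [/\ (d <= e)%N, g \is e.-homog & e = d -> P g]} ->
  ideal_of_seq s f -> P (pihomog mdeg d f).
Proof.
move=> P0 PD PZ Ps [a ->]; rewrite linear_sum /=.
elim/big_rec: _ => // i x _ Px; apply: PD => //.
have [e [le_de he Pe]] := Ps _ (mem_nth 0 (ltn_ord i)).
by rewrite (pihomogM _ he le_de); case: eqP => // /Pe /PZ.
Qed.

(* A linear functional, given as a combination of evaluations at points. *)
Definition eval_comb (l : seq (K * ('I_n -> K))) f : K :=
  \sum_(cv <- l) cv.1 * f.@[cv.2].

Lemma eval_combD l f g : eval_comb l (f + g) = eval_comb l f + eval_comb l g.
Proof. by rewrite -big_split; apply: eq_bigr => cv _; rewrite mevalD mulrDr. Qed.

Lemma eval_combZ l c f : eval_comb l (c *: f) = c * eval_comb l f.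
Proof. by rewrite mulr_sumr; apply: eq_bigr => cv _; rewrite mevalZ mulrCA. Qed.

(** In degree [d] a member of the ideal is a scalar combination of the generators of degree exactly
    [d], so a functional killing these kills the degree [d] part of every member. Generators of
    higher degree do not interfere, which serves lists of mixed degrees. *)
Lemma ideal_seq_eval_comb d s l f :
    {in s, forall g, exists e, [/\ (d <= e)%N, g \is e.-homog & e = d -> eval_comb l g = 0]} ->
  f \is d.-homog -> eval_comb l f != 0 -> ~ ideal_of_seq s f.
Proof.
move=> hs hf /eqP nz /(ideal_seq_pihomog (P := fun g => eval_comb l g = 0)) h.
apply: nz; rewrite -(pihomog_dE hf); apply: (h d) => //.
- by rewrite /eval_comb big1 // => cv _; rewrite meval0 mulr0.
- by move=> g g1 g0 h0; rewrite eval_combD g0 h0 addr0.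
by move=> c g g0; rewrite eval_combZ g0 mulr0.
Qed.

Lemma mem_remove_nth s i g : g \in take i s ++ drop i.+1 s ->
  exists2 j, (j < size s)%N && (j != i) & g = s`_j.
Proof.
rewrite mem_cat => /orP[] /(nthP 0) [j].
  rewrite size_take_min leq_min => /andP[ji js] <-.
  by exists j; rewrite ?js ?nth_take // neq_ltn ji.
rewrite size_drop ltn_subRL => js <-; exists (i.+1 + j)%N; rewrite ?nth_drop //.
by rewrite js neq_ltn orbC addSn ltnS leq_addr.
Qed.

Lemma irredundant_eval_comb d s (l : nat -> seq (K * ('I_n -> K))) :
    {in s, forall g, g \is d.-homog} ->
    (forall i j, (i < size s)%N -> (j < size s)%N -> (eval_comb (l i) s`_j == 0) = (i != j)) ->
  irredundant s.
Proof.
move=> hs hl i si; apply: (@ideal_seq_eval_comb d _ (l i)).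
- move=> g /mem_remove_nth [j /andP[js ji] ->]; exists d; split=> //; first exact/hs/mem_nth.
  by move=> _; apply/eqP; rewrite hl // eq_sym.
- exact/hs/mem_nth.
- by rewrite hl // eqxx.
Qed.

End LowDegree.

(** * Splitting off linear forms *)

Lemma ker_is_ideal (K : fieldType) n (A : nzRingType) (phi : {rmorphism {mpoly K[n]} -> A}) :
  is_ideal (fun f => phi f = 0).
Proof.
split=> [|f g f0 g0|a f f0]; first exact: rmorph0.
  by rewrite rmorphD f0 g0 addr0.
by rewrite rmorphM f0 mulr0.
Qed.

Definition linform (K : fieldType) m n (M : 'M[K]_(m, n)) (i : 'I_m) : {mpoly K[n]} :=
  \sum_j M i j *: 'X_j.

Notation msub M := (comp_mpoly [tuple linform M i | i < _]).

Section LinearSubstitution.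
Variable K : fieldType.

Lemma linform_mul m n p (A : 'M[K]_(m, n)) (B : 'M[K]_(n, p)) i :
  linform (A *m B) i = \sum_j A i j *: linform B j.
Proof.
rewrite /linform; under [RHS]eq_bigr do rewrite scaler_sumr.
rewrite exchange_big /=; apply: eq_bigr => l _.
rewrite mxE scaler_suml; apply: eq_bigr => j _; by rewrite scalerA.
Qed.

Lemma linformB m n (A B : 'M[K]_(m, n)) i :
  linform (A - B) i = linform A i - linform B i.
Proof. by rewrite -sumrB; apply: eq_bigr => j _; rewrite !mxE scalerBl. Qed.

Lemma linform0 m n i : linform (0 : 'M[K]_(m, n)) i = 0.
Proof. by rewrite /linform big1 // => j _; rewrite mxE scale0r. Qed.

Lemma linform1 n i : linform (1%:M : 'M[K]_n) i = 'X_i.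
Proof.
rewrite /linform (bigD1 i) //= mxE eqxx scale1r big1 ?addr0 // => j ji.
by rewrite mxE eq_sym (negbTE ji) scale0r.
Qed.

Lemma linform_homog m n (A : 'M[K]_(m, n)) i : linform A i \is 1.-homog.
Proof.
apply: rpred_sum => j _; apply: dhomogZ.
by have := dhomogX K mdeg 1 U_(j)%MM; rewrite /= mdeg1 eqxx.
Qed.

Lemma meval_linform m n (A : 'M[K]_(m, n)) i v :
  (linform A i).@[v] = \sum_j A i j * v j.
Proof. by rewrite raddf_sum; apply: eq_bigr => j _ /=; rewrite mevalZ mevalXU. Qed.

Lemma msub_linform m n p (A : 'M[K]_(m, n)) (B : 'M[K]_(n, p)) i :
  msub B (linform A i) = linform (A *m B) i.
Proof.
rewrite linform_mul raddf_sum; apply: eq_bigr => j _.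
by rewrite /= comp_mpolyZ comp_mpolyXU nth_mktuple.
Qed.

Lemma msub_comp m n p (A : 'M[K]_(m, n)) (B : 'M[K]_(n, p)) f :
  msub B (msub A f) = msub (A *m B) f.
Proof.
elim/mpoly_var_ind: f => [c|f g hf hg|i f hf].
- by rewrite !comp_mpolyC.
- by rewrite !raddfD /= hf hg.
by rewrite !rmorphM /= hf !comp_mpolyXU !nth_mktuple msub_linform.
Qed.

Lemma msub1 n f : msub (1%:M : 'M[K]_n) f = f.
Proof.
rewrite -[RHS]comp_mpoly_id; congr (_ \mPo _).
by apply: eq_from_tnth => i; rewrite !tnth_mktuple linform1.
Qed.

Lemma meval_msub m n (A : 'M[K]_(m, n)) f v :
  (msub A f).@[v] = f.@[fun i => \sum_j A i j * v j].
Proof.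
by rewrite comp_mpoly_meval; apply: meval_eq => i; rewrite tnth_mktuple meval_linform.
Qed.

Lemma msub_homog m n (A : 'M[K]_(m, n)) d f :
  f \is d.-homog -> msub A f \is d.-homog.
Proof.
move=> hf; rewrite comp_mpolyE big_seq; apply: rpred_sum => mm /(dhomog_mf hf) /= <-.
apply: dhomogZ; rewrite mdegE.
elim/big_ind2: _ => [|d1 p1 d2 p2 h1 h2|i _]; first exact: dhomog1.
  exact: dhomogM.
rewrite tnth_mktuple -[X in X.-homog]mul1n.
by apply: dhomogMn; apply: linform_homog.
Qed.

End LinearSubstitution.

(* msub C is the restriction to the span of the linear forms of C, with section
   msub D; its kernel is generated by the linear forms of Lam. *)
Section Lift.
Variables (K : fieldType) (N r k : nat).
Variables (C : 'M[K]_(N, r)) (D : 'M[K]_(r, N)) (E : 'M[K]_(N, k)) (Lam : 'M[K]_(k, N)).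
Hypotheses (DC : D *m C = 1%:M) (LamC : Lam *m C = 0).
Hypotheses (CD_E : C *m D + E *m Lam = 1%:M) (LamE : Lam *m E = 1%:M).

Let lins := [tuple linform Lam i | i < k].

Lemma lin_eval i j : (linform Lam i).@[fun m => E m j] = (i == j)%:R.
Proof.
transitivity ((Lam *m E) i j); last by rewrite LamE mxE.
by rewrite meval_linform mxE.
Qed.

Lemma linform_neq0 i : linform Lam i != 0.
Proof.
apply/eqP => h; have := lin_eval i i.
by rewrite h meval0 eqxx => /eqP; rewrite eq_sym oner_eq0.
Qed.

(** Since [Lam *m E = 1%:M], this substitution kills the first [i] linear forms and fixes the
    remaining ones. It realizes the quotient by a prefix of the linear forms as a subring of a
    domain. *)
Let rho (i : nat) : {mpoly K[N]} -> {mpoly K[N]} :=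
  comp_mpoly [tuple 'X_m - \sum_(j < k | (j < i)%N) E m j *: linform Lam j | m < N].

Lemma rho_lin (i : nat) (l : 'I_k) :
  rho i (linform Lam l) = linform Lam l - \sum_(j < k | (j < i)%N) (l == j)%:R *: linform Lam j.
Proof.
rewrite /rho raddf_sum /=.
under eq_bigr do rewrite comp_mpolyZ comp_mpolyXU nth_mktuple scalerBr scaler_sumr.
rewrite sumrB exchange_big /=; congr (_ - _); apply: eq_bigr => j _.
transitivity ((Lam *m E) l j *: linform Lam j); last by rewrite LamE mxE.
by rewrite mxE scaler_suml; apply: eq_bigr => m _; rewrite scalerA.
Qed.

Lemma rho_lin0 (i : nat) (l : 'I_k) : (l < i)%N -> rho i (linform Lam l) = 0.
Proof.
move=> li; rewrite rho_lin (bigD1 l) //= eqxx scale1r big1 ?addr0 ?subrr //.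
by move=> j /andP[_ /negbTE jl]; rewrite eq_sym jl scale0r.
Qed.

Lemma rho_lin_id (i : nat) (l : 'I_k) : (i <= l)%N -> rho i (linform Lam l) = linform Lam l.
Proof.
move=> li; rewrite rho_lin big1 ?subr0 // => j ji.
by rewrite -val_eqE /= eq_sym ltn_eqF ?scale0r // (leq_trans ji).
Qed.

(** [rho i] changes every variable by an element of the ideal, so [f] and [rho i f] are congruent
    modulo it. The ideal is thus prime, and [regular_gens] draws the regularity of the linear forms
    from this. *)
Lemma prefix_ideal i f : ideal_of_seq (take i lins) f <-> rho i f = 0.
Proof.
split=> [|h].
  apply: (ideal_seq_min (J := fun f => rho i f = 0)) => [|g /(nthP 0) [j]].
    exact: (ker_is_ideal (comp_mpoly _)).
  rewrite size_take_min leq_min size_tuple => /andP[ji jk] <-.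
  by rewrite nth_take // (nth_mktuple _ _ (Ordinal jk)) rho_lin0.
have -> : f = (f \mPo [tuple 'X_m | m < N]) - rho i f by rewrite comp_mpoly_id h subr0.
apply: comp_mpoly_congr => [|m]; first exact: ideal_seq_is_ideal.
rewrite !tnth_mktuple subKr; apply: is_ideal_sum => [|j ji]; first exact: ideal_seq_is_ideal.
rewrite -mul_mpolyC; apply: ideal_seqM; apply: mem_ideal_seq.
have -> : linform Lam j = (take i lins)`_j by rewrite nth_take // nth_mktuple.
by apply: mem_nth; rewrite size_take_min leq_min ji size_tuple /=.
Qed.

Lemma msubCD p : msub C (msub D p) = p.
Proof. by rewrite msub_comp DC msub1. Qed.

Lemma msubDC_congr f : ideal_of_seq lins (f - msub D (msub C f)).
Proof.
rewrite msub_comp -[X in X - _]comp_mpoly_id; apply: comp_mpoly_congr => [|m].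
  exact: ideal_seq_is_ideal.
rewrite !tnth_mktuple -linform1 -linformB -CD_E addrC addKr linform_mul.
apply: is_ideal_sum => [|j _]; first exact: ideal_seq_is_ideal.
rewrite -mul_mpolyC; apply: ideal_seqM; apply: mem_ideal_seq.
by apply/mapP; exists j; rewrite ?mem_enum.
Qed.

Lemma msubC_lin g : g \in lins -> msub C g = 0.
Proof. by case/mapP => i _ ->; rewrite msub_linform LamC linform0. Qed.

(** The linear forms die under [msub C], and [msub D] is a section of it, so membership descends;
    [gens_msubC] is the way back. *)
Lemma msubC_gens h f : ideal_of_seq (lins ++ map (msub D) h) f -> ideal_of_seq h (msub C f).
Proof.
apply: ideal_seq_morph => g /=; rewrite mem_cat => /orP[/msubC_lin ->|/mapP [p ph ->]].
  exact: ideal_seq0.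
by rewrite msubCD; apply: mem_ideal_seq.
Qed.

Lemma gens_msubC h f : ideal_of_seq h (msub C f) -> ideal_of_seq (lins ++ map (msub D) h) f.
Proof.
move=> hf; rewrite -[f](subrK (msub D (msub C f))); apply: ideal_seqD.
  apply: ideal_seq_sub (msubDC_congr f) => g gl.
  by apply: mem_ideal_seq; rewrite mem_cat gl.
apply: ideal_seq_morph hf => g gh /=.
by apply: mem_ideal_seq; rewrite mem_cat map_f ?orbT.
Qed.

Section Generators.
Variables (h : seq {mpoly K[r]}) (ds : seq nat).
Hypothesis hds : forms_of_degrees ds h.
Let gens := lins ++ map (msub D) h.

Lemma size_gens : size gens = (k + size h)%N.
Proof. by rewrite size_cat size_tuple size_map. Qed.

Lemma nth_gens_lin (i : 'I_k) : gens`_i = linform Lam i.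
Proof. by rewrite nth_cat size_tuple ltn_ord nth_mktuple. Qed.

Lemma nth_gens_h i : (k <= i)%N -> (i - k < size h)%N -> gens`_i = msub D h`_(i - k).
Proof. by move=> ki ih; rewrite nth_cat size_tuple ltnNge ki /= (nth_map 0). Qed.

Lemma take_gens i : (k <= i)%N -> take i gens = lins ++ map (msub D) (take (i - k) h).
Proof. by move=> ki; rewrite take_cat size_tuple ltnNge ki /= map_take. Qed.

Lemma drop_gens i : (k <= i)%N -> drop i.+1 gens = map (msub D) (drop (i - k).+1 h).
Proof. by move=> ki; rewrite drop_cat size_tuple ltnNge leqW //= subSn // map_drop. Qed.

Lemma forms_gens : forms_of_degrees (nseq k 1%N ++ ds) gens.
Proof.
case: hds => [sh hh]; split=> [|i]; first by rewrite size_gens size_cat size_nseq sh.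
rewrite size_gens => si; case: (ltnP i k) => ik.
  rewrite nth_cat size_nseq ik nth_nseq ik (nth_gens_lin (Ordinal ik)).
  exact: linform_homog.
have ih : (i - k < size h)%N by rewrite ltn_subLR.
rewrite nth_cat size_nseq ltnNge ik /= nth_gens_h //.
exact/msub_homog/hh.
Qed.

(** A linear form is detected by evaluation at its column of [E], dual to the rows of [Lam];
    generators of degree at least 2 contribute nothing in degree one. A relation for a generator
    coming from [h] restricts along [C] to a relation inside [h]. *)
Lemma irredundant_gens : all (leq 2) ds -> irredundant h -> irredundant gens.
Proof.
case: hds => [sh hh] /all_nthP ds2 irr i; rewrite size_gens => si.
case: (ltnP i k) => ik.
  have e := nth_gens_lin (Ordinal ik); rewrite /= in e; rewrite e.
  apply: (@ideal_seq_eval_comb _ _ 1 _ [:: (1, fun m => E m (Ordinal ik))]) => //.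
  - move=> g /mem_remove_nth [j]; rewrite size_gens => /andP[sj ji] ->.
    case: (ltnP j k) => jk.
      exists 1%N; rewrite (nth_gens_lin (Ordinal jk)); split=> // [|_].
        exact: linform_homog.
      by rewrite /eval_comb big_seq1 /= lin_eval -val_eqE /= (negbTE ji) mulr0.
    have jh : (j - k < size h)%N by rewrite ltn_subLR.
    have d2 : (1 < nth 0 ds (j - k))%N by apply: ds2; rewrite -sh.
    exists (nth 0%N ds (j - k)); split; first exact: ltnW.
      by rewrite nth_gens_h //; apply/msub_homog/hh.
    by move=> e1; rewrite e1 in d2.
  - exact: linform_homog.
  - by rewrite /eval_comb big_seq1 /= lin_eval eqxx mulr1 oner_eq0.
have ih : (i - k < size h)%N by rewrite ltn_subLR.
rewrite nth_gens_h // take_gens // drop_gens // -catA -map_cat => /msubC_gens.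
by rewrite msubCD; apply: irr.
Qed.

(** A linear form is fixed by the [rho] of the preceding ones, whose values lie in a domain. Past
    the linear forms, restriction along [C] leaves the regularity of [h]. *)
Lemma regular_gens : regular_sequence h -> regular_sequence gens.
Proof.
case=> h1 reg; split=> [/msubC_gens|i]; first by rewrite rmorph1.
rewrite size_gens => si g; case: (ltnP i k) => ik.
  have e := nth_gens_lin (Ordinal ik); rewrite /= in e; rewrite e.
  rewrite take_cat size_tuple ik; move/prefix_ideal.
  rewrite /rho rmorphM /= -!/(rho _ _) (rho_lin_id (l := Ordinal ik)) //.
  by move/eqP; rewrite mulf_eq0 (negbTE (linform_neq0 _)) orbF => /eqP /prefix_ideal.
have ih : (i - k < size h)%N by rewrite ltn_subLR.
rewrite nth_gens_h // take_gens // => /msubC_gens.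
by rewrite rmorphM /= msubCD => /(reg _ ih); apply: gens_msubC.
Qed.

End Generators.
End Lift.

(** [D] is a left inverse of [C], the rows of [Lam] are a basis of the left kernel of [C], and
    [1 - C D] has its rows in that kernel, which yields [E]. The last identity follows by cancelling
    [Lam], whose rows are independent, on the right. *)
Lemma split_matrix (K : fieldType) N r (C : 'M[K]_(N, r)) : \rank C = r ->
  (r <= N)%N /\ exists D E (Lam : 'M_(N - r, N)),
    [/\ D *m C = 1%:M, Lam *m C = 0, C *m D + E *m Lam = 1%:M & Lam *m E = 1%:M].
Proof.
move=> rC; have rN : (r <= N)%N by rewrite -rC rank_leq_row.
split=> //; have : row_full C by rewrite /row_full rC.
case/row_fullP => D DC; exists D.
(* The rank of the left kernel is [N - r] only up to a proof; generalizing this number lets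
   [row_base] have the required type. *)
have := eq_refl (N - r)%N; rewrite -{1}rC -mxrank_ker.
move: (N - r)%N => k /eqP <-; clear k.
have LC : row_base (kermx C) *m C = 0.
  by apply/sub_kermxP; rewrite eq_row_base.
have : (1%:M - C *m D <= row_base (kermx C))%MS.
  by rewrite eq_row_base; apply/sub_kermxP; rewrite mulmxBl mul1mx -mulmxA DC mulmx1 subrr.
case/submxP => E eE; exists E, (row_base (kermx C)).
have CD_E : C *m D + E *m row_base (kermx C) = 1%:M by rewrite -eE addrC subrK.
split=> //; apply: (row_free_inj (row_base_free (kermx C))).
rewrite -mulmxA mul1mx -[RHS]mulmx1 -CD_E mulmxDr.
by rewrite [X in _ = X + _]mulmxA LC mul0mx add0r.
Qed.

Lemma minimally_generated_lift (K : fieldType) N r (C : 'M[K]_(N, r))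
    (I : {mpoly K[N]} -> Prop) (J : {mpoly K[r]} -> Prop) ds :
    \rank C = r -> (forall f, I f <-> J (msub C f)) -> all (leq 2) ds ->
    minimally_generated J ds ->
  (r <= N)%N /\ minimally_generated I (nseq (N - r) 1%N ++ ds).
Proof.
move=> /split_matrix [rN [D [E [Lam [DC LC CDE LE]]]]] IJ ds2 [h [fh hJ irr]].
split=> //; exists ([tuple linform Lam i | i < N - r] ++ map (msub D) h); split.
- exact: forms_gens.
- move=> f; split=> [/IJ/hJ|/(msubC_gens DC LC) h1]; first exact: (gens_msubC CDE).
  exact/IJ/hJ.
- exact: (irredundant_gens DC LC LE fh).
Qed.

(** Equality of ideals only puts [X] inside the common zero locus. The last hypothesis supplies the
    converse: a nonzero common zero, written as [C z], is a point of [X]. *)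
Lemma complete_intersection_lift (K : fieldType) N r (C : 'M[K]_(N, r))
    (X : point_set K N) (J : {mpoly K[r]} -> Prop) ds h :
    \rank C = r -> (forall f, vanishing_ideal X f <-> J (msub C f)) ->
    forms_of_degrees ds h -> regular_sequence h ->
    (forall f, J f <-> ideal_of_seq h f) ->
    (forall y : 'rV_N, y != 0 ->
      (exists2 z : 'I_r -> K, {in h, forall g, g.@[z] = 0} &
         forall i, y 0 i = \sum_j C i j * z j) -> X <[y]>%VS) ->
  (r <= N)%N /\ complete_intersection X (nseq (N - r) 1%N ++ ds).
Proof.
move=> /split_matrix [rN [D [E [Lam [DC LC CDE LE]]]]] IJ fh reg hJ hX.
split=> //; exists ([tuple linform Lam i | i < N - r] ++ map (msub D) h).
have I_gens f : vanishing_ideal X f <->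
    ideal_of_seq ([tuple linform Lam i | i < N - r] ++ map (msub D) h) f.
  split=> [/IJ/hJ|/(msubC_gens DC LC) h1]; first exact: (gens_msubC CDE).
  exact/IJ/hJ.
split=> //; [exact: forms_gens|exact: (regular_gens DC LC CDE LE)|move=> p dp; split].
  move=> Xp f fs x xp.
  have [s sX] : vanishing_ideal X f by apply/I_gens/mem_ideal_seq.
  apply: (ideal_seq_min (J := fun g => g.@[fun i => x 0 i] = 0)) => [|g gs].
    exact: (ker_is_ideal (meval _)).
  by have [_ gX] := sX _ gs; apply: gX xp.
move=> van; pose y := vpick p.
have y0 : y != 0 by rewrite vpick0 -dimv_eq0 dp.
have yp : y \in p by apply: memv_pick.
have -> : p = <[y]>%VS.
  by apply/eqP; rewrite eq_sym eqEdim dim_vline y0 dp andbT -memvE.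
(* The coordinates [z = D y] reproduce [y]: the linear forms vanish at [y], so [C D y = y]. *)
apply: hX => //; exists (fun j => \sum_i D j i * y 0 i).
  move=> g gh; rewrite -meval_msub; apply: van yp.
  by rewrite mem_cat map_f ?orbT.
have Ly : Lam *m y^T = 0.
  apply/matrixP => i j; rewrite [RHS]mxE mxE; have := van (linform Lam i) _ _ yp.
  rewrite meval_linform mem_cat map_f ?mem_enum // => /(_ isT) {2}<-.
  by apply: eq_bigr => m _; rewrite mxE !ord1.
move=> i; transitivity ((1%:M *m y^T) i 0); first by rewrite mul1mx mxE.
rewrite -CDE mulmxDl -[E *m _ *m _]mulmxA Ly mulmx0 addr0 -mulmxA mxE.
apply: eq_bigr => j _; congr (_ * _); rewrite mxE.
by apply: eq_bigr => m _; rewrite mxE.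
Qed.

(** * Kernels of evaluation at points (t0^2, t1^2, t2^2, ...) *)

Definition pt (K : fieldType) n (s : seq K) : 'I_n -> K := fun i => s`_i.
Arguments pt {K} n s i /.

Notation "''x_' ( n , i )" := ('X_(@Ordinal n i isT)) (at level 0, format "''x_' ( n ,  i )").

Section Parity.
Variable K : numClosedFieldType.
Implicit Types P : {mpoly K[3]}.

Lemma ord3P (Q : 'I_3 -> Prop) :
  Q (@Ordinal 3 0 isT) -> Q (@Ordinal 3 1 isT) -> Q (@Ordinal 3 2 isT) -> forall i, Q i.
Proof.
by move=> Q0 Q1 Q2 [[|[|[|//]]] i3]; rewrite (bool_irrelevance i3 isT).
Qed.

(** For [t_i] a square root of [v_i] the factor in front is only a square root of the monomial at
    [v], so the vanishing of ['X_[m] * P] at [v] is read off from its square. The monomial then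
    cancels in a domain. *)
Lemma monomial_sq_eval0 n (m : 'X_{1..n}) (P : {mpoly K[n]}) :
    (forall t : 'I_n -> K, (\prod_i t i ^+ m i) * P.@[fun i => t i ^+ 2] = 0) -> P = 0.
Proof.
move=> h; have : 'X_[m] * P = 0.
  apply: mpoly_eval0 => v; rewrite mevalM mevalX.
  have := h (fun i => sqrtC (v i)).
  have -> : P.@[fun i => sqrtC (v i) ^+ 2] = P.@[v].
    by apply: meval_eq => i; rewrite sqrtCK.
  have e : (\prod_i sqrtC (v i) ^+ m i) ^+ 2 = \prod_i v i ^+ m i.
    by rewrite -prodrXl; apply: eq_bigr => i _; rewrite exprAC sqrtCK.
  move=> h0; apply/eqP; rewrite -sqrf_eq0 exprMn; apply/eqP.
  have -> : (\prod_i v i ^+ m i) ^+ 2 * P.@[v] ^+ 2 =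
     (\prod_i v i ^+ m i) * P.@[v] *
     ((\prod_i sqrtC (v i) ^+ m i) * ((\prod_i sqrtC (v i) ^+ m i) * P.@[v])).
    by rewrite -e; ring.
  by rewrite h0 !mulr0.
move/eqP; rewrite mulf_eq0 => /orP[/eqP /(congr1 (fun p => p@_m))|/eqP //].
by rewrite mcoeffX eqxx mcoeff0 => /eqP; rewrite oner_eq0.
Qed.

Definition sq3 (t0 t1 t2 : K) : 'I_3 -> K := pt 3 [:: t0 ^+ 2; t1 ^+ 2; t2 ^+ 2].

Lemma monomial_sq3_eval0 P d0 d1 d2 :
    (forall t0 t1 t2, t0 ^+ d0 * (t1 ^+ d1 * t2 ^+ d2) * P.@[sq3 t0 t1 t2] = 0) -> P = 0.
Proof.
pose m := [multinom nth 0%N [:: d0; d1; d2] i | i < 3].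
move=> h; apply: (@monomial_sq_eval0 3 m) => t.
rewrite -[RHS](h (t (@Ordinal 3 0 isT)) (t (@Ordinal 3 1 isT)) (t (@Ordinal 3 2 isT))).
congr (_ * _); last by apply: meval_eq; elim/ord3P.
rewrite !big_ord_recl big_ord0 mulr1 !mnmE /=.
by congr (t _ ^+ _ * (t _ ^+ _ * t _ ^+ _)); apply: val_inj.
Qed.

(* The four sums arise from one identity by changing the sign of one variable. *)
Lemma sign_sums (a b c d : K) :
    a + b + c + d = 0 -> a - b - c + d = 0 -> a - b + c - d = 0 -> a + b - c - d = 0 ->
  [/\ a = 0, b = 0, c = 0 & d = 0].
Proof.
move=> e0 e1 e2 e3; have n4 : 4%:R != 0 :> K by rewrite pnatr_eq0.
have sum4 (x y z w : K) : x = 0 -> y = 0 -> z = 0 -> w = 0 -> x + y + z + w = 0.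
  by move=> -> -> -> ->; rewrite !addr0.
have n0 (x : K) : x = 0 -> - x = 0 by move->; rewrite oppr0.
split; apply: (mulfI n4); rewrite mulr0.
- by rewrite -(sum4 _ _ _ _ e0 e1 e2 e3); ring.
- by rewrite -(sum4 _ _ _ _ e0 (n0 _ e1) (n0 _ e2) e3); ring.
- by rewrite -(sum4 _ _ _ _ e0 (n0 _ e1) e2 (n0 _ e3)); ring.
- by rewrite -(sum4 _ _ _ _ e0 e1 (n0 _ e2) (n0 _ e3)); ring.
Qed.

Lemma parity P0 P1 P2 P3 :
    (forall t0 t1 t2, P0.@[sq3 t0 t1 t2] + t0 * t1 * P1.@[sq3 t0 t1 t2]
       + t0 * t2 * P2.@[sq3 t0 t1 t2] + t1 * t2 * P3.@[sq3 t0 t1 t2] = 0) ->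
  [/\ P0 = 0, P1 = 0, P2 = 0 & P3 = 0].
Proof.
move=> h.
have split4 t0 t1 t2 : [/\ P0.@[sq3 t0 t1 t2] = 0, t0 * t1 * P1.@[sq3 t0 t1 t2] = 0,
     t0 * t2 * P2.@[sq3 t0 t1 t2] = 0 & t1 * t2 * P3.@[sq3 t0 t1 t2] = 0].
  have := h (- t0) t1 t2; have := h t0 (- t1) t2; have := h t0 t1 (- t2).
  rewrite /sq3 !sqrrN !mulNr !mulrN !mulNr => e3 e2 e1.
  exact: sign_sums (h _ _ _) e1 e2 e3.
split.
- apply: (@monomial_sq3_eval0 _ 0 0 0) => t0 t1 t2.
  by case: (split4 t0 t1 t2) => -> _ _ _; rewrite mulr0.
- apply: (@monomial_sq3_eval0 _ 1 1 0) => t0 t1 t2.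
  by case: (split4 t0 t1 t2) => _ e _ _; rewrite !expr1 expr0 mulr1.
- apply: (@monomial_sq3_eval0 _ 1 0 1) => t0 t1 t2.
  by case: (split4 t0 t1 t2) => _ _ e _; rewrite !expr1 expr0 mul1r.
- apply: (@monomial_sq3_eval0 _ 0 1 1) => t0 t1 t2.
  by case: (split4 t0 t1 t2) => _ _ _ e; rewrite !expr1 expr0 mul1r.
Qed.
End Parity.

Lemma addrBD_split (V : zmodType) (a b c d : V) : a + b - (c + d) = (a - c) + (b - d).
Proof. by rewrite opprD addrACA. Qed.

(** * Generation of a kernel through normal forms over a smaller polynomial ring *)

Section FreeModule.
Variables (K : fieldType) (q r : nat) (idx : 'I_q -> 'I_r).
Variables (s b : seq {mpoly K[r]}).

Definition relabel : {mpoly K[q]} -> {mpoly K[r]} := comp_mpoly [tuple 'X_(idx i) | i < q].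

(* f is, modulo the ideal of s, in the module spanned by b over the polynomials
   in the variables X_(idx i). *)
Definition spanned (f : {mpoly K[r]}) : Prop :=
  exists c : nat -> {mpoly K[q]}, ideal_of_seq s (f - \sum_(j < size b) relabel (c j) * b`_j).

Lemma spanned_ideal f : ideal_of_seq s f -> spanned f.
Proof.
exists (fun _ => 0); rewrite big1 ?subr0 // => j _; by rewrite /relabel rmorph0 mul0r.
Qed.

Lemma spannedD f g : spanned f -> spanned g -> spanned (f + g).
Proof.
move=> [c hc] [d hd]; exists (fun j => c j + d j).
have -> : \sum_(j < size b) relabel (c j + d j) * b`_j =
  \sum_(j < size b) relabel (c j) * b`_j + \sum_(j < size b) relabel (d j) * b`_j.
  by rewrite -big_split; apply: eq_bigr => j _; rewrite /relabel rmorphD mulrDl.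
rewrite addrBD_split. exact: ideal_seqD hc hd.
Qed.

Lemma spanned_relabel a f : spanned f -> spanned (relabel a * f).
Proof.
move=> [c hc]; exists (fun j => a * c j).
have -> : \sum_(j < size b) relabel (a * c j) * b`_j =
  relabel a * \sum_(j < size b) relabel (c j) * b`_j.
  by rewrite mulr_sumr; apply: eq_bigr => j _; rewrite /relabel rmorphM mulrA.
by rewrite -mulrBr; apply: ideal_seqM.
Qed.

Lemma relabelC c : relabel c%:MP = c%:MP.
Proof. exact: comp_mpolyC. Qed.

Lemma spannedZ c f : spanned f -> spanned (c *: f).
Proof. by rewrite -mul_mpolyC -relabelC; apply: spanned_relabel. Qed.

Lemma spannedN f : spanned f -> spanned (- f).
Proof. by rewrite -scaleN1r; apply: spannedZ. Qed.

Lemma spannedMn f d : spanned f -> spanned (f *+ d).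
Proof. by rewrite -scaler_nat; apply: spannedZ. Qed.

Lemma spannedX (i : 'I_q) f : spanned f -> spanned ('X_(idx i) * f).
Proof.
have -> : 'X_(idx i) = relabel 'X_i by rewrite /relabel comp_mpolyXU nth_mktuple.
exact: spanned_relabel.
Qed.

Lemma spanned_nth j : (j < size b)%N -> spanned b`_j.
Proof.
move=> jb; exists (fun i => (i == j)%:R).
rewrite (bigD1 (Ordinal jb)) //= eqxx /relabel rmorph1 mul1r big1 ?addr0 ?subrr.
  exact: ideal_seq0.
by move=> i; rewrite -val_eqE /= => /negbTE ->; rewrite rmorph0 mul0r.
Qed.

Lemma spanned_sum (I : Type) (l : seq I) (P : pred I) (F : I -> {mpoly K[r]}) :
  (forall i, P i -> spanned (F i)) -> spanned (\sum_(i <- l | P i) F i).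
Proof.
move=> h; elim/big_rec: _ => [|i x Pi hx]; last exact: spannedD (h _ Pi) hx.
by apply: spanned_ideal; apply: ideal_seq0.
Qed.

(** The variables ['X_(idx l)] preserve the span by construction, so closure has to be checked only
    for products of the other variables with the elements of [b]. *)
Lemma spanned_all :
    spanned 1 ->
    (forall i, (exists l, i = idx l) \/
       (forall j, (j < size b)%N -> spanned ('X_i * b`_j))) ->
  forall f, spanned f.
Proof.
move=> s1 sX; elim/mpoly_var_ind => [c|f g|i f [c hc]].
- by rewrite -[_%:MP]mulr1 -relabelC; apply: spanned_relabel.
- exact: spannedD.
rewrite -[f](subrK (\sum_(j < size b) relabel (c j) * b`_j)) mulrDr.
apply: spannedD; first exact/spanned_ideal/ideal_seqM.
rewrite mulr_sumr; apply: spanned_sum => j _; rewrite mulrCA; apply: spanned_relabel.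
case: (sX i) => [[l ->]|]; last by apply.
by apply: spannedX; apply: spanned_nth.
Qed.

Lemma meval_relabel c v : (relabel c).@[v] = c.@[fun i => v (idx i)].
Proof.
by rewrite comp_mpoly_meval; apply: meval_eq => i; rewrite tnth_mktuple mevalXU.
Qed.

(** A polynomial differs from its normal form by an element of the ideal of [s]. The last hypothesis
    asks for membership and not for vanishing coefficients: without freeness a nontrivial
    combination can lie in the kernel, as in [pv_kernel]. *)
Lemma kernel_generated (J : {mpoly K[r]} -> Prop) :
    is_ideal J -> {in s, forall g, J g} -> (forall f, spanned f) ->
    (forall c : nat -> {mpoly K[q]}, J (\sum_(j < size b) relabel (c j) * b`_j) ->
       ideal_of_seq s (\sum_(j < size b) relabel (c j) * b`_j)) ->
  forall f, J f <-> ideal_of_seq s f.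
Proof.
move=> Jid Js sp hJ f; split=> [Jf|]; last exact: ideal_seq_min.
have [c hc] := sp f; rewrite -[f](subrK (\sum_(j < size b) relabel (c j) * b`_j)).
apply: ideal_seqD => //; apply: hJ.
have [J0 JD JM] := Jid.
rewrite -[X in J X](subKr f) -[- _]mulN1r; apply: JD => //; apply: JM.
exact: ideal_seq_min hc.
Qed.
End FreeModule.

Definition eval_kernel (K : fieldType) r (g : K -> K -> K -> seq K) (f : {mpoly K[r]}) :=
  forall t0 t1 t2, f.@[pt r (g t0 t1 t2)] = 0.

Lemma eval_kernel_ideal (K : fieldType) r g : is_ideal (@eval_kernel K r g).
Proof.
split=> [|f h f0 h0|a f f0] t0 t1 t2; first exact: meval0.
  by rewrite mevalD f0 h0 addr0.
by rewrite mevalM f0 mulr0.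
Qed.

Lemma meval_relabel_pt (K : fieldType) r (le3 : (3 <= r)%N) c (y0 y1 y2 : K) l :
  (relabel (widen_ord le3) c).@[pt r [:: y0, y1, y2 & l]] = c.@[pt 3 [:: y0; y1; y2]].
Proof. by rewrite meval_relabel; apply: meval_eq; elim/ord3P. Qed.

Lemma spannedX3 (K : fieldType) r (le3 : (3 <= r)%N) s b (i : 'I_r) (f : {mpoly K[r]}) :
  (i < 3)%N -> spanned (widen_ord le3) s b f -> spanned (widen_ord le3) s b ('X_i * f).
Proof.
move=> i3; have -> : i = widen_ord le3 (Ordinal i3) by apply: val_inj.
exact: spannedX.
Qed.

Lemma spanned_all3 (K : fieldType) r (le3 : (3 <= r)%N) s b :
    let sp := spanned (K := K) (widen_ord le3) s b in
    sp 1 ->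
    (forall (i : 'I_r) j, (3 <= i)%N -> (j < size b)%N -> sp ('X_i * b`_j)) ->
  forall f, sp f.
Proof.
move=> sp s1 sX; apply: spanned_all => // i; case: (ltnP i 3) => i3.
  by left; exists (Ordinal i3); apply: val_inj.
by right=> j; apply: sX.
Qed.

Lemma homog_varM (R : comNzRingType) n d (i : 'I_n) (p : {mpoly R[n]}) :
  p \is d.-homog -> 'X_i * p \is d.+1.-homog.
Proof.
move=> hp; rewrite -add1n; apply: dhomogM => //.
by have := dhomogX R mdeg 1 U_(i)%MM; rewrite /= mdeg1 eqxx.
Qed.

Lemma homog_var (R : comNzRingType) n (i : 'I_n) : ('X_i : {mpoly R[n]}) \is 1.-homog.
Proof. by have := dhomogX R mdeg 1 U_(i)%MM; rewrite /= mdeg1 eqxx. Qed.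

Ltac homog_tac := repeat first
  [ exact: homog_var | apply: homog_varM | apply: rpredB | apply: rpredN
  | apply: rpredD | apply: rpredMn ].

Definition meval_simp := (mevalD, mevalM, mevalN, mevalMn, mevalXU, meval1).

Section MonomialKernels.
Variable K : numClosedFieldType.

Local Notation w r := (widen_ord (isT : (3 <= r)%N)).

Lemma squares_kernel f :
  @eval_kernel K 3 (fun t0 t1 t2 => [:: t0 ^+ 2; t1 ^+ 2; t2 ^+ 2]) f <-> f = 0.
Proof.
split=> [h|-> t0 t1 t2]; last exact: meval0.
by apply: (@monomial_sq3_eval0 _ _ 0 0 0) => t0 t1 t2; rewrite h mulr0.
Qed.

Definition cone_quadric : {mpoly K[4]} := 'x_(4, 3) * 'x_(4, 3) - 'x_(4, 0) * 'x_(4, 1).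

Lemma cone_kernel f :
  @eval_kernel K 4 (fun t0 t1 t2 => [:: t0 ^+ 2; t1 ^+ 2; t2 ^+ 2; t0 * t1]) f <->
  ideal_of_seq [:: cone_quadric] f.
Proof.
pose b : seq {mpoly K[4]} := [:: 1; 'x_(4, 3)]; pose s := [:: cone_quadric].
move: f; apply: (@kernel_generated K 3 4 (w 4) _ b).
- exact: eval_kernel_ideal.
- move=> g; rewrite inE => /eqP -> t0 t1 t2.
  by rewrite /cone_quadric !meval_simp /=; ring.
- have b0 : spanned (w 4) s b 1 by apply: (spanned_nth _ _ (j := 0)).
  have b1 : spanned (w 4) s b 'x_(4, 3) by apply: (spanned_nth _ _ (j := 1)).
  apply: spanned_all3 => //.
  move=> [[|[|[|[|//]]]] i4] // [|[|//]] _ _; rewrite (bool_irrelevance i4 isT) ?mulr1 //.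
  rewrite [nth _ _ _]/= -[X in spanned _ _ _ X](subrK ('x_(4, 0) * ('x_(4, 1) * 1))).
  apply: spannedD; last by do 2!apply: spannedX3 => //.
  by apply: spanned_ideal; apply: mem_ideal_seq; rewrite mulr1 inE.
move=> c; rewrite !big_ord_recr big_ord0 /= add0r => h.
(* Only 1 and [t0 t1] occur here; the slots of [t0 t2] and [t1 t2] in [parity] are filled with
   zero. *)
have [c0 c1 _ _] : [/\ c 0%N = 0, c 1%N = 0, 0 = 0 :> {mpoly K[3]} & 0 = 0 :> {mpoly K[3]}].
  apply: parity => t0 t1 t2; rewrite -[RHS](h t0 t1 t2) !meval0.
  by rewrite !meval_simp !meval_relabel_pt /sq3 /=; ring.
rewrite c0 c1 /relabel !rmorph0 !mul0r addr0.
exact: ideal_seq0.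
Qed.

Definition veronese_quadrics : seq {mpoly K[6]} :=
  [:: 'x_(6, 3) * 'x_(6, 3) - 'x_(6, 0) * 'x_(6, 1); 'x_(6, 4) * 'x_(6, 4) - 'x_(6, 0) * 'x_(6, 2);
      'x_(6, 5) * 'x_(6, 5) - 'x_(6, 1) * 'x_(6, 2); 'x_(6, 3) * 'x_(6, 4) - 'x_(6, 0) * 'x_(6, 5);
      'x_(6, 3) * 'x_(6, 5) - 'x_(6, 1) * 'x_(6, 4); 'x_(6, 4) * 'x_(6, 5) - 'x_(6, 2) * 'x_(6, 3)].

Lemma veronese_kernel f :
  @eval_kernel K 6 (fun t0 t1 t2 =>
     [:: t0 ^+ 2; t1 ^+ 2; t2 ^+ 2; t0 * t1; t0 * t2; t1 * t2]) f <->
  ideal_of_seq veronese_quadrics f.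
Proof.
pose b : seq {mpoly K[6]} := [:: 1; 'x_(6, 3); 'x_(6, 4); 'x_(6, 5)].
pose s := veronese_quadrics.
move: f; apply: (@kernel_generated K 3 6 (w 6) _ b).
- exact: eval_kernel_ideal.
- move=> g; rewrite !inE => /or3P[||/or3P[||/orP[]]] /eqP -> t0 t1 t2;
  by rewrite !meval_simp /=; ring.
- pose sp := spanned (w 6) s b.
  have b0 : sp 1 by apply: (spanned_nth _ _ (j := 0)).
  have b1 : sp 'x_(6, 3) by apply: (spanned_nth _ _ (j := 1)).
  have b2 : sp 'x_(6, 4) by apply: (spanned_nth _ _ (j := 2)).
  have b3 : sp 'x_(6, 5) by apply: (spanned_nth _ _ (j := 3)).
  have sX (i : 'I_6) : (i < 3)%N -> sp 'X_i.
    by move=> i3; rewrite -['X_i]mulr1; apply: spannedX3.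
  have rel (p g : {mpoly K[6]}) (i : 'I_6) : (i < 3)%N -> sp g -> p - 'X_i * g \in s -> sp p.
    move=> i3 spg ps; rewrite -[p](subrK ('X_i * g)); apply: spannedD.
      by apply: spanned_ideal; apply: mem_ideal_seq.
    exact: spannedX3.
  have hAA : sp ('x_(6, 3) * 'x_(6, 3)).
    by apply: (rel _ 'x_(6, 1) (@Ordinal 6 0 isT)) => //; [apply: sX|exact: (@mem_nth _ 0 s 0 isT)].
  have hBB : sp ('x_(6, 4) * 'x_(6, 4)).
    by apply: (rel _ 'x_(6, 2) (@Ordinal 6 0 isT)) => //; [apply: sX|exact: (@mem_nth _ 0 s 1 isT)].
  have hCC : sp ('x_(6, 5) * 'x_(6, 5)).
    by apply: (rel _ 'x_(6, 2) (@Ordinal 6 1 isT)) => //; [apply: sX|exact: (@mem_nth _ 0 s 2 isT)].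
  have hAB : sp ('x_(6, 3) * 'x_(6, 4)).
    by apply: (rel _ 'x_(6, 5) (@Ordinal 6 0 isT)) => //; exact: (@mem_nth _ 0 s 3 isT).
  have hAC : sp ('x_(6, 3) * 'x_(6, 5)).
    by apply: (rel _ 'x_(6, 4) (@Ordinal 6 1 isT)) => //; exact: (@mem_nth _ 0 s 4 isT).
  have hBC : sp ('x_(6, 4) * 'x_(6, 5)).
    by apply: (rel _ 'x_(6, 3) (@Ordinal 6 2 isT)) => //; exact: (@mem_nth _ 0 s 5 isT).
  apply: spanned_all3 => // -[[|[|[|[|[|[|//]]]]]] i6] // [|[|[|[|//]]]] _ _;
    rewrite (bool_irrelevance i6 isT) /= ?mulr1 //;
    by rewrite mulrC.
move=> c; rewrite !big_ord_recr big_ord0 /= add0r => h.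
have [c0 c1 c2 c3] : [/\ c 0%N = 0, c 1%N = 0, c 2%N = 0 & c 3%N = 0].
  apply: parity => t0 t1 t2; rewrite -[RHS](h t0 t1 t2).
  by rewrite !meval_simp !meval_relabel_pt /sq3 /=; ring.
rewrite c0 c1 c2 c3 /relabel !rmorph0 !mul0r !addr0.
exact: ideal_seq0.
Qed.

Definition node_quadrics : seq {mpoly K[5]} :=
  [:: 'x_(5, 3) * 'x_(5, 3) - 'x_(5, 0) * 'x_(5, 2);
      'x_(5, 4) * 'x_(5, 4) - 'x_(5, 1) * 'x_(5, 2)].

Lemma node_kernel f :
  @eval_kernel K 5 (fun t0 t1 t2 =>
     [:: t0 ^+ 2; t1 ^+ 2; t2 ^+ 2; t0 * t2; t1 * t2]) f <->
  ideal_of_seq node_quadrics f.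
Proof.
pose b : seq {mpoly K[5]} := [:: 1; 'x_(5, 3); 'x_(5, 4); 'x_(5, 3) * 'x_(5, 4)].
pose s := node_quadrics.
move: f; apply: (@kernel_generated K 3 5 (w 5) _ b).
- exact: eval_kernel_ideal.
- move=> g; rewrite !inE => /orP[] /eqP -> t0 t1 t2;
  by rewrite !meval_simp /=; ring.
- pose sp := spanned (w 5) s b.
  have b0 : sp 1 by apply: (spanned_nth _ _ (j := 0)).
  have b1 : sp 'x_(5, 3) by apply: (spanned_nth _ _ (j := 1)).
  have b2 : sp 'x_(5, 4) by apply: (spanned_nth _ _ (j := 2)).
  have b3 : sp ('x_(5, 3) * 'x_(5, 4)) by apply: (spanned_nth _ _ (j := 3)).
  have rel (g : {mpoly K[5]}) : sp g ->
      sp ('x_(5, 3) * 'x_(5, 3) * g) /\ sp ('x_(5, 4) * 'x_(5, 4) * g).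
    move=> spg; split.
      rewrite -['x_(5, 3) * 'x_(5, 3)](subrK ('x_(5, 0) * 'x_(5, 2))) mulrDl.
      apply: spannedD; last by rewrite -mulrA; do 2!apply: spannedX3 => //.
      rewrite mulrC; apply/spanned_ideal/ideal_seqM/mem_ideal_seq.
      by rewrite !inE eqxx.
    rewrite -['x_(5, 4) * 'x_(5, 4)](subrK ('x_(5, 1) * 'x_(5, 2))) mulrDl.
    apply: spannedD; last by rewrite -mulrA; do 2!apply: spannedX3 => //.
    rewrite mulrC; apply/spanned_ideal/ideal_seqM/mem_ideal_seq.
    by rewrite !inE eqxx orbT.
  have [r00 r01] := rel _ b0; have [_ r11] := rel _ b1; have [r20 _] := rel _ b2.
  have {}r11 : sp ('x_(5, 4) * ('x_(5, 3) * 'x_(5, 4))) by rewrite mulrCA mulrC.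
  have {}r20 : sp ('x_(5, 3) * ('x_(5, 3) * 'x_(5, 4))) by rewrite mulrA.
  have b3' : sp ('x_(5, 4) * 'x_(5, 3)) by rewrite mulrC.
  rewrite !mulr1 in r00 r01.
  apply: spanned_all3 => // -[[|[|[|[|[|//]]]]] i5] // [|[|[|[|//]]]] _ _;
    by rewrite (bool_irrelevance i5 isT) /= ?mulr1.
move=> c; rewrite !big_ord_recr big_ord0 /= add0r => h.
(* The last basis element has the value [t0 t1 t2^2], so its coefficient appears in the slot of
   [t0 t1], multiplied by the variable that stands for [t2^2]. *)
have [c0 c3 c1 c2] : [/\ c 0%N = 0, 'x_(3, 2) * c 3%N = 0, c 1%N = 0 & c 2%N = 0].
  apply: parity => t0 t1 t2; rewrite -[RHS](h t0 t1 t2).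
  by rewrite !meval_simp !meval_relabel_pt /sq3 /=; ring.
have {}c3 : c 3%N = 0.
  apply/eqP; move/eqP: c3; rewrite mulf_eq0 => /orP[] // /eqP /(congr1 (meval (fun _ => 1))).
  by rewrite mevalXU meval0 => /eqP; rewrite oner_eq0.
rewrite c0 c1 c2 c3 /relabel !rmorph0 !mul0r !addr0.
exact: ideal_seq0.
Qed.
End MonomialKernels.

(** * Forms for the Steiner quartic and the projected Veronese surface *)

Definition sym2 (A : pzRingType) (y0 y1 y2 f : A) : A :=
  y0 * (y1 * f) + y0 * (y2 * f) + y1 * (y2 * f).

(** Steiner's quartic. For [e = t0 t1 + t0 t2 + t1 t2], [y_i = t_i^2] and [s] the second elementary
    symmetric function of the [y_i], one has [e^2 - s = 2 t0 t1 t2 (t0 + t1 + t2)]; squaring gives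
    [(e^2 - s)^2 = 4 y0 y1 y2 (y0 + y1 + y2 + 2 e)]. *)
Definition quartic_form (A : pzRingType) (y0 y1 y2 e : A) : A :=
  e * (e * (e * e)) - sym2 y0 y1 y2 (e * e) *+ 2 + sym2 y0 y1 y2 (sym2 y0 y1 y2 1)
  - (y0 * (y1 * (y2 * (y0 + y1 + y2)))) *+ 4 - (y0 * (y1 * (y2 * e))) *+ 8.

(** Solved for the fourth power, with variables wrapped one at a time around a power of [e]: the
    shape that the closure rules of a span can consume. *)
Lemma quartic_formE (A : comPzRingType) (y0 y1 y2 e : A) :
  e * (e * (e * e)) = quartic_form y0 y1 y2 e +
    (sym2 y0 y1 y2 (e * e) *+ 2 - sym2 y0 y1 y2 (sym2 y0 y1 y2 1)
     + (y0 * (y1 * (y2 * (y0 * 1 + y1 * 1 + y2 * 1)))) *+ 4 + (y0 * (y1 * (y2 * e))) *+ 8).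
Proof. by rewrite /quartic_form /sym2; ring. Qed.

Section ProjectedVeroneseForms.
Variable A : comPzRingType.
Variables y0 y1 y2 u v : A.

(* Under y_i = t_i^2, u = t1 (t0 - t2), v = t2 (t0 - t1), the value of pv_wi is
   2 y_i t1 t2.  The first three cubics are the Koszul relations between the
   pv_wi; the others come from u t1 t2 = y1 v + y1 t1 t2 - y1 y2 and
   v t1 t2 = y2 u + y2 t1 t2 - y1 y2, multiplied by 2 y_i.  The two relations of
   this kind with i = 0 are consequences, by pv_uw0 and pv_vw0. *)
Definition pv_w0 : A := (u * v) *+ 2 + y0 * y1 + y0 * y2 - u * u - v * v.
Definition pv_w1 : A := y0 * y1 + y1 * y2 - (y1 * v) *+ 2 - u * u.
Definition pv_w2 : A := y0 * y2 + y1 * y2 - (y2 * u) *+ 2 - v * v.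

Definition pv_u (y w : A) : A := u * w - (y * (y1 * v)) *+ 2 + (y * (y1 * y2)) *+ 2 - y1 * w.
Definition pv_v (y w : A) : A := v * w - (y * (y2 * u)) *+ 2 + (y * (y1 * y2)) *+ 2 - y2 * w.

Definition pv_cubics : seq A :=
  [:: y0 * pv_w1 - y1 * pv_w0; y0 * pv_w2 - y2 * pv_w0; y1 * pv_w2 - y2 * pv_w1;
      pv_u y1 pv_w1; pv_u y2 pv_w2; pv_v y1 pv_w1; pv_v y2 pv_w2].

(** This and the next identities form a multiplication table: modulo the cubics, the products of [u]
    and [v] with 1, [u], [v] and the [pv_wi] reduce to combinations of these elements over the
    [y_i]. Factors 1 are kept so that a term visibly ends in a spanning element. *)
Lemma pv_uu : u * u = y0 * (y1 * 1) + y1 * (y2 * 1) - (y1 * v) *+ 2 - pv_w1.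
Proof. by rewrite /pv_w1; ring. Qed.

Lemma pv_vv : v * v = y0 * (y2 * 1) + y1 * (y2 * 1) - (y2 * u) *+ 2 - pv_w2.
Proof. by rewrite /pv_w2; ring. Qed.

Lemma pv_uv : (u * v) *+ 2 = pv_w0 - pv_w1 - pv_w2 + (y1 * (y2 * 1)) *+ 2
  - (y1 * v) *+ 2 - (y2 * u) *+ 2.
Proof. by rewrite /pv_w0 /pv_w1 /pv_w2; ring. Qed.

Lemma pv_uE y w : u * w =
  pv_u y w + ((y * (y1 * v)) *+ 2 - (y * (y1 * (y2 * 1))) *+ 2 + y1 * w).
Proof. by rewrite /pv_u; ring. Qed.

Lemma pv_vE y w : v * w =
  pv_v y w + ((y * (y2 * u)) *+ 2 - (y * (y1 * (y2 * 1))) *+ 2 + y2 * w).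
Proof. by rewrite /pv_v; ring. Qed.

Lemma pv_uw0 : u * pv_w0 = u * pv_w1 + u * pv_w2 - (v * pv_w1) *+ 2
  + (y1 * (y0 * v)) *+ 2 + (y1 * (y2 * v)) *+ 2 - (y1 * (v * v)) *+ 4
  - (y1 * (y2 * u)) *+ 2 + (y1 * (u * v)) *+ 2 + (y2 * (u * u)) *+ 2.
Proof. by rewrite /pv_w0 /pv_w1 /pv_w2; ring. Qed.

Lemma pv_vw0 : v * pv_w0 = v * pv_w1 + v * pv_w2 - (u * pv_w2) *+ 2
  + (y2 * (y0 * u)) *+ 2 + (y2 * (y1 * u)) *+ 2 - (y2 * (u * u)) *+ 4
  - (y1 * (y2 * v)) *+ 2 + (y2 * (u * v)) *+ 2 + (y1 * (v * v)) *+ 2.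
Proof. by rewrite /pv_w0 /pv_w1 /pv_w2; ring. Qed.

(** The coefficients on the left are those that [koszul3] produces for a syzygy of the [y_i]; the
    right-hand side lies in the ideal of the first three cubics. *)
Lemma pv_koszul p q s :
  (y1 * p + y2 * q) * pv_w0 + (y2 * s - y0 * p) * pv_w1 + (- (y0 * q) - y1 * s) * pv_w2 =
  - p * (y0 * pv_w1 - y1 * pv_w0) - q * (y0 * pv_w2 - y2 * pv_w0)
  - s * (y1 * pv_w2 - y2 * pv_w1).
Proof. by ring. Qed.

End ProjectedVeroneseForms.

Section Koszul.
Variable K : fieldType.

Lemma ideal_seq1 n (g f : {mpoly K[n]}) : ideal_of_seq [:: g] f -> exists a, f = g * a.
Proof. by case=> a ->; exists (a 0%N); rewrite big_ord1 mulrC. Qed.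

Lemma ideal_seq2 n (g h f : {mpoly K[n]}) :
  ideal_of_seq [:: g; h] f -> exists a b, f = g * a + h * b.
Proof.
by case=> a ->; exists (a 0%N), (a 1%N); rewrite !big_ord_recr big_ord0 /= add0r ![a _ * _]mulrC.
Qed.

Local Notation kill S := (comp_mpoly [tuple if i \in S then 0 else 'X_i | i < _]).

Lemma killX n (S : seq 'I_n) i : kill S ('X_i : {mpoly K[n]}) = if i \in S then 0 else 'X_i.
Proof. by rewrite comp_mpolyXU nth_mktuple. Qed.

Lemma kill_ideal n (S : seq 'I_n) (f : {mpoly K[n]}) :
  kill S f = 0 -> ideal_of_seq [seq 'X_i | i <- S] f.
Proof.
move=> f0; have -> : f = (f \mPo [tuple 'X_i | i < n]) - kill S f by rewrite f0 subr0 comp_mpoly_id.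
apply: comp_mpoly_congr => [|i]; first exact: ideal_seq_is_ideal.
rewrite !tnth_mktuple; case: ifP => iS; last first.
  by rewrite subrr; apply: ideal_seq0.
by rewrite subr0; apply: mem_ideal_seq; apply/mapP; exists i.
Qed.

Lemma mpolyX_neq0 n (i : 'I_n) : ('X_i : {mpoly K[n]}) != 0.
Proof.
apply/eqP => /(congr1 (meval (fun _ => 1))).
by rewrite mevalXU meval0 => /eqP; rewrite oner_eq0.
Qed.

(** Setting [y0 = y1 = 0] leaves [y2 f = 0], so [f] lies in the ideal of [y0] and [y1]. After
    substituting this, setting [y0 = 0] settles the remaining relation between [y0] and [y1] in the
    same way. *)
Lemma koszul3 (d e f : {mpoly K[3]}) :
    'x_(3, 0) * d + 'x_(3, 1) * e + 'x_(3, 2) * f = 0 ->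
  exists p q s, [/\ d = 'x_(3, 1) * p + 'x_(3, 2) * q, e = 'x_(3, 2) * s - 'x_(3, 0) * p
    & f = - ('x_(3, 0) * q) - 'x_(3, 1) * s].
Proof.
set y0 := 'x_(3, 0); set y1 := 'x_(3, 1); set y2 := 'x_(3, 2) => h.
have [a [b ef]] : exists a b, f = y0 * a + y1 * b.
  apply/ideal_seq2/(@kill_ideal 3 [:: @Ordinal 3 0 isT; @Ordinal 3 1 isT]).
  have := congr1 (kill [:: @Ordinal 3 0 isT; @Ordinal 3 1 isT]) h.
  rewrite !raddfD /= !rmorphM /= rmorph0 !killX !inE /= !mul0r !add0r => /eqP.
  by rewrite mulf_eq0 (negbTE (mpolyX_neq0 _)) => /eqP.
have h1 : y0 * (d + y2 * a) + y1 * (e + y2 * b) = 0.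
  rewrite -[RHS]h ef !mulrDr [in RHS]addrA -!addrA; congr (_ + _).
  by rewrite addrCA [y0 * (y2 * a)]mulrCA [y1 * (y2 * b)]mulrCA.
have [c ec] : exists c, e + y2 * b = y0 * c.
  apply/ideal_seq1/(@kill_ideal 3 [:: @Ordinal 3 0 isT]).
  have := congr1 (kill [:: @Ordinal 3 0 isT]) h1.
  rewrite raddfD /= [X in X + _]rmorphM [X in _ + X]rmorphM /= rmorph0 !killX !inE /=.
  rewrite mul0r add0r => /eqP.
  by rewrite mulf_eq0 (negbTE (mpolyX_neq0 _)) => /eqP.
have h2 : y0 * (d + y2 * a + y1 * c) = 0.
  by rewrite -[RHS]h1 ec mulrDr; congr (_ + _); rewrite mulrCA.
exists (- c), (- a), (- b); split.
- move/eqP: h2; rewrite mulf_eq0 (negbTE (mpolyX_neq0 _)) /= addr_eq0 => /eqP e0.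
  by rewrite !mulrN -e0 addrK.
- by rewrite !mulrN opprK -ec addrC addrK.
- by rewrite !mulrN !opprK.
Qed.
End Koszul.

Ltac closure_tac hD hN hM h0 h1 h2 := repeat first
  [ assumption | apply: (hD) | apply: (hN) | apply: (hM)
  | apply: (h0) | apply: (h1) | apply: (h2) ].

Section NonMonomialKernels.
Variable K : numClosedFieldType.

Local Notation w r := (widen_ord (isT : (3 <= r)%N)).

Definition steiner_quartic : {mpoly K[4]} :=
  quartic_form 'x_(4, 0) 'x_(4, 1) 'x_(4, 2) 'x_(4, 3).

Lemma mpoly_half n (f : {mpoly K[n]}) : f = 2%:R^-1 *: (f *+ 2).
Proof. by rewrite -[f *+ 2]scaler_nat scalerA mulVf ?scale1r // pnatr_eq0. Qed.

Lemma mulXB_eq0 n (i j : 'I_n) (f : {mpoly K[n]}) : i != j -> ('X_i - 'X_j) * f = 0 -> f = 0.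
Proof.
move=> ij /eqP; rewrite mulf_eq0 => /orP[|/eqP //] /eqP.
move=> /(congr1 (meval (fun l => (l == i)%:R))).
by rewrite mevalB !mevalXU eqxx eq_sym (negbTE ij) subr0 meval0 => /eqP; rewrite oner_eq0.
Qed.

Lemma double_eq0 n (f : {mpoly K[n]}) : f *+ 2 = 0 -> f = 0.
Proof. by move=> h; rewrite [f]mpoly_half h scaler0. Qed.

(* Comparing the coefficients of t1 t2, t0 t2, t0 t1 in c0 + c1 e + c2 e^2 + c3 e^3
   for e = t0 t1 + t0 t2 + t1 t2 leaves a Vandermonde system. *)
Lemma quartic_coef_eq0 (A : comPzRingType) (y0 y1 y2 c1 c2 c3 : A)
    (s := fun y z z' : A => c1 + (y * c2) *+ 2 +
       (y0 * y1 + y0 * y2 + y1 * y2 + (y * (z + z')) *+ 2) * c3) :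
  ((y2 - y1) * (c2 + y0 * c3)) *+ 2 = s y2 y0 y1 - s y1 y0 y2 /\
  ((y2 - y0) * (c2 + y1 * c3)) *+ 2 = s y2 y0 y1 - s y0 y1 y2.
Proof. by rewrite /s; split; ring. Qed.

Lemma steiner_kernel f :
  @eval_kernel K 4 (fun t0 t1 t2 =>
     [:: t0 ^+ 2; t1 ^+ 2; t2 ^+ 2; t0 * t1 + t0 * t2 + t1 * t2]) f <->
  ideal_of_seq [:: steiner_quartic] f.
Proof.
pose e : {mpoly K[4]} := 'x_(4, 3).
pose b : seq {mpoly K[4]} := [:: 1; e; e * e; e * (e * e)].
pose s := [:: steiner_quartic].
move: f; apply: (@kernel_generated K 3 4 (w 4) _ b).
- exact: eval_kernel_ideal.
- move=> g; rewrite inE => /eqP -> t0 t1 t2.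
  by rewrite /steiner_quartic /quartic_form /sym2 !meval_simp /=; ring.
- pose sp := spanned (w 4) s b.
  have b0 : sp 1 by apply: (spanned_nth _ _ (j := 0)).
  have b1 : sp e by apply: (spanned_nth _ _ (j := 1)).
  have b2 : sp (e * e) by apply: (spanned_nth _ _ (j := 2)).
  have b3 : sp (e * (e * e)) by apply: (spanned_nth _ _ (j := 3)).
  have sD f g : sp f -> sp g -> sp (f + g) by apply: spannedD.
  have sN f : sp f -> sp (- f) by apply: spannedN.
  have sM f k : sp f -> sp (f *+ k) by apply: spannedMn.
  have s0 f : sp f -> sp ('x_(4, 0) * f) by apply: spannedX3.
  have s1 f : sp f -> sp ('x_(4, 1) * f) by apply: spannedX3.
  have s2 f : sp f -> sp ('x_(4, 2) * f) by apply: spannedX3.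
  have sym f : sp f -> sp (sym2 'x_(4, 0) 'x_(4, 1) 'x_(4, 2) f).
    by move=> sf; closure_tac sD sN sM s0 s1 s2.
  have b4 : sp (e * (e * (e * e))).
    rewrite (quartic_formE 'x_(4, 0) 'x_(4, 1) 'x_(4, 2)); apply: spannedD.
      by apply: spanned_ideal; apply: mem_ideal_seq; rewrite inE.
    apply: (sD (_ + _)); last by closure_tac sD sN sM s0 s1 s2.
    apply: (sD (_ + _)); last first.
      by closure_tac sD sN sM s0 s1 s2.
    by apply: (sD); [apply: (sM); apply: (sym)|apply: (sN); apply: (sym); apply: (sym)].
  apply: spanned_all3 => //.
  move=> [[|[|[|[|//]]]] i4] // [|[|[|[|//]]]] _ _;
    by rewrite (bool_irrelevance i4 isT) /= ?mulr1.
move=> c; rewrite !big_ord_recr big_ord0 /= add0r => h.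
pose y0 : {mpoly K[3]} := 'x_(3, 0); pose y1 : {mpoly K[3]} := 'x_(3, 1).
pose y2 : {mpoly K[3]} := 'x_(3, 2).
pose sc := fun y z z' : {mpoly K[3]} => c 1%N + (y * c 2%N) *+ 2 +
  (y0 * y1 + y0 * y2 + y1 * y2 + (y * (z + z')) *+ 2) * c 3%N.
(* For [s = y0 y1 + y0 y2 + y1 y2] the value of [e^2] is [s + 2 (y0 t1 t2 + y1 t0 t2 + y2 t0 t1)],
   and that of [e^3] has the part [6 y0 y1 y2] without cross terms. The three values of [sc] are the
   coefficients of [t0 t1], [t0 t2] and [t1 t2]. *)
have [e0 e1 e2 e3] : [/\ c 0%N + (y0 * y1 + y0 * y2 + y1 * y2) * c 2%N
      + (y0 * (y1 * (y2 * c 3%N))) *+ 6 = 0,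
    sc y2 y0 y1 = 0, sc y1 y0 y2 = 0 & sc y0 y1 y2 = 0].
  apply: parity => t0 t1 t2; rewrite -[RHS](h t0 t1 t2).
  by rewrite /sc !meval_simp !meval_relabel_pt /sq3 /=; ring.
have [f1 f2] := quartic_coef_eq0 y0 y1 y2 (c 1%N) (c 2%N) (c 3%N).
rewrite -!/(sc _ _ _) e1 e2 subrr in f1; rewrite -!/(sc _ _ _) e1 e3 subrr in f2.
have {}f1 := @mulXB_eq0 3 (@Ordinal 3 2 isT) (@Ordinal 3 1 isT) _ isT (double_eq0 f1).
have {}f2 := @mulXB_eq0 3 (@Ordinal 3 2 isT) (@Ordinal 3 0 isT) _ isT (double_eq0 f2).
have c3 : c 3%N = 0.
  apply: (@mulXB_eq0 3 (@Ordinal 3 0 isT) (@Ordinal 3 1 isT)) => //.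
  rewrite mulrBl; transitivity ((c 2%N + y0 * c 3%N) - (c 2%N + y1 * c 3%N)).
    by rewrite addrBD_split subrr add0r.
  by rewrite f1 f2 subrr.
have c2 : c 2%N = 0 by rewrite -f1 c3 mulr0 addr0.
have c1 : c 1%N = 0 by rewrite -e1 /sc c2 c3 !mulr0 mul0rn !addr0.
have c0 : c 0%N = 0 by rewrite -e0 c2 c3 !mulr0 mul0rn !addr0.
rewrite c0 c1 c2 c3 /relabel !rmorph0 !mul0r !addr0.
exact: ideal_seq0.
Qed.

Lemma relabel_w r (le3 : (3 <= r)%N) i (i3 : (i < 3)%N) (ir : (i < r)%N) :
  relabel (widen_ord le3) 'X_(Ordinal i3) = 'X_(Ordinal ir) :> {mpoly K[r]}.
Proof. by rewrite /relabel comp_mpolyXU nth_mktuple; congr 'X_ _; apply: val_inj. Qed.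

Definition pv_gens : seq {mpoly K[5]} :=
  pv_cubics 'x_(5, 0) 'x_(5, 1) 'x_(5, 2) 'x_(5, 3) 'x_(5, 4).

Lemma pv_kernel f :
  @eval_kernel K 5 (fun t0 t1 t2 =>
     [:: t0 ^+ 2; t1 ^+ 2; t2 ^+ 2; t1 * (t0 - t2); t2 * (t0 - t1)]) f <->
  ideal_of_seq pv_gens f.
Proof.
pose y0 : {mpoly K[5]} := 'x_(5, 0); pose y1 : {mpoly K[5]} := 'x_(5, 1).
pose y2 : {mpoly K[5]} := 'x_(5, 2).
pose u : {mpoly K[5]} := 'x_(5, 3); pose v : {mpoly K[5]} := 'x_(5, 4).
pose w0 := pv_w0 y0 y1 y2 u v; pose w1 := pv_w1 y0 y1 y2 u v; pose w2 := pv_w2 y0 y1 y2 u v.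
pose b : seq {mpoly K[5]} := [:: 1; u; v; w0; w1; w2].
pose s := pv_gens.
move: f; apply: (@kernel_generated K 3 5 (w 5) _ b).
- exact: eval_kernel_ideal.
- move=> g; rewrite !inE => /or3P[||/or3P[||/or3P[]]] /eqP -> t0 t1 t2;
  by rewrite /pv_u /pv_v /pv_w0 /pv_w1 /pv_w2 !meval_simp /=; ring.
- pose sp := spanned (w 5) s b.
  have b0 : sp 1 by apply: (spanned_nth _ _ (j := 0)).
  have bu : sp u by apply: (spanned_nth _ _ (j := 1)).
  have bv : sp v by apply: (spanned_nth _ _ (j := 2)).
  have bw0 : sp w0 by apply: (spanned_nth _ _ (j := 3)).
  have bw1 : sp w1 by apply: (spanned_nth _ _ (j := 4)).
  have bw2 : sp w2 by apply: (spanned_nth _ _ (j := 5)).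
  have sD f g : sp f -> sp g -> sp (f + g) by apply: spannedD.
  have sN f : sp f -> sp (- f) by apply: spannedN.
  have sM f k : sp f -> sp (f *+ k) by apply: spannedMn.
  have s0 f : sp f -> sp (y0 * f) by apply: spannedX3.
  have s1 f : sp f -> sp (y1 * f) by apply: spannedX3.
  have s2 f : sp f -> sp (y2 * f) by apply: spannedX3.
  have hs i : (i < size s)%N -> sp s`_i.
    by move=> i_s; apply: spanned_ideal; apply: mem_ideal_seq; apply: mem_nth.
  have buu : sp (u * u).
    by rewrite (pv_uu y0 y1 y2 u v) -/w1; closure_tac sD sN sM s0 s1 s2.
  have bvv : sp (v * v).
    by rewrite (pv_vv y0 y1 y2 u v) -/w2; closure_tac sD sN sM s0 s1 s2.
  have buv : sp (u * v).
    rewrite [u * v]mpoly_half; apply: spannedZ; rewrite (pv_uv y0 y1 y2 u v) -/w0 -/w1 -/w2.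
    by closure_tac sD sN sM s0 s1 s2.
  have buw1 : sp (u * w1).
    rewrite (pv_uE y1 y2 u v y1); apply: (sD); first exact: (hs 3).
    by closure_tac sD sN sM s0 s1 s2.
  have buw2 : sp (u * w2).
    rewrite (pv_uE y1 y2 u v y2); apply: (sD); first exact: (hs 4).
    by closure_tac sD sN sM s0 s1 s2.
  have bvw1 : sp (v * w1).
    rewrite (pv_vE y1 y2 u v y1); apply: (sD); first exact: (hs 5).
    by closure_tac sD sN sM s0 s1 s2.
  have bvw2 : sp (v * w2).
    rewrite (pv_vE y1 y2 u v y2); apply: (sD); first exact: (hs 6).
    by closure_tac sD sN sM s0 s1 s2.
  have buw0 : sp (u * w0).
    rewrite /w0 pv_uw0 -/w1 -/w2.
    by closure_tac sD sN sM s0 s1 s2.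
  have bvw0 : sp (v * w0).
    rewrite /w0 pv_vw0 -/w1 -/w2.
    by closure_tac sD sN sM s0 s1 s2.
  have bvu : sp (v * u) by rewrite mulrC.
  apply: spanned_all3 => // -[[|[|[|[|[|//]]]]] i5] // [|[|[|[|[|[|//]]]]]] _ _;
    by rewrite (bool_irrelevance i5 isT) /= ?mulr1.
move=> c; rewrite !big_ord_recr big_ord0 /= add0r => h.
(* The values of [u], [v] and [w_i] are [t0 t1 - t1 t2], [t0 t2 - t1 t2] and [2 y_i t1 t2]. Hence
   [c 3], [c 4], [c 5] occur only in the coefficient of [t1 t2], and once [c 1] and [c 2] vanish
   they form a syzygy of the [y_i]. *)
have [c0 c1 c2 c345] : [/\ c 0%N = 0, c 1%N = 0, c 2%N = 0 &
   ('x_(3, 0) * c 3%N + 'x_(3, 1) * c 4%N + 'x_(3, 2) * c 5%N) *+ 2 - c 1%N - c 2%N = 0].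
  apply: parity => t0 t1 t2; rewrite -[RHS](h t0 t1 t2).
  by rewrite /w0 /w1 /w2 /pv_w0 /pv_w1 /pv_w2 !meval_simp !meval_relabel_pt /sq3 /=; ring.
rewrite c1 c2 !subr0 in c345.
have [p [q [r [c3 c4 c5]]]] := koszul3 (double_eq0 c345).
rewrite c0 c1 c2 c3 c4 c5 /relabel !rmorph0 !mul0r !addr0 add0r.
have E0 : relabel (w 5) 'x_(3, 0) = y0 by apply: relabel_w.
have E1 : relabel (w 5) 'x_(3, 1) = y1 by apply: relabel_w.
have E2 : relabel (w 5) 'x_(3, 2) = y2 by apply: relabel_w.
have hs i : (i < size s)%N -> ideal_of_seq s s`_i by move=> i_s; apply/mem_ideal_seq/mem_nth.
rewrite !rmorphD !rmorphN !rmorphM /= -!/(relabel _ _) E0 E1 E2.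
set P := relabel _ p; set Q := relabel _ q; set S := relabel _ r.
rewrite (pv_koszul y0 y1 y2 u v P Q S); apply: ideal_seqB; first apply: ideal_seqB.
- by apply: ideal_seqM; apply: (hs 0).
- by apply: ideal_seqM; apply: (hs 1).
by apply: ideal_seqM; apply: (hs 2).
Qed.
End NonMonomialKernels.

(** * Irredundancy of the generating forms *)

Section MinimalGenerators.
Variable K : numClosedFieldType.

Lemma forms_nseq (F : fieldType) n d (s : seq {mpoly F[n]}) :
  {in s, forall g, g \is d.-homog} -> forms_of_degrees (nseq (size s) d) s.
Proof.
move=> hs; split=> [|i si]; first by rewrite size_nseq.
by rewrite nth_nseq si; apply/hs/mem_nth.
Qed.

(* Working over int lets vm_compute decide whether the functionals are dual to s. *)
Lemma irredundant_int_eval r d (s : seq {mpoly K[r]}) (M : nat -> seq int -> int)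
    (l : seq (seq (int * seq int))) :
    {in s, forall g, g \is d.-homog} ->
    (forall j a, (j < size s)%N -> (s`_j).@[fun i => (nth 0 a i)%:~R] = (M j a)%:~R) ->
    (let ns := iota 0 (size s) in
     all (fun i => all (fun j =>
       (foldr (fun ca x => ca.1 * M j ca.2 + x) 0 (nth [::] l i) == 0) == (i != j)) ns) ns) ->
  irredundant s.
Proof.
move=> hs hM /allP hl.
apply: (@irredundant_eval_comb _ _ d _ (fun i =>
  [seq (ca.1%:~R, fun i : 'I_r => (nth 0 ca.2 i)%:~R) | ca <- nth [::] l i])) => // i j si sj.
have := hl i; rewrite mem_iota => /(_ si) /allP /(_ j).
rewrite mem_iota => /(_ sj) /eqP <-.
rewrite -(intr_eq0 K) /eval_comb; congr (_ == _).
elim: (nth [::] l i) => [|ca t IHt] /=; first by rewrite big_nil.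
by rewrite big_cons /= IHt hM // rmorphD rmorphM.
Qed.

Lemma squares_minimally_generated :
  minimally_generated (@eval_kernel K 3 (fun t0 t1 t2 => [:: t0 ^+ 2; t1 ^+ 2; t2 ^+ 2])) [::].
Proof.
exists [::]; split=> // f; rewrite squares_kernel.
by split=> [->|/ideal_seq_nil //]; apply: ideal_seq0.
Qed.

Lemma cone_minimally_generated :
  minimally_generated
    (@eval_kernel K 4 (fun t0 t1 t2 => [:: t0 ^+ 2; t1 ^+ 2; t2 ^+ 2; t0 * t1])) [:: 2].
Proof.
have hom : {in [:: cone_quadric K], forall g, g \is 2.-homog}.
  by move=> g; rewrite inE => /eqP ->; rewrite /cone_quadric; homog_tac.
exists [:: cone_quadric K]; split; [exact: (forms_nseq hom)|exact: cone_kernel|].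
apply: (irredundant_int_eval (M := fun _ a => a`_3 * a`_3 - a`_0 * a`_1)
  (l := [:: [:: (1, [:: 0; 0; 0; 1])]]) hom) => [[|//] a _|//].
by rewrite /= /cone_quadric !meval_simp /= !rmorphB !rmorphM.
Qed.

Lemma steiner_minimally_generated :
  minimally_generated
    (@eval_kernel K 4 (fun t0 t1 t2 =>
     [:: t0 ^+ 2; t1 ^+ 2; t2 ^+ 2; t0 * t1 + t0 * t2 + t1 * t2])) [:: 4].
Proof.
have hom : {in [:: steiner_quartic K], forall g, g \is 4.-homog}.
  move=> g; rewrite inE => /eqP ->; rewrite /steiner_quartic /quartic_form /sym2.
  by homog_tac; exact: dhomog1.
exists [:: steiner_quartic K]; split; [exact: (forms_nseq hom)|exact: steiner_kernel|].
apply: (irredundant_int_eval (M := fun _ a => quartic_form a`_0 a`_1 a`_2 a`_3)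
  (l := [:: [:: (1, [:: 0; 0; 0; 1])]]) hom) => [[|//] a _|//].
rewrite /= /steiner_quartic /quartic_form /sym2 !meval_simp /=.
by rewrite !(rmorphD, rmorphN, rmorphMn, rmorphM, rmorph1).
Qed.

Lemma veronese_minimally_generated :
  minimally_generated
    (@eval_kernel K 6 (fun t0 t1 t2 =>
     [:: t0 ^+ 2; t1 ^+ 2; t2 ^+ 2; t0 * t1; t0 * t2; t1 * t2])) (nseq 6 2%N).
Proof.
have hom : {in veronese_quadrics K, forall g, g \is 2.-homog}.
  by move=> g; rewrite !inE => /or3P[||/or3P[||/orP[]]] /eqP ->; homog_tac.
exists (veronese_quadrics K); split; [exact: (forms_nseq hom)|exact: veronese_kernel|].
(* Polarization: for a quadratic form, [q(e_i + e_j) - q(e_i) - q(e_j)] is the coefficient of the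
   product of variables [i] and [j]. Coordinates past the end of a list read as zero. *)
pose e i : seq int := ncons i 0 [:: 1]; pose e2 i j : seq int := set_nth 0 (e i) j 1.
apply: (irredundant_int_eval
  (M := fun j a => nth 0 [:: a`_3 * a`_3 - a`_0 * a`_1; a`_4 * a`_4 - a`_0 * a`_2;
     a`_5 * a`_5 - a`_1 * a`_2; a`_3 * a`_4 - a`_0 * a`_5; a`_3 * a`_5 - a`_1 * a`_4;
     a`_4 * a`_5 - a`_2 * a`_3] j)
  (l := [:: [:: (1, e 3%N)]; [:: (1, e 4%N)]; [:: (1, e 5%N)];
    [:: (1, e2 3%N 4%N); (-1, e 3%N); (-1, e 4%N)];
    [:: (1, e2 3%N 5%N); (-1, e 3%N); (-1, e 5%N)];
    [:: (1, e2 4%N 5%N); (-1, e 4%N); (-1, e 5%N)]]) hom); last by vm_compute.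
by move=> [|[|[|[|[|[|//]]]]]] a _ /=; rewrite !meval_simp /= !rmorphB !rmorphM.
Qed.

Lemma pv_minimally_generated :
  minimally_generated
    (@eval_kernel K 5 (fun t0 t1 t2 =>
     [:: t0 ^+ 2; t1 ^+ 2; t2 ^+ 2; t1 * (t0 - t2); t2 * (t0 - t1)])) (nseq 7 3%N).
Proof.
have hom : {in pv_gens K, forall g, g \is 3.-homog}.
  move=> g; rewrite !inE => /or3P[||/or3P[||/or3P[]]] /eqP ->;
  by rewrite /pv_u /pv_v /pv_w0 /pv_w1 /pv_w2; homog_tac.
exists (pv_gens K); split; [exact: (forms_nseq hom)|exact: pv_kernel|].
(* Where all [y_i] are zero, the first three cubics vanish and the other four become [- u^3],
   [- u v^2], [- u^2 v], [- v^3]; the last four functionals isolate these monomials up to a factor.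
   Where [u = v = 0], the first three are [y_i y_j (y_i - y_j)], visible at a point with coordinates
   2 and 1; the remaining terms cancel the values of the last four cubics there. *)
pose ev (c : int) (y0 y1 y2 u v : int) := (c, [:: y0; y1; y2; u; v]).
apply: (irredundant_int_eval
  (M := fun j a => (pv_cubics a`_0 a`_1 a`_2 a`_3 a`_4)`_j)
  (l := [:: [:: ev 1 2 1 0 0 0; ev (-2) 0 0 0 1 0];
            [:: ev 1 2 0 1 0 0; ev (-2) 0 0 0 0 1];
            [:: ev 1 0 2 1 0 0; ev 4 0 0 0 1 0; ev 2 0 0 0 0 1; ev 3 0 0 0 1 1;
                ev (-3) 0 0 0 1 (-1); ev (-6) 0 0 0 0 1];
            [:: ev 1 0 0 0 1 0];
            [:: ev 1 0 0 0 1 1; ev 1 0 0 0 1 (-1); ev (-2) 0 0 0 1 0];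
            [:: ev 1 0 0 0 1 1; ev (-1) 0 0 0 1 (-1); ev (-2) 0 0 0 0 1];
            [:: ev 1 0 0 0 0 1]]) hom); last by vm_compute.
move=> [|[|[|[|[|[|[|//]]]]]]] a _ /=; rewrite /pv_u /pv_v /pv_w0 /pv_w1 /pv_w2 !meval_simp /=;
by rewrite !(rmorphD, rmorphN, rmorphMn, rmorphM).
Qed.

End MinimalGenerators.

(** * Regularity of the two quadrics belonging to a reducible conic *)

Section NodeRegular.
Variable K : numClosedFieldType.

Lemma node_forms : forms_of_degrees (nseq 2 2%N) (node_quadrics K).
Proof.
apply: (@forms_nseq _ _ 2 (node_quadrics K)) => g.
by rewrite !inE => /orP[] /eqP ->; homog_tac.
Qed.

Let q0 := nth 0 (node_quadrics K) 0.
Let q1 := nth 0 (node_quadrics K) 1.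
(** Every variable except number 3; over these, polynomials modulo [q0] are spanned by 1 and
    variable 3. *)
Let idx : 'I_4 -> 'I_5 :=
  tnth [tuple @Ordinal 5 0 isT; @Ordinal 5 1 isT; @Ordinal 5 2 isT; @Ordinal 5 4 isT].

Lemma ord4P (Q : 'I_4 -> Prop) : Q (@Ordinal 4 0 isT) -> Q (@Ordinal 4 1 isT) ->
  Q (@Ordinal 4 2 isT) -> Q (@Ordinal 4 3 isT) -> forall i, Q i.
Proof.
by move=> Q0 Q1 Q2 Q3 [[|[|[|[|//]]]] i4]; rewrite (bool_irrelevance i4 isT).
Qed.

Lemma spanned_mod_q0 f : spanned idx [:: q0] [:: 1; 'x_(5, 3)] f.
Proof.
have sp1 : spanned idx [:: q0] [:: 1; 'x_(5, 3)] 1 by apply: (spanned_nth _ _ (j := 0)).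
have left (k : 'I_4) i : i = idx k -> exists l, i = idx l by exists k.
move: f; apply: spanned_all => // -[[|[|[|[|[|//]]]]] i5]; rewrite (bool_irrelevance i5 isT).
- by left; apply: (left (@Ordinal 4 0 isT)).
- by left; apply: (left (@Ordinal 4 1 isT)).
- by left; apply: (left (@Ordinal 4 2 isT)).
- right=> -[|[|//]] _ /=; first by rewrite mulr1; apply: (spanned_nth _ _ (j := 1)).
  have -> : 'x_(5, 3) * 'x_(5, 3) = q0 + 'x_(5, 0) * ('x_(5, 2) * 1) :> {mpoly K[5]}.
    by rewrite /q0 /= mulr1 subrK.
  apply: spannedD; first by apply: spanned_ideal; apply: mem_ideal_seq; rewrite inE.
  by apply: (spannedX (@Ordinal 4 0 isT)); apply: (spannedX (@Ordinal 4 2 isT)).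
by left; apply: (left (@Ordinal 4 3 isT)).
Qed.

(** Points of the zero locus of [q0] with all four remaining coordinates given as squares, so that a
    sign change of [t] at index 0 separates the two coefficients of a normal form. *)
Let z (t : 'I_4 -> K) : 'I_5 -> K :=
  pt 5 [:: t (@Ordinal 4 0 isT) ^+ 2; t (@Ordinal 4 1 isT) ^+ 2; t (@Ordinal 4 2 isT) ^+ 2;
    t (@Ordinal 4 0 isT) * t (@Ordinal 4 2 isT); t (@Ordinal 4 3 isT) ^+ 2].

Lemma meval_relabel_z c t : (relabel idx c).@[z t] = c.@[fun i => t i ^+ 2].
Proof. by rewrite meval_relabel; apply: meval_eq; elim/ord4P. Qed.

Lemma even_odd_eq0 (c d : {mpoly K[4]}) :
    (forall t : 'I_4 -> K, c.@[fun i => t i ^+ 2] +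
       t (@Ordinal 4 0 isT) * t (@Ordinal 4 2 isT) * d.@[fun i => t i ^+ 2] = 0) ->
  c = 0 /\ d = 0.
Proof.
move=> h; pose flip (t : 'I_4 -> K) i := if i == @Ordinal 4 0 isT then - t i else t i.
have flip2 (e : {mpoly K[4]}) t : e.@[fun i => flip t i ^+ 2] = e.@[fun i => t i ^+ 2].
  by apply: meval_eq => i; rewrite /flip; case: ifP => // _; rewrite sqrrN.
have c0 t : c.@[fun i => t i ^+ 2] = 0.
  have n2 : 2%:R != 0 :> K by rewrite pnatr_eq0.
  apply: (mulfI n2); rewrite mulr0 -[RHS](addr0 0) -{1}(h t) -(h (flip t)) !flip2 /flip /=.
  by ring.
split; first by apply: (@monomial_sq_eval0 _ 4 0%MM) => t; rewrite c0 mulr0.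
apply: (@monomial_sq_eval0 _ 4 (U_(@Ordinal 4 0 isT) + U_(@Ordinal 4 2 isT))%MM) => t.
have := h t; rewrite c0 add0r => e; rewrite -[RHS]e; congr (_ * _).
by rewrite -mevalX mpolyXD mevalM !mevalXU.
Qed.

(** [q1] does not involve variable 3, so it multiplies both coefficients of a normal form by the
    same nonzero [S]; vanishing on the zero locus of [q0] then forces both coefficients to be
    zero. *)
Lemma q1_regular g : ideal_of_seq [:: q0] (g * q1) -> ideal_of_seq [:: q0] g.
Proof.
have [c hc] := spanned_mod_q0 g.
pose T := \sum_(j < 2) relabel idx (c j) * [:: 1; 'x_(5, 3)]`_j.
rewrite -[\sum_(j < size _) _]/T in hc; rewrite -[g](subrK T); move=> hg; apply: ideal_seqD => //.
have {hg}hT : ideal_of_seq [:: q0] (T * q1).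
  have := ideal_seqB hg (ideal_seqM q1 hc).
  by rewrite [q1 * _]mulrC -mulrBl [_ + T]addrC addrK.
have zT t : (T * q1).@[z t] = 0.
  move: hT; apply: (ideal_seq_min (J := fun f => f.@[z t] = 0)).
    exact: (ker_is_ideal (meval _)).
  by move=> f; rewrite inE => /eqP ->; rewrite /q0 !meval_simp /z /=; ring.
pose S : {mpoly K[4]} := 'x_(4, 3) * 'x_(4, 3) - 'x_(4, 1) * 'x_(4, 2).
have S0 : S != 0.
  apply/eqP => /(congr1 (meval (pt 4 [:: 0; 0; 0; 1]))).
  by rewrite meval0 !meval_simp /= !mul0r mulr1 subr0 => /eqP; rewrite oner_eq0.
have [c0 c1] : c 0%N * S = 0 /\ c 1%N * S = 0.
  apply: even_odd_eq0 => t; rewrite -[RHS](zT t) /T !big_ord_recr big_ord0 /= add0r /q1.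
  by rewrite !meval_simp !meval_relabel_z /z /=; ring.
have cancel_S (e : {mpoly K[4]}) : e * S = 0 -> e = 0.
  by move/eqP; rewrite mulf_eq0 (negbTE S0) orbF => /eqP.
rewrite /T !big_ord_recr big_ord0 /= (cancel_S _ c0) (cancel_S _ c1) /relabel rmorph0 !mul0r !addr0.
exact: ideal_seq0.
Qed.

Lemma node_regular : regular_sequence (node_quadrics K).
Proof.
split=> [h|[|[|//]] _ g].
- suff: (1 : {mpoly K[5]}).@[fun _ => 0] = 0 by rewrite meval1 => /eqP; rewrite oner_eq0.
  move: h; apply: (ideal_seq_min (J := fun f => f.@[fun _ => 0] = 0)).
    exact: (ker_is_ideal (meval _)).
  by move=> f; rewrite !inE => /orP[] /eqP ->; rewrite !meval_simp !mul0r subr0.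
- move/ideal_seq_nil/eqP; rewrite mulf_eq0 => /orP[/eqP ->|]; first exact: ideal_seq0.
  move=> /eqP /(congr1 (meval (pt 5 [:: 0; 0; 0; 1; 0]))).
  by rewrite meval0 !meval_simp /= !mul0r mulr1 subr0 => /eqP; rewrite oner_eq0.
exact: q1_regular.
Qed.

End NodeRegular.

(** * Dual bases and conics *)

Section Frames.
Variables (K : numClosedFieldType) (W : vectType K).
Implicit Types (f l : dual W) (q : Sym W).

(** The value is typed in [K] instead of [K^o], so that field computations apply to it. *)
Definition ev f (w : W) : K := f w.

Lemma evD f v w : ev f (v + w) = ev f v + ev f w.
Proof. by rewrite /ev linearD. Qed.
Lemma evZ f c w : ev f (c *: w) = c * ev f w.
Proof. by rewrite /ev linearZ. Qed.
Lemma evDl f g w : ev (f + g) w = ev f w + ev g w.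
Proof. by rewrite /ev add_lfunE. Qed.
Lemma evZl c f w : ev (c *: f) w = c * ev f w.
Proof. by rewrite /ev scale_lfunE. Qed.
Lemma ev0l w : ev 0 w = 0.
Proof. by rewrite /ev zero_lfunE. Qed.
Lemma ev0 f : ev f 0 = 0.
Proof. by rewrite /ev linear0. Qed.
Lemma ev_inj f g : (forall w, ev f w = ev g w) -> f = g.
Proof. by move=> h; apply/lfunP. Qed.
Lemma ev_sum f I (r : seq I) (P : pred I) (F : I -> W) :
  ev f (\sum_(i <- r | P i) F i) = \sum_(i <- r | P i) ev f (F i).
Proof. by rewrite /ev linear_sum. Qed.

Lemma sym_evalE q f : sym_eval q f = q.@[fun j => ev f (vbasis {:W})`_j].
Proof. by []. Qed.

Lemma sym_evalD q q' f : sym_eval (q + q') f = sym_eval q f + sym_eval q' f.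
Proof. exact: mevalD. Qed.
Lemma sym_evalM q q' f : sym_eval (q * q') f = sym_eval q f * sym_eval q' f.
Proof. exact: mevalM. Qed.
Lemma sym_evalZ c q f : sym_eval (c *: q) f = c * sym_eval q f.
Proof. exact: mevalZ. Qed.
Lemma sym_eval0 f : sym_eval 0 f = 0.
Proof. exact: meval0. Qed.

Lemma coord_vbasis_sum (w : W) : w = \sum_i coord (vbasis {:W}) i w *: (vbasis {:W})`_i.
Proof. by apply: coord_vbasis; apply: memvf. Qed.

Lemma coord_vbasis_delta (i j : 'I_(\dim {:W})) :
  coord (vbasis {:W}) i (vbasis {:W})`_j = (i == j)%:R.
Proof. by rewrite (coord_free _ _ (basis_free (vbasisP _))) eq_sym. Qed.

Lemma sym_eval_inj q q' : (forall f, sym_eval q f = sym_eval q' f) -> q = q'.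
Proof.
move=> h; apply/eqP; rewrite -subr_eq0; apply/eqP; apply: mpoly_eval0 => v.
pose f : dual W := \sum_j v j *: linfun (coord (vbasis {:W}) j : W -> K^o).
have fE (j : 'I_(\dim {:W})) : ev f (vbasis {:W})`_j = v j.
  rewrite /ev /f sum_lfunE (bigD1 j) //= big1 ?addr0 => [|k kj].
    by rewrite scale_lfunE lfunE /= coord_vbasis_delta eqxx /GRing.scale /= mulr1.
  by rewrite scale_lfunE lfunE /= coord_vbasis_delta (negbTE kj) /GRing.scale /= mulr0.
have := h f; rewrite !sym_evalE !(meval_eq _ fE) mevalB => ->.
by rewrite subrr.
Qed.

Definition lin (w : W) : Sym W := \sum_i coord (vbasis {:W}) i w *: 'X_i.

Lemma sym_eval_lin w f : sym_eval (lin w) f = ev f w.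
Proof.
rewrite [in RHS](coord_vbasis_sum w) ev_sum sym_evalE /lin raddf_sum /=.
by apply: eq_bigr => i _; rewrite mevalZ mevalXU evZ.
Qed.

Lemma lin_homog w : lin w \is 1.-homog.
Proof. by apply: rpred_sum => i _; apply: dhomogZ; apply: homog_var. Qed.

Lemma homog1_eval q : q \is 1.-homog -> exists w, forall f, sym_eval q f = ev f w.
Proof.
move=> hq; rewrite [q]mpolyE big_seq; elim/big_rec: _ => [|m p mq [w hw]].
  by exists 0 => f; rewrite sym_eval0 ev0.
have /mdeg1P [j /eqP ->] : mdeg m == 1%N by rewrite -(dhomog_mf hq mq).
exists (q@_(U_(j)) *: (vbasis {:W})`_j + w) => f.
by rewrite sym_evalD hw evD evZ sym_evalZ sym_evalE mevalXU.
Qed.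

Lemma homog2_evalZ q c f : q \is 2.-homog -> sym_eval q (c *: f) = c ^+ 2 * sym_eval q f.
Proof.
move=> hq; rewrite !sym_evalE -(homog_evalZ _ _ hq).
by apply: meval_eq => j; rewrite evZl.
Qed.

Definition qf (c0 c1 c2 c3 c4 c5 x0 x1 x2 : K) : K :=
  c0 * x0 ^+ 2 + c1 * x1 ^+ 2 + c2 * x2 ^+ 2 + c3 * (x0 * x1) + c4 * (x0 * x2) + c5 * (x1 * x2).

Lemma homog2_eval3 (p : {mpoly K[3]}) : p \is 2.-homog ->
  exists c0 c1 c2 c3 c4 c5, forall x0 x1 x2,
    p.@[pt 3 [:: x0; x1; x2]] = qf c0 c1 c2 c3 c4 c5 x0 x1 x2.
Proof.
move=> hp; rewrite [p]mpolyE big_seq; elim/big_rec: _ => [|m r mp].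
  by exists 0, 0, 0, 0, 0, 0 => x0 x1 x2; rewrite meval0 /qf; ring.
move=> [c0 [c1 [c2 [c3 [c4 [c5 hc]]]]]].
have hm x0 x1 x2 : 'X_[m].@[pt 3 [:: x0; x1; x2]] =
    x0 ^+ m (@Ordinal 3 0 isT) * (x1 ^+ m (@Ordinal 3 1 isT) * x2 ^+ m (@Ordinal 3 2 isT)).
  rewrite mevalX !big_ord_recl big_ord0 mulr1 /=.
  by congr (_ ^+ m _ * (_ ^+ m _ * _ ^+ m _)); apply: val_inj.
have : mdeg m = 2%N := dhomog_mf hp mp.
rewrite mdegE !big_ord_recl big_ord0 addn0.
have -> : lift ord0 (lift ord0 ord0) = @Ordinal 3 2 isT by apply: val_inj.
have -> : lift ord0 ord0 = @Ordinal 3 1 isT by apply: val_inj.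
have -> : ord0 = @Ordinal 3 0 isT by apply: val_inj.
have hD x0 x1 x2 := mevalD (pt 3 [:: x0; x1; x2]) (p@_m *: 'X_[m]) r.
case: (m _) hm => [|[|[|m0]]]; case: (m _) => [|[|[|m1]]]; case: (m _) => [|[|[|m2]]] // hm _.
- exists c0, c1, (c2 + p@_m), c3, c4, c5 => x0 x1 x2.
  by rewrite hD mevalZ hm hc /qf; ring.
- exists c0, c1, c2, c3, c4, (c5 + p@_m) => x0 x1 x2.
  by rewrite hD mevalZ hm hc /qf; ring.
- exists c0, (c1 + p@_m), c2, c3, c4, c5 => x0 x1 x2.
  by rewrite hD mevalZ hm hc /qf; ring.
- exists c0, c1, c2, c3, (c4 + p@_m), c5 => x0 x1 x2.
  by rewrite hD mevalZ hm hc /qf; ring.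
- exists c0, c1, c2, (c3 + p@_m), c4, c5 => x0 x1 x2.
  by rewrite hD mevalZ hm hc /qf; ring.
exists (c0 + p@_m), c1, c2, c3, c4, c5 => x0 x1 x2.
by rewrite hD mevalZ hm hc /qf; ring.
Qed.

(** A basis of [W] together with its dual basis. Keeping both allows either side to be prescribed:
    functionals, when three points of [Z] become coordinate points, or vectors, when the factors of
    a reducible conic become coordinates. *)
Record frame (e0 e1 e2 : W) (l0 l1 l2 : dual W) : Prop := Frame {
  frame_sum : forall w, w = ev l0 w *: e0 + ev l1 w *: e1 + ev l2 w *: e2;
  frame0 : [/\ ev l0 e0 = 1, ev l0 e1 = 0 & ev l0 e2 = 0];
  frame1 : [/\ ev l1 e0 = 0, ev l1 e1 = 1 & ev l1 e2 = 0];
  frame2 : [/\ ev l2 e0 = 0, ev l2 e1 = 0 & ev l2 e2 = 1] }.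

Section FrameTheory.
Variables (e0 e1 e2 : W) (l0 l1 l2 : dual W).
Hypothesis fr : frame e0 e1 e2 l0 l1 l2.

Definition frameE := (And3 (frame0 fr) (frame1 fr) (frame2 fr)).

Lemma frame_dual f : f = ev f e0 *: l0 + ev f e1 *: l1 + ev f e2 *: l2.
Proof.
apply: ev_inj => w; rewrite [in LHS](frame_sum fr w) !(evD, evZ, evDl, evZl).
by congr (_ + _ + _); rewrite mulrC.
Qed.

Definition fpt x0 x1 x2 : dual W := x0 *: l0 + x1 *: l1 + x2 *: l2.

Lemma ev_fpt x0 x1 x2 : [/\ ev (fpt x0 x1 x2) e0 = x0, ev (fpt x0 x1 x2) e1 = x1
  & ev (fpt x0 x1 x2) e2 = x2].
Proof.
have [[h1 h2 h3] [h4 h5 h6] [h7 h8 h9]] := frameE.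
by split; rewrite !(evDl, evZl) ?h1 ?h2 ?h3 ?h4 ?h5 ?h6 ?h7 ?h8 ?h9
  !mulr0 ?mulr1 ?addr0 ?add0r.
Qed.

Definition fvec t0 t1 t2 : W := t0 *: e0 + t1 *: e1 + t2 *: e2.

Lemma ev_fvec f t0 t1 t2 : ev f (fvec t0 t1 t2) = t0 * ev f e0 + t1 * ev f e1 + t2 * ev f e2.
Proof. by rewrite !evD !evZ. Qed.

Definition quad (c0 c1 c2 c3 c4 c5 : K) : Sym W :=
  c0 *: (lin e0 * lin e0) + c1 *: (lin e1 * lin e1) + c2 *: (lin e2 * lin e2)
  + c3 *: (lin e0 * lin e1) + c4 *: (lin e0 * lin e2) + c5 *: (lin e1 * lin e2).

Lemma sym_eval_quad c0 c1 c2 c3 c4 c5 f : sym_eval (quad c0 c1 c2 c3 c4 c5) f =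
  qf c0 c1 c2 c3 c4 c5 (ev f e0) (ev f e1) (ev f e2).
Proof. by rewrite !(sym_evalD, sym_evalZ, sym_evalM) !sym_eval_lin /qf !expr2. Qed.

Lemma quad_homog c0 c1 c2 c3 c4 c5 : quad c0 c1 c2 c3 c4 c5 \is 2.-homog.
Proof.
have hZ c v w : c *: (lin v * lin w) \is 2.-homog.
  by apply: dhomogZ; apply: (dhomogM (lin_homog v) (lin_homog w)).
by repeat first [exact: hZ | apply: rpredD].
Qed.

Lemma qf_eq0 c0 c1 c2 c3 c4 c5 : (forall x0 x1 x2, qf c0 c1 c2 c3 c4 c5 x0 x1 x2 = 0) ->
  [/\ c0 = 0, c1 = 0 & c2 = 0] /\ [/\ c3 = 0, c4 = 0 & c5 = 0].
Proof.
move=> h.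
have h0 : c0 = 0 by rewrite -(h 1 0 0) /qf; ring.
have h1 : c1 = 0 by rewrite -(h 0 1 0) /qf; ring.
have h2 : c2 = 0 by rewrite -(h 0 0 1) /qf; ring.
split; first by split.
split.
- by rewrite -(h 1 1 0) /qf h0 h1; ring.
- by rewrite -(h 1 0 1) /qf h0 h2; ring.
- by rewrite -(h 0 1 1) /qf h1 h2; ring.
Qed.

Lemma quad_eval_all q : q \is 2.-homog ->
  exists c0 c1 c2 c3 c4 c5, forall f,
    sym_eval q f = qf c0 c1 c2 c3 c4 c5 (ev f e0) (ev f e1) (ev f e2).
Proof.
move=> hq; pose A : 'M[K]_(\dim {:W}, 3) :=
  let v j := (vbasis {:W})`_j in
  \matrix_(j, i) nth 0 [:: ev l0 (v j); ev l1 (v j); ev l2 (v j)] i.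
have [c0 [c1 [c2 [c3 [c4 [c5 hc]]]]]] := homog2_eval3 (msub_homog A hq).
exists c0, c1, c2, c3, c4, c5 => f; rewrite -hc meval_msub sym_evalE; apply: meval_eq => j.
rewrite {1}[f]frame_dual !(evDl, evZl) !big_ord_recl big_ord0 !mxE /= addr0 addrA.
by rewrite ![ev _ (vbasis _)`_j * _]mulrC.
Qed.

End FrameTheory.
End Frames.

Lemma rank_col_inj (K : fieldType) N r (C : 'M[K]_(N, r)) :
    (forall c : 'I_r -> K, (forall i, \sum_j C i j * c j = 0) -> forall j, c j = 0) ->
  \rank C = r.
Proof.
move=> h; rewrite -mxrank_tr; apply/eqP; apply: inj_row_free => v vC.
apply/rowP => j; rewrite mxE; apply: (h (fun j => v 0 j)) => i.
have /matrixP /(_ 0 i) := vC; rewrite !mxE => {2}<-.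
by apply: eq_bigr => k _; rewrite mxE mulrC.
Qed.

Lemma sum_ord3 (V : nmodType) (F : 'I_3 -> V) :
  \sum_i F i = F (@Ordinal 3 0 isT) + F (@Ordinal 3 1 isT) + F (@Ordinal 3 2 isT).
Proof.
rewrite !big_ord_recl big_ord0 addr0 addrA.
by congr (F _ + F _ + F _); apply: val_inj.
Qed.

(** * Existence and change of frames *)

Section FrameExistence.
Variables (K : numClosedFieldType) (W : vectType K).
Hypothesis dimW : \dim {:W} = 3%N.
Local Notation o0 := (@Ordinal 3 0 isT).
Local Notation o1 := (@Ordinal 3 1 isT).
Local Notation o2 := (@Ordinal 3 2 isT).

Lemma frame_of_basis (X : 3.-tuple W) : basis_of {:W} X ->
  exists l0 l1 l2, frame X`_0 X`_1 X`_2 l0 l1 l2.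
Proof.
move=> bX; pose l i : dual W := linfun (coord X i : W -> K^o).
have lE i w : ev (l i) w = coord X i w by rewrite /ev /l lfunE.
have lX (i j : 'I_3) : ev (l i) X`_j = (i == j)%:R.
  by rewrite lE (coord_free _ _ (basis_free bX)) eq_sym.
exists (l o0), (l o1), (l o2); split; last first.
- by split; [exact: (lX o2 o0)|exact: (lX o2 o1)|exact: (lX o2 o2)].
- by split; [exact: (lX o1 o0)|exact: (lX o1 o1)|exact: (lX o1 o2)].
- by split; [exact: (lX o0 o0)|exact: (lX o0 o1)|exact: (lX o0 o2)].
by move=> w; rewrite [LHS](coord_basis bX (memvf w)) sum_ord3 !lE.
Qed.

Lemma frame_exists : exists e0 e1 e2 l0 l1 l2, @frame K W e0 e1 e2 l0 l1 l2.
Proof.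
have := vbasisP {:W}; move: (vbasis {:W}); rewrite dimW => X bX.
by exists X`_0, X`_1, X`_2; apply: frame_of_basis.
Qed.

Lemma frame_extend (A B : W) : free [:: A; B] ->
  exists e2 l0 l1 l2, @frame K W A B e2 l0 l1 l2.
Proof.
move=> fAB; have : ~~ ({:W} <= <<[:: A; B]>>)%VS.
  by apply/negP => /dimvS; rewrite dimW (eqnP fAB).
case/subvPn => C _ CAB.
have fX : free [:: C; A; B] by rewrite free_cons CAB.
have pX : perm_eq [:: A; B; C] [:: C; A; B].
  by rewrite -[X in perm_eq X]/([:: A; B] ++ [:: C]) perm_catC.
have bX : basis_of {:W} [tuple A; B; C].
  by rewrite basisEfree (perm_free pX) fX subvf dimW.
by exists C; apply: frame_of_basis bX.
Qed.

(** The dual vectors of the new functionals are read off the columns of the inverse of their matrix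
    in the old basis. *)
Lemma frame_change e0 e1 e2 l0 l1 l2 (m : 'I_3 -> dual W) :
    @frame K W e0 e1 e2 l0 l1 l2 ->
    (\matrix_(i, j) ev (m i) (nth 0 [:: e0; e1; e2] j)) \in unitmx ->
  exists e0' e1' e2', frame e0' e1' e2' (m o0) (m o1) (m o2).
Proof.
move=> fr; set B := (\matrix_(i, j) _) => uB.
pose x (k : 'I_3) := [:: e0; e1; e2]`_k; pose l (k : 'I_3) := nth 0 [:: l0; l1; l2] k.
pose e (j : 'I_3) := \sum_k (invmx B) k j *: x k.
have me i j : ev (m i) (e j) = (i == j)%:R.
  rewrite ev_sum; transitivity ((B *m invmx B) i j); last by rewrite mulmxV // mxE.
  by rewrite mxE; apply: eq_bigr => k _; rewrite evZ mxE mulrC.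
have wx w : w = \sum_k ev (l k) w *: x k by rewrite [LHS](frame_sum fr) sum_ord3.
exists (e o0), (e o1), (e o2); split; last first.
- by split; rewrite me.
- by split; rewrite me.
- by split; rewrite me.
move=> w; transitivity (\sum_i ev (m i) w *: e i); last by rewrite sum_ord3.
have mw i : ev (m i) w = \sum_k B i k * ev (l k) w.
  by rewrite {1}(wx w) ev_sum; apply: eq_bigr => k _; rewrite evZ mxE mulrC.
rewrite [LHS]wx; under [RHS]eq_bigr do rewrite scaler_sumr.
rewrite exchange_big /=; apply: eq_bigr => p _.
under eq_bigr do rewrite scalerA; rewrite -scaler_suml; congr (_ *: _).
transitivity ((invmx B *m B *m (\col_k ev (l k) w)) p 0).
  by rewrite mulVmx // mul1mx mxE.
rewrite -mulmxA mxE; apply: eq_bigr => i _; rewrite mulrC; congr (_ * _).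
by rewrite mw mxE; apply: eq_bigr => k _; rewrite [(\col__ _) _ _]mxE.
Qed.

Lemma frame_scale e0 e1 e2 l0 l1 l2 (a b c : K) : a != 0 -> b != 0 -> c != 0 ->
  @frame K W e0 e1 e2 l0 l1 l2 ->
  frame (a *: e0) (b *: e1) (c *: e2) (a^-1 *: l0) (b^-1 *: l1) (c^-1 *: l2).
Proof.
move=> a0 b0 c0 fr; have [[h1 h2 h3] [h4 h5 h6] [h7 h8 h9]] := frameE fr.
have sK (d x : K) w : d != 0 -> (d^-1 * x) *: (d *: w) = x *: w :> W.
  by move=> d0; rewrite scalerA mulrAC mulVf // mul1r.
split=> [w||| ]; last first.
- by split; rewrite evZl evZ ?h7 ?h8 ?h9 ?mulr0 ?mulr1 ?mulVf.
- by split; rewrite evZl evZ ?h4 ?h5 ?h6 ?mulr0 ?mulr1 ?mulVf.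
- by split; rewrite evZl evZ ?h1 ?h2 ?h3 ?mulr0 ?mulr1 ?mulVf.
by rewrite !evZl !sK //; apply: frame_sum fr w.
Qed.

Lemma frame_swap01 e0 e1 e2 l0 l1 l2 :
  @frame K W e0 e1 e2 l0 l1 l2 -> frame e1 e0 e2 l1 l0 l2.
Proof.
move=> fr; have [[h1 h2 h3] [h4 h5 h6] [h7 h8 h9]] := frameE fr; split=> // w.
by rewrite {1}[w](frame_sum fr) [_ *: e0 + _]addrC.
Qed.

Lemma frame_swap12 e0 e1 e2 l0 l1 l2 :
  @frame K W e0 e1 e2 l0 l1 l2 -> frame e0 e2 e1 l0 l2 l1.
Proof.
move=> fr; have [[h1 h2 h3] [h4 h5 h6] [h7 h8 h9]] := frameE fr; split=> // w.
by rewrite {1}[w](frame_sum fr) addrAC.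
Qed.

End FrameExistence.

Section Configuration.
Variables (K : numClosedFieldType) (W : vectType K) (N : nat) (ell : 'I_N -> dual W).
Hypothesis dimW : \dim {:W} = 3%N.
Hypothesis ell_inj : forall w, (forall i, ev (ell i) w = 0) -> w = 0.
Local Notation Z := (configuration ell).

Lemma mem_configuration p :
  reflect (exists2 i, ell i != 0 & p = <[ell i]>%VS) (p \in Z).
Proof.
rewrite mem_undup; apply: (iffP mapP) => [[i + ->] | [i i0 ->]].
  by rewrite mem_filter => /andP[i0 _]; exists i.
by exists i; rewrite // mem_filter i0 mem_enum.
Qed.

Lemma conic_throughP q : q \is 2.-homog ->
  conic_through Z q <-> q != 0 /\ (forall i, sym_eval q (ell i) = 0).
Proof.
move=> hq; split=> [[[q0 _] hZ]|[q0 hZ]].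
  split=> // i; have [->|i0] := eqVneq (ell i) 0.
    rewrite -[0 : dual W](scale0r (0 : dual W)) homog2_evalZ // expr0n mul0r.
    by [].
  by apply: (hZ <[ell i]>%VS); rewrite ?memv_line //; apply/mem_configuration; exists i.
split=> // p f /mem_configuration [i i0 ->] /vlineP [k ->].
by rewrite homog2_evalZ // hZ mulr0.
Qed.

(** Injectivity of the embedding means that the coordinate matrix of the [ell i] has rank 3; three
    independent rows give three points of [Z] that serve as coordinate points. *)
Lemma frame_from_configuration : exists s0 s1 s2 e0 e1 e2,
  frame e0 e1 e2 (ell s0) (ell s1) (ell s2).
Proof.
have [x0 [x1 [x2 [m0 [m1 [m2 fr]]]]]] := frame_exists dimW.
pose A : 'M[K]_(N, 3) := \matrix_(i, j) ev (ell i) (nth 0 [:: x0; x1; x2] j).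
have rA : row_full A.
  apply/eqP; apply: rank_col_inj => c hc.
  have w0 : fvec x0 x1 x2 (c (@Ordinal 3 0 isT)) (c (@Ordinal 3 1 isT)) (c (@Ordinal 3 2 isT)) = 0.
    by apply: ell_inj => i; rewrite ev_fvec -[RHS](hc i) sum_ord3 !mxE /= ![_ * c _]mulrC.
  have hf f := ev_fvec x0 x1 x2 f (c (@Ordinal 3 0 isT)) (c (@Ordinal 3 1 isT))
    (c (@Ordinal 3 2 isT)).
  have [[h1 h2 h3] [h4 h5 h6] [h7 h8 h9]] := frameE fr.
  apply: ord3P.
  - by have := hf m0; rewrite w0 ev0 h1 h2 h3 mulr1 !mulr0 !addr0.
  - by have := hf m1; rewrite w0 ev0 h4 h5 h6 mulr1 !mulr0 addr0 add0r.
  - by have := hf m2; rewrite w0 ev0 h7 h8 h9 mulr1 !mulr0 !add0r.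
pose s := fullrankfun rA.
have uB : (\matrix_(i, j) ev (ell (s i)) (nth 0 [:: x0; x1; x2] j)) \in unitmx.
  suff -> : (\matrix_(i, j) ev (ell (s i)) (nth 0 [:: x0; x1; x2] j)) = rowsub s A.
    exact: fullrowsub_unit.
  by apply/matrixP => i j; rewrite !mxE.
have [e0 [e1 [e2 fe]]] := frame_change fr uB.
by exists (s (@Ordinal 3 0 isT)), (s (@Ordinal 3 1 isT)), (s (@Ordinal 3 2 isT)), e0, e1, e2.
Qed.

End Configuration.

Section VanishingIdeal.
Variables (K : numClosedFieldType) (n : nat) (L : {vspace 'rV[K]_n}) (W : vectType K).
Variable (ell : 'I_n -> dual W).
Hypothesis L_neq0 : L != 0%VS.
Hypothesis ell_image : forall x, x \in L <-> exists w, x = \row_i ev (ell i) w.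

(** The vanishing ideal is generated by forms, whereas [f] may be inhomogeneous. Scaling [w] by a
    square root of [c] turns the value of [f] into a polynomial in [c] whose coefficients are the
    values of its homogeneous components, so each component vanishes separately. *)
Lemma vanishing_coord_square f : vanishing_ideal (coord_square L) f <->
  forall w, f.@[fun i => ev (ell i) w ^+ 2] = 0.
Proof.
split=> [[s hs hf] w|hf].
  move: hf; apply: (ideal_seq_min (J := fun f => f.@[fun i => ev (ell i) w ^+ 2] = 0)).
    exact: (ker_is_ideal (meval _)).
  move=> g /hs [_ van]; pose x : 'rV[K]_n := \row_i ev (ell i) w.
  have xL : x \in L by apply/ell_image; exists w.
  have [x0|x0] := eqVneq x 0; last first.
    have := van <[map_mx (fun a => a ^+ 2) x]>%VS _ _ (memv_line _).
    rewrite (meval_eq (v2 := fun i => ev (ell i) w ^+ 2)); first by apply; exists x.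
    by move=> i; rewrite !mxE.
  (* Here [w] maps to the origin, which is no projective point. The origin lies on the line of every
     point, so any nonzero vector of [L] supplies a point at which vanishing can be applied. *)
  have y0 : vpick L != 0 by rewrite vpick0.
  have := van <[map_mx (fun a => a ^+ 2) (vpick L)]>%VS _ _ (mem0v _).
  rewrite (meval_eq (v2 := fun i => ev (ell i) w ^+ 2)).
    by apply; exists (vpick L); split=> //; apply: memv_pick.
  by move=> i; have := congr1 (fun y : 'rV_n => y 0 i) x0; rewrite !mxE => ->; rewrite expr0n.
have comp0 d w : (d < msize f)%N -> (pihomog mdeg d f).@[fun i => ev (ell i) w ^+ 2] = 0.
  move=> df; pose F k := (pihomog mdeg k f).@[fun i => ev (ell i) w ^+ 2].
  pose P : {poly K} := \poly_(k < msize f) F k.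
  suff P0 : P = 0 by have := coef_poly (msize f) F d; rewrite -/P P0 coef0 df.
  apply: poly_eval0 => c; rewrite horner_poly -[RHS](hf (sqrtC c *: w)).
  rewrite [in RHS](pihomog_partitionE (mf := mdeg) (ssrnat.leqnn (msize f))) raddf_sum /=.
  apply: eq_bigr => k _; rewrite mulrC -(homog_evalZ _ _ (pihomogP _ _ _)).
  by apply: meval_eq => i; rewrite evZ exprMn sqrtCK.
exists [seq pihomog mdeg d f | d <- iota 0 (msize f)]; last first.
  set s := (X in ideal_of_seq X _).
  rewrite (pihomog_partitionE (mf := mdeg) (ssrnat.leqnn (msize f))).
  apply: (is_ideal_sum (J := ideal_of_seq s)) => [|d _]; first exact: ideal_seq_is_ideal.
  by apply: mem_ideal_seq; apply/mapP; exists (d : nat); rewrite // mem_iota /=.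
move=> g /mapP [d]; rewrite mem_iota /= => df ->; split.
  by apply/homogP; exists d; apply: pihomogP.
(* A representative [k] times the squared vector of [w] is the squared vector of [sqrtC k *: w]. *)
move=> p [x [/ell_image [w ->] x0 ->]] y /vlineP [k ->].
rewrite -(comp0 d (sqrtC k *: w) df); apply: meval_eq => i.
by rewrite !mxE evZ exprMn sqrtCK.
Qed.

End VanishingIdeal.

(** * The cases of the theorem *)

Definition coef_mx (K : fieldType) N r (row : 'I_N -> seq K) : 'M[K]_(N, r) :=
  \matrix_(i, j) (row i)`_j.

Lemma rank_coef_mx (K : fieldType) N r (row : 'I_N -> seq K) :
    (forall c : nat -> K, (forall i, \sum_(j < r) (row i)`_j * c j = 0) ->
      forall j, (j < r)%N -> c j = 0) ->
  \rank (coef_mx r row) = r.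
Proof.
move=> h; apply: rank_col_inj => c hc j.
pose c' k := oapp c 0 (insub k : option 'I_r).
have c'E (k : 'I_r) : c' k = c k by rewrite /c' valK.
rewrite -c'E; apply: h (ltn_ord j) => i; rewrite -[RHS](hc i).
by apply: eq_bigr => k _; rewrite c'E mxE.
Qed.

Lemma notin3 (T : eqType) (p a b c : T) :
  (p \notin [:: a; b; c]) = [&& p != a, p != b & p != c].
Proof. by rewrite !inE !negb_or. Qed.

Lemma uniq3 (T : eqType) (a b c : T) : uniq [:: a; b; c] = [&& a != b, a != c & b != c].
Proof. by rewrite /= !inE negb_or !andbT andbA. Qed.

Section Factorization.
Variables (K : numClosedFieldType) (W : vectType K).

Lemma irreducible_not_product (q : Sym W) (A B : W) :
  irreducible_conic q -> ~ (forall f, sym_eval q f = ev f A * ev f B).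
Proof.
move=> [_ irr] h; have qE : q = lin A * lin B.
  by apply: sym_eval_inj => f; rewrite h sym_evalM !sym_eval_lin.
have nu (w : W) : lin w \isn't a GRing.unit.
  apply/negP => /unitrP [u [_ /(congr1 (fun p => sym_eval p 0))]].
  rewrite sym_evalM sym_eval_lin ev0l mul0r sym_evalE meval1 => /eqP.
  by rewrite eq_sym oner_eq0.
by case: (irr _ _ qE); apply/negP/nu.
Qed.

Lemma nonunit_msize n (p : {mpoly K[n]}) :
  p != 0 -> p \isn't a GRing.unit -> (1 < msize p)%N.
Proof.
move=> p0; rewrite ltnNge; apply: contra => /msize1_polyC pE.
have c0 : p@_0%MM != 0 by apply: contraNneq p0 => c0; rewrite pE c0 mpolyC0.
by rewrite pE; apply: rmorph_unit; rewrite unitfE.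
Qed.

(** The factors of a form are not assumed homogeneous. Two nonunits with product of degree 2 both
    have degree 1, and the degree 2 part of the product is the product of their linear parts. *)
Lemma not_irreducible_product (q : Sym W) : conic q -> ~ irreducible_conic q ->
  exists A B, forall f, sym_eval q f = ev f A * ev f B.
Proof.
move=> [q0 hq] nirr; apply: boolp.contrapT => nAB; apply: nirr; split=> // f g qE.
apply: boolp.contrapT => /boolp.not_orP [/negP nf /negP ng]; apply: nAB.
have f0 : f != 0 by apply: contraNneq q0 => f0; rewrite qE f0 mul0r.
have g0 : g != 0 by apply: contraNneq q0 => g0; rewrite qE g0 mulr0.
have sf := nonunit_msize f0 nf; have sg := nonunit_msize g0 ng.
(* [msize] is the degree plus one: [q] has size 3 and nonunits have size at least 2, so both factors
   have size exactly 2. *)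
have sq : msize q = 3%N.
  have := dhomog_uniq q0 hq (dhomog_msize hq).
  by rewrite /= (mpolySpred mdeg q0) /= => <-.
have := msizeM f0 g0; rewrite -qE sq => sfg.
have [sf2 sg2] : msize f = 2%N /\ msize g = 2%N.
  move: sf sg sfg; case: (msize f) => [|[|a]] //; case: (msize g) => [|[|b]] // _ _.
  by rewrite !addSn !addnS /= => -[] /esym /eqP; rewrite addn_eq0 => /andP[/eqP -> /eqP ->].
have fE : f = pihomog mdeg 0 f + pihomog mdeg 1 f.
  have := pihomog_partitionE (mf := mdeg) (p := f) (k := 2); rewrite sf2 => /(_ isT).
  by rewrite !big_ord_recr big_ord0 /= add0r.
have gE : g = pihomog mdeg 0 g + pihomog mdeg 1 g.
  have := pihomog_partitionE (mf := mdeg) (p := g) (k := 2); rewrite sg2 => /(_ isT).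
  by rewrite !big_ord_recr big_ord0 /= add0r.
have hM i j : pihomog mdeg i f * pihomog mdeg j g \is (i + j).-homog.
  by apply: dhomogM; apply: pihomogP.
have q11 : q = pihomog mdeg 1 f * pihomog mdeg 1 g.
  rewrite -[LHS](pihomog_dE hq) qE [in LHS]fE [in LHS]gE mulrDl !mulrDr !pihomogD.
  rewrite (pihomog_ne0 _ (hM 0 0)) // (pihomog_ne0 _ (hM 0 1)) // (pihomog_ne0 _ (hM 1 0)) //.
  by rewrite !add0r (pihomog_dE (hM 1%N 1%N)).
have [A hA] := homog1_eval (pihomogP mdeg 1 f).
have [B hB] := homog1_eval (pihomogP mdeg 1 g).
by exists A, B => h; rewrite q11 sym_evalM hA hB.
Qed.

End Factorization.

Section Cases.
Variables (K : numClosedFieldType) (N : nat) (L : {vspace 'rV[K]_N}) (W : vectType K).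
Variable ell : 'I_N -> dual W.
Hypothesis L_neq0 : L != 0%VS.
Hypothesis dimW : \dim {:W} = 3%N.
Hypothesis ell_inj : forall w, (forall i, ev (ell i) w = 0) -> w = 0.
Hypothesis ell_image : forall x, x \in L <-> exists w, x = \row_i ev (ell i) w.
Local Notation Z := (configuration ell).
Local Notation I := (vanishing_ideal (coord_square L)).

Section Frame.
Variables (e0 e1 e2 : W) (l0 l1 l2 : dual W).
Hypothesis fr : frame e0 e1 e2 l0 l1 l2.
Local Notation a0 i := (ev (ell i) e0).
Local Notation a1 i := (ev (ell i) e1).
Local Notation a2 i := (ev (ell i) e2).

Definition parametrizes r (row : 'I_N -> seq K) (g : K -> K -> K -> seq K) :=
  forall i t0 t1 t2, (t0 * a0 i + t1 * a1 i + t2 * a2 i) ^+ 2 =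
    \sum_(j < r) (row i)`_j * (g t0 t1 t2)`_j.

Lemma ideal_eval_kernel r row g : parametrizes r row g ->
  forall f, I f <-> eval_kernel g (msub (coef_mx r row) f).
Proof.
move=> hg f; rewrite (vanishing_coord_square L_neq0 ell_image) /eval_kernel.
have E t0 t1 t2 : (msub (coef_mx r row) f).@[pt r (g t0 t1 t2)] =
    f.@[fun i => ev (ell i) (fvec e0 e1 e2 t0 t1 t2) ^+ 2].
  rewrite meval_msub; apply: meval_eq => i; rewrite ev_fvec hg.
  by apply: eq_bigr => j _; rewrite mxE.
split=> [h t0 t1 t2|h w]; first by rewrite E.
by rewrite (frame_sum fr w) -E.
Qed.

Lemma minimally_generated_frame r row g ds :
    parametrizes r row g ->
    (forall c : nat -> K, (forall i, \sum_(j < r) (row i)`_j * c j = 0) ->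
      forall j, (j < r)%N -> c j = 0) ->
    all (leq 2) ds -> minimally_generated (@eval_kernel K r g) ds ->
  (r <= N)%N /\ minimally_generated I (nseq (N - r) 1%N ++ ds).
Proof.
move=> hg /rank_coef_mx rC; apply: minimally_generated_lift rC _.
exact: ideal_eval_kernel.
Qed.

End Frame.

Lemma conic_through_frame e0 e1 e2 l0 l1 l2 (q : Sym W) :
    frame e0 e1 e2 l0 l1 l2 -> q \is 2.-homog ->
    sym_eval q l0 = 0 -> sym_eval q l1 = 0 -> sym_eval q l2 = 0 ->
  exists a b c, forall f, sym_eval q f =
    a * (ev f e0 * ev f e1) + b * (ev f e0 * ev f e2) + c * (ev f e1 * ev f e2).
Proof.
move=> fr hq q0 q1 q2; have [c0 [c1 [c2 [a [b [c hc]]]]]] := quad_eval_all fr hq.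
have [[h1 h2 h3] [h4 h5 h6] [h7 h8 h9]] := frameE fr.
have c00 : c0 = 0 by rewrite -q0 hc h1 h2 h3 /qf; ring.
have c10 : c1 = 0 by rewrite -q1 hc h4 h5 h6 /qf; ring.
have c20 : c2 = 0 by rewrite -q2 hc h7 h8 h9 /qf; ring.
by exists a, b, c => f; rewrite hc c00 c10 c20 /qf !mul0r !add0r.
Qed.

Lemma no_conic_case : in_no_conic Z ->
  (6 <= N)%N /\ minimally_generated I (nseq (N - 6) 1%N ++ nseq 6 2%N).
Proof.
move=> noc; have [e0 [e1 [e2 [l0 [l1 [l2 fr]]]]]] := frame_exists dimW.
pose row i := let a0 := ev (ell i) e0 in let a1 := ev (ell i) e1 in let a2 := ev (ell i) e2 in
  [:: a0 ^+ 2; a1 ^+ 2; a2 ^+ 2; (a0 * a1) *+ 2; (a0 * a2) *+ 2; (a1 * a2) *+ 2].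
apply: (minimally_generated_frame fr (row := row) _ _ _ (veronese_minimally_generated K)) => //.
  by move=> i t0 t1 t2; rewrite !big_ord_recr big_ord0 /=; ring.
(* A relation [c] among the columns is a quadratic form vanishing on [Z]; the factors 2 are those of
   the cross terms in [row]. Injectivity therefore says that no conic passes through [Z]. *)
move=> c hc; pose q := quad e0 e1 e2 (c 0%N) (c 1%N) (c 2%N) (c 3%N *+ 2) (c 4%N *+ 2) (c 5%N *+ 2).
have hq : q \is 2.-homog by apply: quad_homog.
have q0 : q = 0.
  apply/eqP/negPn/negP => nq; apply: (noc q); apply/(conic_throughP _ hq); split=> // i.
  rewrite sym_eval_quad -[RHS](hc i) !big_ord_recr big_ord0 /= /qf; ring.
have [|[c0 c1 c2] [c3 c4 c5]] :=
  @qf_eq0 K (c 0%N) (c 1%N) (c 2%N) (c 3%N *+ 2) (c 4%N *+ 2) (c 5%N *+ 2).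
  move=> x0 x1 x2; have [h0 h1 h2] := ev_fpt fr x0 x1 x2.
  by have := sym_eval_quad e0 e1 e2 (c 0%N) (c 1%N) (c 2%N) (c 3%N *+ 2) (c 4%N *+ 2) (c 5%N *+ 2)
    (fpt l0 l1 l2 x0 x1 x2); rewrite h0 h1 h2 -/q q0 sym_eval0 => <-.
have half x : x *+ 2 = 0 :> K -> x = 0 by move/eqP; rewrite mulrn_eq0 => /eqP.
by move=> [|[|[|[|[|[|//]]]]]] _ //; apply: half.
Qed.

(** * Exactly one conic through the configuration *)

Section UniqueConic.
Variable Q : Sym W.
Hypothesis uniqueQ : unique_conic_through Z Q.

Lemma unique_conic_homog : Q \is 2.-homog.
Proof. by case: uniqueQ => -[[]]. Qed.

Lemma unique_conic_neq0 : Q != 0.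
Proof. by case: uniqueQ => -[[]]. Qed.

Lemma unique_conic_eval i : sym_eval Q (ell i) = 0.
Proof.
have [/(conic_throughP _ unique_conic_homog) [_ h] _] := uniqueQ.
exact: h.
Qed.

Lemma unique_conic_span q : q \is 2.-homog -> (forall i, sym_eval q (ell i) = 0) ->
  exists c, q = c *: Q.
Proof.
move=> hq q_ell; have [->|q0] := eqVneq q 0; first by exists 0; rewrite scale0r.
have [_ uQ] := uniqueQ; have [|c _ ->] := uQ q; last by exists c.
exact/(conic_throughP _ hq).
Qed.

(** Vanishing at the three coordinate points removes the squares from [Q], and if one of the cross
    coefficients were zero, [Q] would be a product of two linear forms. Rescaling then makes the
    cross coefficients equal. *)
Lemma irreducible_normal_form : irreducible_conic Q ->
  exists e0 e1 e2 l0 l1 l2 k, [/\ frame e0 e1 e2 l0 l1 l2, k != 0 &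
    forall f, sym_eval Q f =
      k * (ev f e0 * ev f e1 + ev f e0 * ev f e2 + ev f e1 * ev f e2)].
Proof.
move=> irr; have [s0 [s1 [s2 [e0 [e1 [e2 fr]]]]]] := frame_from_configuration dimW ell_inj.
have [a [b [c hc]]] := conic_through_frame fr unique_conic_homog
  (unique_conic_eval s0) (unique_conic_eval s1) (unique_conic_eval s2).
have a0 : a != 0.
  apply/eqP => a0; apply: (irreducible_not_product (A := b *: e0 + c *: e1) (B := e2) irr) => f.
  by rewrite hc a0 evD !evZ; ring.
have b0 : b != 0.
  apply/eqP => b0; apply: (irreducible_not_product (A := a *: e0 + c *: e2) (B := e1) irr) => f.
  by rewrite hc b0 evD !evZ; ring.
have c_0 : c != 0.
  apply/eqP => cE; apply: (irreducible_not_product (A := e0) (B := a *: e1 + b *: e2) irr) => f.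
  by rewrite hc cE evD !evZ; ring.
have abc0 : a * b * c != 0 by rewrite !mulf_neq0.
(* The scaling factors ab, ac, bc turn the coefficients a, b, c into 1 / abc. *)
have := frame_scale (mulf_neq0 a0 b0) (mulf_neq0 a0 c_0) (mulf_neq0 b0 c_0) fr.
set l0 := _ *: ell s0; set l1 := _ *: ell s1; set l2 := _ *: ell s2 => fr'.
exists ((a * b) *: e0), ((a * c) *: e1), ((b * c) *: e2), l0, l1, l2, (a * b * c)^-1; split=> //.
  by rewrite invr_eq0.
move=> f; apply: (mulfI abc0); rewrite mulrA mulfV // mul1r hc !evZ; ring.
Qed.

Lemma irreducible_case : irreducible_conic Q ->
  (5 <= N)%N /\ minimally_generated I (nseq (N - 5) 1%N ++ nseq 7 3%N).
Proof.
move=> /irreducible_normal_form [e0 [e1 [e2 [l0 [l1 [l2 [k [fr k0 hQ]]]]]]]].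
pose row i := let a0 := ev (ell i) e0 in let a1 := ev (ell i) e1 in let a2 := ev (ell i) e2 in
  [:: a0 ^+ 2; a1 ^+ 2; a2 ^+ 2; (a0 * a1) *+ 2; (a0 * a2) *+ 2].
apply: (minimally_generated_frame fr (row := row) _ _ _ (pv_minimally_generated K)) => //.
  move=> i t0 t1 t2; rewrite !big_ord_recr big_ord0 /=.
  have h : ev (ell i) e0 * ev (ell i) e1 + ev (ell i) e0 * ev (ell i) e2 +
      ev (ell i) e1 * ev (ell i) e2 = 0.
    by apply: (mulfI k0); rewrite -hQ unique_conic_eval mulr0.
  (* The conic trades the cross term [a1 a2] for [- (a0 a1 + a0 a2)], which produces [t1 (t0 - t2)]
     and [t2 (t0 - t1)]; the two sides differ by [2 t1 t2] times the equation [h]. *)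
  apply/eqP; rewrite -subr_eq0 -[X in _ == X](mulr0 ((t1 * t2) *+ 2)) -[X in _ == _ * X]h.
  by apply/eqP; ring.
move=> c hc; pose q := quad e0 e1 e2 (c 0%N) (c 1%N) (c 2%N) (c 3%N *+ 2) (c 4%N *+ 2) 0.
have hq : q \is 2.-homog by apply: quad_homog.
have [|m qE] := unique_conic_span hq.
  by move=> i; rewrite sym_eval_quad -[RHS](hc i) !big_ord_recr big_ord0 /= /qf; ring.
(* [q] is the multiple [m] of [Q] but has no [x1 x2] term, while [Q] has coefficient [k != 0] there;
   comparing coefficients gives [m * k = 0] and then all of [c]. *)
have qf_m x0 x1 x2 : qf (c 0%N) (c 1%N) (c 2%N)
    (c 3%N *+ 2 - m * k) (c 4%N *+ 2 - m * k) (- (m * k)) x0 x1 x2 = 0.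
  have [h0 h1 h2] := ev_fpt fr x0 x1 x2.
  have := sym_eval_quad e0 e1 e2 (c 0%N) (c 1%N) (c 2%N) (c 3%N *+ 2) (c 4%N *+ 2) 0
    (fpt l0 l1 l2 x0 x1 x2).
  rewrite h0 h1 h2 -/q qE sym_evalZ hQ h0 h1 h2 => /eqP; rewrite eq_sym -subr_eq0 => /eqP <-.
  by rewrite /qf; ring.
have [[c0 c1 c2] [c3 c4 /eqP]] := qf_eq0 qf_m.
rewrite oppr_eq0 => /eqP mk; rewrite mk !subr0 in c3 c4.
have half x : x *+ 2 = 0 :> K -> x = 0 by move/eqP; rewrite mulrn_eq0 => /eqP.
by move=> [|[|[|[|[|//]]]]] _ //; apply: half.
Qed.

(** Two independent factors can be taken as the first two basis vectors. Proportional factors would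
    put [Z] on a single line, against the injectivity of the embedding. *)
Lemma reducible_normal_form : ~ irreducible_conic Q ->
  exists e0 e1 e2 l0 l1 l2, frame e0 e1 e2 l0 l1 l2 /\
    forall f, sym_eval Q f = ev f e0 * ev f e1.
Proof.
move=> nirr; have cQ : conic Q := conj unique_conic_neq0 unique_conic_homog.
have [A [B hAB]] := not_irreducible_product cQ nirr.
have nQ0 : ~ (forall f, sym_eval Q f = 0).
  move=> h; have /eqP[] := unique_conic_neq0.
  by apply: sym_eval_inj => f; rewrite h sym_eval0.
have fAB : free [:: A; B].
  rewrite free_cons seq1_free span_seq1; apply/andP; split; last first.
    by apply/eqP => B0; apply: nQ0 => f; rewrite hAB B0 ev0 mulr0.
  apply/negP => /vlineP [k Ak].
  have [k0|k0] := eqVneq k 0; first by apply: nQ0 => f; rewrite hAB Ak k0 scale0r ev0 mul0r.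
  have B0 : B = 0.
    apply: ell_inj => i; apply/eqP; rewrite -sqrf_eq0; apply/eqP/(mulfI k0).
    by rewrite mulr0 -(unique_conic_eval i) hAB Ak evZ expr2 mulrA.
  by apply: nQ0 => f; rewrite hAB B0 ev0 mulr0.
have [e2 [l0 [l1 [l2 fr]]]] := frame_extend dimW fAB.
by exists A, B, e2, l0, l1, l2.
Qed.

(** Every common zero of the two quadrics has a parameter, as the zero locus in a complete
    intersection demands. If [z2] is nonzero, divide [z3] and [z4] by a square root of it; if
    [z2 = 0], then [z3] and [z4] vanish and [t0], [t1] are arbitrary square roots. *)
Lemma node_param (z0 z1 z2 z3 z4 : K) : z3 * z3 = z0 * z2 -> z4 * z4 = z1 * z2 ->
  exists t0 t1 t2, [/\ z0 = t0 ^+ 2, z1 = t1 ^+ 2 & z2 = t2 ^+ 2] /\ z3 = t0 * t2 /\ z4 = t1 * t2.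
Proof.
move=> h3 h4; have [z20|z20] := eqVneq z2 0.
  exists (sqrtC z0), (sqrtC z1), 0; rewrite !sqrtCK z20 expr0n !mulr0; split=> //.
  by move/eqP: h3; move/eqP: h4; rewrite z20 !mulr0 !mulf_eq0 !orbb => /eqP -> /eqP ->.
have t20 : sqrtC z2 != 0 by rewrite sqrtC_eq0.
exists (z3 / sqrtC z2), (z4 / sqrtC z2), (sqrtC z2).
by rewrite !expr_div_n sqrtCK !expr2 h3 h4 !mulfK // !divfK.
Qed.

Lemma reducible_case : ~ irreducible_conic Q ->
  (5 <= N)%N /\ complete_intersection (coord_square L) (nseq (N - 5) 1%N ++ nseq 2 2%N).
Proof.
move=> /reducible_normal_form [e0 [e1 [e2 [l0 [l1 [l2 [fr hQ]]]]]]].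
pose row i := let a0 := ev (ell i) e0 in let a1 := ev (ell i) e1 in let a2 := ev (ell i) e2 in
  [:: a0 ^+ 2; a1 ^+ 2; a2 ^+ 2; (a0 * a2) *+ 2; (a1 * a2) *+ 2].
pose g (t0 t1 t2 : K) := [:: t0 ^+ 2; t1 ^+ 2; t2 ^+ 2; t0 * t2; t1 * t2].
have par : parametrizes e0 e1 e2 5 row g.
  move=> i t0 t1 t2; rewrite !big_ord_recr big_ord0 /=.
  have h : ev (ell i) e0 * ev (ell i) e1 = 0 by rewrite -hQ unique_conic_eval.
  apply/eqP; rewrite -subr_eq0 -[X in _ == X](mulr0 ((t0 * t1) *+ 2)) -[X in _ == _ * X]h.
  by apply/eqP; ring.
apply: (complete_intersection_lift (C := coef_mx 5 row) _ (ideal_eval_kernel fr par)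
   (node_forms K) (node_regular K) (@node_kernel K)).
- apply: rank_coef_mx => c hc.
  pose q := quad e0 e1 e2 (c 0%N) (c 1%N) (c 2%N) 0 (c 3%N *+ 2) (c 4%N *+ 2).
  have hq : q \is 2.-homog by apply: quad_homog.
  have [|m qE] := unique_conic_span hq.
    by move=> i; rewrite sym_eval_quad -[RHS](hc i) !big_ord_recr big_ord0 /= /qf; ring.
  have qf_m x0 x1 x2 : qf (c 0%N) (c 1%N) (c 2%N) (- m) (c 3%N *+ 2) (c 4%N *+ 2) x0 x1 x2 = 0.
    have [h0 h1 h2] := ev_fpt fr x0 x1 x2.
    have := sym_eval_quad e0 e1 e2 (c 0%N) (c 1%N) (c 2%N) 0 (c 3%N *+ 2) (c 4%N *+ 2)
      (fpt l0 l1 l2 x0 x1 x2).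
    rewrite h0 h1 h2 -/q qE sym_evalZ hQ h0 h1 => /eqP; rewrite eq_sym -subr_eq0 => /eqP <-.
    by rewrite /qf; ring.
  have [[c0 c1 c2] [_ c3 c4]] := qf_eq0 qf_m.
  have half x : x *+ 2 = 0 :> K -> x = 0 by move/eqP; rewrite mulrn_eq0 => /eqP.
  by move=> [|[|[|[|[|//]]]]] _ //; apply: half.
move=> y y0 [z hz hy].
pose zn k := z (inord k).
have zE (i : 'I_5) : z i = zn i by rewrite /zn inord_val.
have h3 := hz _ (mem_nth 0 (isT : (0 < size (node_quadrics K))%N)).
have h4 := hz _ (mem_nth 0 (isT : (1 < size (node_quadrics K))%N)).
have {h3}h3 : zn 3%N * zn 3%N = zn 0%N * zn 2%N.
  by apply/eqP; rewrite -subr_eq0; apply/eqP; rewrite -[RHS]h3 !meval_simp !zE.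
have {h4}h4 : zn 4%N * zn 4%N = zn 1%N * zn 2%N.
  by apply/eqP; rewrite -subr_eq0; apply/eqP; rewrite -[RHS]h4 !meval_simp !zE.
have [t0 [t1 [t2 [[z0 z1 z2] [z3 z4]]]]] := node_param h3 h4.
pose w := fvec e0 e1 e2 t0 t1 t2; pose x : 'rV[K]_N := \row_i ev (ell i) w.
have yx : y = map_mx (fun a => a ^+ 2) x.
  apply/rowP => i; rewrite !mxE hy ev_fvec par; apply: eq_bigr => j _; rewrite mxE zE.
  congr (_ * _); case: j => [[|[|[|[|[|//]]]]] j5] //=.
exists x; split.
- by apply/ell_image; exists w.
- apply: contraNneq y0 => x0; rewrite yx x0; apply/eqP/rowP => i.
  by rewrite !mxE expr0n.
by rewrite yx.
Qed.

End UniqueConic.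

(** * Several conics through the configuration *)

Section FrameLines.
Variables (e0 e1 e2 : W) (l0 l1 l2 : dual W).
Hypothesis fr : frame e0 e1 e2 l0 l1 l2.

Lemma vline_scaled (f g : dual W) : <[f]>%VS = <[g]>%VS -> exists k, f = k *: g.
Proof. by move=> fg; apply/vlineP; rewrite -fg memv_line. Qed.

Lemma vline_scale k (g : dual W) : k != 0 -> <[k *: g]>%VS = <[g]>%VS.
Proof.
move=> k0; apply/eqP; rewrite eqEsubv -!memvE memvZ ?memv_line //=.
by apply/vlineP; exists k^-1; rewrite scalerA mulVf // scale1r.
Qed.

Lemma frame_neq0 : [/\ l0 != 0, l1 != 0 & l2 != 0].
Proof.
have [[h1 _ _] [_ h5 _] [_ _ h9]] := frameE fr.
by split; apply/eqP => E; [move: h1|move: h5|move: h9];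
  rewrite E ev0l => /eqP; rewrite eq_sym oner_eq0.
Qed.

Lemma frame_uniq : uniq [:: <[l0]>%VS; <[l1]>%VS; <[l2]>%VS].
Proof.
have [[h1 h2 h3] [h4 h5 h6] [h7 h8 h9]] := frameE fr.
rewrite uniq3; apply/and3P; split; apply/eqP => /vline_scaled [k E].
- by move: h1; rewrite E evZl h4 mulr0 => /eqP; rewrite eq_sym oner_eq0.
- by move: h1; rewrite E evZl h7 mulr0 => /eqP; rewrite eq_sym oner_eq0.
- by move: h5; rewrite E evZl h8 mulr0 => /eqP; rewrite eq_sym oner_eq0.
Qed.

Lemma mem_plane f : f \in <<[:: l0; l1]>>%VS <-> ev f e2 = 0.
Proof.
have [[h1 h2 h3] [h4 h5 h6] [h7 h8 h9]] := frameE fr.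
rewrite span_cons span_seq1; split=> [/memv_addP [x /vlineP [a ->] [y /vlineP [b ->] ->]]|f2].
  by rewrite evDl !evZl h3 h6 !mulr0 addr0.
rewrite (frame_dual fr f) f2 scale0r addr0.
by apply: memv_add; rewrite memvZ ?memv_line.
Qed.

Lemma dim_plane : \dim <<[:: l0; l1]>>%VS = 2%N.
Proof.
apply/eqP; have [n0 n1 n2] := frame_neq0.
suff : free [:: l0; l1] by [].
rewrite free_cons span_seq1 seq1_free n1 andbT; apply/negP => /vlineP [k E].
have [[h1 h2 h3] [h4 h5 h6] _] := frameE fr.
by move: h1; rewrite E evZl h4 mulr0 => /eqP; rewrite eq_sym oner_eq0.
Qed.

Lemma frame_not_in_plane (M : {vspace dual W}) : \dim M = 2%N ->
  l0 \in M -> l1 \in M -> l2 \in M -> False.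
Proof.
move=> dM m0 m1 m2.
have EM : <<[:: l0; l1]>>%VS = M.
  apply/eqP; rewrite eqEdim dim_plane dM leqnn andbT.
  by apply/span_subvP => x; rewrite !inE => /orP[] /eqP ->.
move: m2; rewrite -EM => /mem_plane.
by have [_ _ [_ _ ->]] := frameE fr => /eqP; rewrite oner_eq0.
Qed.

Lemma single_coordinate f : f != 0 ->
    ev f e0 * ev f e1 = 0 -> ev f e0 * ev f e2 = 0 -> ev f e1 * ev f e2 = 0 ->
  <[f]>%VS \in [:: <[l0]>%VS; <[l1]>%VS; <[l2]>%VS].
Proof.
move=> f0 /eqP; rewrite mulf_eq0 => h01 /eqP; rewrite mulf_eq0 => h02 /eqP; rewrite mulf_eq0 => h12.
have fE := frame_dual fr f; rewrite !inE.
have [x0|x0] := eqVneq (ev f e0) 0; last first.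
  move: h01 h02; rewrite (negbTE x0) /= => /eqP h1 /eqP h2.
  by rewrite fE h1 h2 !scale0r !addr0 vline_scale ?eqxx.
have [x1|x1] := eqVneq (ev f e1) 0; last first.
  move: h12; rewrite (negbTE x1) /= => /eqP h2.
  by rewrite fE x0 h2 !scale0r add0r addr0 vline_scale ?eqxx ?orbT.
have x2 : ev f e2 != 0.
  by apply: contraNneq f0 => x2; rewrite fE x0 x1 x2 !scale0r !addr0.
by rewrite fE x0 x1 !scale0r !add0r vline_scale ?eqxx ?orbT.
Qed.

Lemma on_coordinate_lines f (P : K -> K -> K -> Prop) :
    (forall k, P k 0 0) -> (forall k, P 0 k 0) -> (forall k, P 0 0 k) ->
    <[f]>%VS \in [:: <[l0]>%VS; <[l1]>%VS; <[l2]>%VS] ->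
  P (ev f e0) (ev f e1) (ev f e2).
Proof.
move=> P0 P1 P2; have [[h1 h2 h3] [h4 h5 h6] [h7 h8 h9]] := frameE fr.
rewrite !inE => /or3P[] /eqP /vline_scaled [k ->]; rewrite !evZl.
- by rewrite h1 h2 h3 mulr1 !mulr0.
- by rewrite h4 h5 h6 mulr1 !mulr0.
- by rewrite h7 h8 h9 mulr1 !mulr0.
Qed.

End FrameLines.

Lemma proportional_of_minors (u0 u1 u2 v0 v1 v2 : K) :
    [|| u0 != 0, u1 != 0 | u2 != 0] ->
    u0 * v1 = u1 * v0 -> u0 * v2 = u2 * v0 -> u1 * v2 = u2 * v1 ->
  exists c, [/\ v0 = c * u0, v1 = c * u1 & v2 = c * u2].
Proof.
move=> /or3P[] u h1 h2 h3.
- exists (v0 / u0); split; first by rewrite divfK.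
    by apply: (mulfI u); rewrite h1; field.
  by apply: (mulfI u); rewrite h2; field.
- exists (v1 / u1); split; last by apply: (mulfI u); rewrite h3; field.
    by apply: (mulfI u); rewrite -h1; field.
  by rewrite divfK.
- exists (v2 / u2); split; last by rewrite divfK.
    by apply: (mulfI u); rewrite -h2; field.
  by apply: (mulfI u); rewrite -h3; field.
Qed.

Lemma extra_point (s : seq {vspace dual W}) : (size s < size Z)%N ->
  exists2 k, ell k != 0 & <[ell k]>%VS \notin s.
Proof.
move=> sZ; have : ~~ all (mem s) Z.
  by apply/negP => /allP /(uniq_leq_size (undup_uniq _)); rewrite leqNgt sZ.
by case/allPn => p /mem_configuration [k k0 ->] ps; exists k.
Qed.

Section ConfigurationFrame.
Variables (s0 s1 s2 : 'I_N) (e0 e1 e2 : W).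
Hypothesis fr : frame e0 e1 e2 (ell s0) (ell s1) (ell s2).
Local Notation P0 := <[ell s0]>%VS.
Local Notation P1 := <[ell s1]>%VS.
Local Notation P2 := <[ell s2]>%VS.
Local Notation a0 i := (ev (ell i) e0).
Local Notation a1 i := (ev (ell i) e1).
Local Notation a2 i := (ev (ell i) e2).

Lemma frame_points : {subset [:: P0; P1; P2] <= Z}.
Proof.
have [n0 n1 n2] := frame_neq0 fr => p.
by rewrite !inE => /or3P[] /eqP ->; apply/mem_configuration;
  [exists s0|exists s1|exists s2].
Qed.

Lemma size3_mem : size Z = 3%N -> Z =i [:: P0; P1; P2].
Proof.
move=> sZ p; have [] := uniq_min_size (frame_uniq fr) frame_points; first by rewrite sZ.
by move=> _ ->.
Qed.

Lemma three_points_case : size Z = 3%N ->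
  (3 <= N)%N /\ minimally_generated I (nseq (N - 3) 1%N).
Proof.
move=> /size3_mem ZE; have [[h1 h2 h3] [h4 h5 h6] [h7 h8 h9]] := frameE fr.
pose row i := [:: a0 i ^+ 2; a1 i ^+ 2; a2 i ^+ 2].
rewrite -[nseq _ _]cats0.
apply: (minimally_generated_frame fr (row := row) _ _ _ (squares_minimally_generated K)) => //.
  move=> i t0 t1 t2; rewrite !big_ord_recr big_ord0 /= add0r.
  have [i0|i0] := eqVneq (ell i) 0; first by rewrite i0 !ev0l; ring.
  apply: (on_coordinate_lines fr (P := fun a b c => (t0 * a + t1 * b + t2 * c) ^+ 2 =
     a ^+ 2 * t0 ^+ 2 + b ^+ 2 * t1 ^+ 2 + c ^+ 2 * t2 ^+ 2)) => [k|k|k|]; try by ring.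
  by rewrite -ZE; apply/mem_configuration; exists i.
move=> c hc.
have expand i : \sum_(j < 3) (row i)`_j * c j =
    a0 i ^+ 2 * c 0%N + a1 i ^+ 2 * c 1%N + a2 i ^+ 2 * c 2%N.
  by rewrite !big_ord_recr big_ord0 /= add0r.
move: hc => hc [|[|[|//]]] _.
- by have := hc s0; rewrite expand h1 h2 h3 => <-; ring.
- by have := hc s1; rewrite expand h4 h5 h6 => <-; ring.
- by have := hc s2; rewrite expand h7 h8 h9 => <-; ring.
Qed.

(** Otherwise the point lies on the line through [P0] and [P1], and these three points are
    collinear. *)
Lemma plane_collinear p : ell p != 0 -> <[ell p]>%VS \notin [:: P0; P1; P2] ->
  no_three_collinear Z -> a2 p != 0.
Proof.
move=> p0 pn n3; apply/eqP => p2; move: (pn); rewrite notin3 => /and3P[n0 n1 _].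
apply: (n3 P0 P1 <[ell p]>%VS).
- by apply: frame_points; rewrite inE eqxx.
- by apply: frame_points; rewrite !inE eqxx orbT.
- by apply/mem_configuration; exists p.
- have := frame_uniq fr; rewrite !uniq3 => /and3P[n01 _ _].
  by apply/and3P; split; [exact: n01|rewrite eq_sym; exact: n0|rewrite eq_sym; exact: n1].
exists <<[:: ell s0; ell s1]>>%VS; first exact: dim_plane fr.
move=> q; rewrite !inE => /or3P[] /eqP ->; rewrite -memvE.
- by apply: memv_span; rewrite inE eqxx.
- by apply: memv_span; rewrite !inE eqxx orbT.
- exact/(mem_plane fr).
Qed.

Lemma all_but_one_case : (4 <= size Z)%N ->
  (exists2 M : {vspace dual W}, \dim M = 2%N & {in Z, forall p, (p <= M)%VS <-> p != P2}) ->
  (4 <= N)%N /\ minimally_generated I (nseq (N - 4) 1%N ++ [:: 2%N]).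
Proof.
move=> sZ [M dM hM]; have [[h1 h2 h3] [h4 h5 h6] [h7 h8 h9]] := frameE fr.
have [n0 n1 n2] := frame_neq0 fr.
have inZ i : ell i != 0 -> <[ell i]>%VS \in Z by move=> i0; apply/mem_configuration; exists i.
have := frame_uniq fr; rewrite uniq3 => /and3P[u01 u02 u12].
have m0 : ell s0 \in M by rewrite memvE; apply/(hM _ (inZ _ n0)).
have m1 : ell s1 \in M by rewrite memvE; apply/(hM _ (inZ _ n1)).
have nm2 : ell s2 \notin M.
  by rewrite memvE; apply/negP => /(hM _ (inZ _ n2)); rewrite eqxx.
have dich i : ell i != 0 -> <[ell i]>%VS != P2 -> a2 i = 0.
  move=> i0 iP; have mi : ell i \in M by rewrite memvE; apply/(hM _ (inZ _ i0)).
  apply/eqP; apply: contraNT nm2 => i2.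
  have -> : ell s2 = (a2 i)^-1 *: (ell i - a0 i *: ell s0 - a1 i *: ell s1).
    rewrite {2}(frame_dual fr (ell i)) -addrA -opprD [_ + _ *: ell s2]addrC addrK.
    by rewrite scalerA mulVf // scale1r.
  by rewrite memvZ // !rpredB // memvZ.
(* A fourth point lies on the line through [P0] and [P1] and differs from both, so its first two
   coordinates are nonzero. Only such a point detects the coefficient of [t0 t1]. *)
have [k k0 kn] := @extra_point [:: P0; P1; P2] sZ.
move: kn; rewrite notin3 => /and3P[k_0 k_1 k_2].
have ak2 := dich _ k0 k_2.
have kE := frame_dual fr (ell k); rewrite ak2 scale0r addr0 in kE.
have ak0 : a0 k != 0.
  apply: contraNneq k_1 => z; rewrite z scale0r add0r in kE.
  have k1 : a1 k != 0 by apply: contraNneq k0 => z1; rewrite kE z1 scale0r.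
  by rewrite kE vline_scale.
have ak1 : a1 k != 0.
  by apply: contraNneq k_0 => z; rewrite z scale0r addr0 in kE; rewrite kE vline_scale.
pose row i := [:: a0 i ^+ 2; a1 i ^+ 2; a2 i ^+ 2; (a0 i * a1 i) *+ 2].
apply: (minimally_generated_frame fr (row := row) _ _ _ (cone_minimally_generated K)) => //.
  move=> i t0 t1 t2; rewrite !big_ord_recr big_ord0 /= add0r.
  have [i0|i0] := eqVneq (ell i) 0; first by rewrite i0 !ev0l; ring.
  have [iP|iP] := eqVneq <[ell i]>%VS P2; last by rewrite (dich _ i0 iP); ring.
  have [c ->] := vline_scaled iP; rewrite !evZl h7 h8 h9; ring.
move=> c hc.
have expand i : a0 i ^+ 2 * c 0%N + a1 i ^+ 2 * c 1%N + a2 i ^+ 2 * c 2%N +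
    (a0 i * a1 i) *+ 2 * c 3%N = 0.
  by rewrite -[RHS](hc i) !big_ord_recr big_ord0 /= add0r.
have c0 : c 0%N = 0 by have := expand s0; rewrite h1 h2 h3 => <-; ring.
have c1 : c 1%N = 0 by have := expand s1; rewrite h4 h5 h6 => <-; ring.
have c2 : c 2%N = 0 by have := expand s2; rewrite h7 h8 h9 => <-; ring.
have c3 : c 3%N = 0.
  have := expand k; rewrite c0 c1 c2 !mulr0 !add0r => /eqP.
  by rewrite mulf_eq0 mulrn_eq0 /= mulf_eq0 (negbTE ak0) (negbTE ak1) /= => /eqP.
by move=> [|[|[|[|//]]]].
Qed.

End ConfigurationFrame.

Section SeveralConics.
Variables (s0 s1 s2 : 'I_N) (e0 e1 e2 : W).
Hypothesis fr : frame e0 e1 e2 (ell s0) (ell s1) (ell s2).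
Local Notation P0 := <[ell s0]>%VS.
Local Notation P1 := <[ell s1]>%VS.
Local Notation P2 := <[ell s2]>%VS.
Local Notation a0 i := (ev (ell i) e0).
Local Notation a1 i := (ev (ell i) e1).
Local Notation a2 i := (ev (ell i) e2).

Lemma two_coordinates_notin k : a0 k != 0 -> a1 k != 0 -> <[ell k]>%VS \notin [:: P0; P1; P2].
Proof.
move=> k0 k1; apply/negP => kn.
have : a0 k * a1 k = 0.
  by apply: (on_coordinate_lines fr (P := fun a b _ => a * b = 0)) kn => *;
    rewrite ?mulr0 ?mul0r.
by move/eqP; rewrite mulf_eq0 (negbTE k0) (negbTE k1).
Qed.

Lemma four_points_uniq k : <[ell k]>%VS \notin [:: P0; P1; P2] ->
  uniq [:: <[ell k]>%VS; P0; P1; P2].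
Proof. by move=> kn; rewrite cons_uniq kn; apply: frame_uniq fr. Qed.

Lemma four_points_sub k : ell k != 0 -> {subset [:: <[ell k]>%VS; P0; P1; P2] <= Z}.
Proof.
move=> k0 p; rewrite in_cons => /orP[/eqP ->|]; last exact: frame_points fr p.
by apply/mem_configuration; exists k.
Qed.

Lemma four_points_case : size Z = 4%N -> no_three_collinear Z ->
  (4 <= N)%N /\ minimally_generated I (nseq (N - 4) 1%N ++ [:: 4%N]).
Proof.
move=> sZ n3; have [k k0 kn] := @extra_point [:: P0; P1; P2] (eq_leq (esym sZ)).
have ZE : Z =i [:: <[ell k]>%VS; P0; P1; P2].
  have [] := uniq_min_size (four_points_uniq kn) (four_points_sub k0); first by rewrite sZ.
  by move=> _ h p; rewrite h.
have k2 : a2 k != 0 := plane_collinear fr k0 kn n3.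
have /and3P[p0 p1 p2] : [&& <[ell k]>%VS != P0, <[ell k]>%VS != P1 & <[ell k]>%VS != P2].
  by rewrite -notin3.
have k1 : a1 k != 0.
  apply: (plane_collinear (frame_swap12 fr) k0 _ n3).
  by rewrite notin3; apply/and3P; exact: And3 p0 p2 p1.
have k_0 : a0 k != 0.
  apply: (plane_collinear (frame_swap12 (frame_swap01 fr)) k0 _ n3).
  by rewrite notin3; apply/and3P; exact: And3 p1 p2 p0.
have [[h1 h2 h3] [h4 h5 h6] [h7 h8 h9]] := frameE fr.
have i0 : (a0 k)^-1 != 0 by rewrite invr_eq0.
have i1 : (a1 k)^-1 != 0 by rewrite invr_eq0.
have i2 : (a2 k)^-1 != 0 by rewrite invr_eq0.
(* In the rescaled frame the fourth point is [[1 : 1 : 1]]. The three cross products of coordinates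
   then agree at every point of [Z], so the cross terms combine into one multiple of
   [t0 t1 + t0 t2 + t1 t2]. *)
have fr' := frame_scale i0 i1 i2 fr.
set f0 := (a0 k)^-1 *: e0 in fr'; set f1 := (a1 k)^-1 *: e1 in fr'.
set f2 := (a2 k)^-1 *: e2 in fr'.
have kf : [/\ ev (ell k) f0 = 1, ev (ell k) f1 = 1 & ev (ell k) f2 = 1].
  by split; rewrite evZ mulVf.
pose row i := [:: ev (ell i) f0 ^+ 2; ev (ell i) f1 ^+ 2; ev (ell i) f2 ^+ 2;
  (ev (ell i) f0 * ev (ell i) f1) *+ 2].
apply: (minimally_generated_frame fr' (row := row) _ _ _ (steiner_minimally_generated K)) => //.
  move=> i t0 t1 t2; rewrite !big_ord_recr big_ord0 /= add0r.
  have [iz|i_0] := eqVneq (ell i) 0; first by rewrite iz !ev0l; ring.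
  have : <[ell i]>%VS \in Z by apply/mem_configuration; exists i.
  rewrite ZE in_cons => /orP[/eqP /vline_scaled [c ->]|iP].
    by rewrite !evZl; case: kf => -> -> ->; ring.
  apply: (on_coordinate_lines fr' (P := fun a b c => (t0 * a + t1 * b + t2 * c) ^+ 2 =
     a ^+ 2 * t0 ^+ 2 + b ^+ 2 * t1 ^+ 2 + c ^+ 2 * t2 ^+ 2 +
     (a * b) *+ 2 * (t0 * t1 + t0 * t2 + t1 * t2))) => [c|c|c|]; try by ring.
  by rewrite !vline_scale ?invr_eq0.
move=> c hc.
have expand i : ev (ell i) f0 ^+ 2 * c 0%N + ev (ell i) f1 ^+ 2 * c 1%N + ev (ell i) f2 ^+ 2 * c 2%N
    + (ev (ell i) f0 * ev (ell i) f1) *+ 2 * c 3%N = 0.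
  by rewrite -[RHS](hc i) !big_ord_recr big_ord0 /= add0r.
have c0 : c 0%N = 0.
  apply: (mulfI (expf_neq0 2 i0)); rewrite mulr0 -[RHS](expand s0).
  by rewrite !evZ h1 h2 h3; ring.
have c1 : c 1%N = 0.
  apply: (mulfI (expf_neq0 2 i1)); rewrite mulr0 -[RHS](expand s1).
  by rewrite !evZ h4 h5 h6; ring.
have c2 : c 2%N = 0.
  apply: (mulfI (expf_neq0 2 i2)); rewrite mulr0 -[RHS](expand s2).
  by rewrite !evZ h7 h8 h9; ring.
have c3 : c 3%N = 0.
  have := expand k; rewrite c0 c1 c2 !mulr0 !add0r; case: kf => -> -> _ /eqP.
  by rewrite mulr1 mulf_eq0 pnatr_eq0 => /eqP.
by move=> [|[|[|[|//]]]].
Qed.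

(* The vector of cross terms of ell i is orthogonal to the coefficient vectors of
   two independent conics, hence a multiple of their cross product. *)
Lemma several_conics_cross : in_several_conics Z ->
  exists n0 n1 n2 : K, [|| n0 != 0, n1 != 0 | n2 != 0] /\
    forall i, exists c, [/\ a0 i * a1 i = c * n0, a0 i * a2 i = c * n1 & a1 i * a2 i = c * n2].
Proof.
move=> [q [q' [cq cq' nqq]]].
have [[qn hq] _] := cq; have [[qn' hq'] _] := cq'.
have [_ qZ] := (conic_throughP ell hq).1 cq; have [_ qZ'] := (conic_throughP ell hq').1 cq'.
have [a [b [c hc]]] := conic_through_frame fr hq (qZ s0) (qZ s1) (qZ s2).
have [a' [b' [c' hc']]] := conic_through_frame fr hq' (qZ' s0) (qZ' s1) (qZ' s2).
have v0 : [|| a != 0, b != 0 | c != 0].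
  apply: contraNT qn; rewrite !negb_or !negbK => /and3P[/eqP az /eqP bz /eqP cz].
  by apply/eqP/sym_eval_inj => f; rewrite hc az bz cz !mul0r !addr0 sym_eval0.
have nu0 : [|| b * c' - c * b' != 0, c * a' - a * c' != 0 | a * b' - b * a' != 0].
  apply: contra_notT nqq; rewrite !negb_or !negbK !subr_eq0 => /and3P[/eqP m0 /eqP m1 /eqP m2].
  have [k [ka kb kc]] := proportional_of_minors v0 m2 (esym m1) m0.
  have E : q' = k *: q.
    by apply: sym_eval_inj => f; rewrite sym_evalZ hc hc' ka kb kc; ring.
  by exists k => //; apply: contraNneq qn' => k0; rewrite E k0 scale0r.
exists (b * c' - c * b'), (c * a' - a * c'), (a * b' - b * a'); split=> // i.
have h := qZ i; have h' := qZ' i; rewrite hc in h; rewrite hc' in h'.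
move: h h'; set x := a0 i * a1 i; set y := a0 i * a2 i; set z := a1 i * a2 i => h h'.
apply: proportional_of_minors => //; apply/eqP; rewrite -subr_eq0.
- have -> : (b * c' - c * b') * y - (c * a' - a * c') * x =
    c' * (a * x + b * y + c * z) - c * (a' * x + b' * y + c' * z) by ring.
  by rewrite h h' !mulr0 subrr.
- have -> : (b * c' - c * b') * z - (a * b' - b * a') * x =
    b * (a' * x + b' * y + c' * z) - b' * (a * x + b * y + c * z) by ring.
  by rewrite h h' !mulr0 subrr.
have -> : (c * a' - a * c') * z - (a * b' - b * a') * y =
    a' * (a * x + b * y + c * z) - a * (a' * x + b' * y + c' * z) by ring.
by rewrite h h' !mulr0 subrr.
Qed.

(** Each point has either last coordinate zero, and lies on the line through [P0] and [P1], or its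
    first two coordinates zero, and is [P2]. The point of [ell k] is a fourth one, on the line. *)
Lemma all_but_one_of_cross k : ell k != 0 -> a0 k != 0 -> a1 k != 0 ->
    (forall i, a0 i * a2 i = 0 /\ a1 i * a2 i = 0) ->
  (4 <= size Z)%N /\ all_but_one_on_line Z.
Proof.
move=> k0 k_0 k_1 hx; split.
  exact: (uniq_leq_size (four_points_uniq (two_coordinates_notin k_0 k_1)) (four_points_sub k0)).
exists <<[:: ell s0; ell s1]>>%VS; first exact: dim_plane fr.
have [[h1 h2 h3] [h4 h5 h6] [h7 h8 h9]] := frameE fr.
exists P2; first by apply: frame_points fr _ _; rewrite !inE eqxx !orbT.
move=> p /mem_configuration [i i0 ->]; rewrite -memvE; split=> [/(mem_plane fr) i2|iP].
  apply: contraNneq i0 => /vline_scaled [c E].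
  by move: i2; rewrite E evZl h9 mulr1 => ->; rewrite scale0r.
apply/(mem_plane fr)/eqP; apply: contraNT iP => i2; have [x0 x1] := hx i.
move/eqP: x0; rewrite mulf_eq0 (negbTE i2) orbF => /eqP x0.
move/eqP: x1; rewrite mulf_eq0 (negbTE i2) orbF => /eqP x1.
by rewrite (frame_dual fr (ell i)) x0 x1 !scale0r !add0r vline_scale.
Qed.

(** A line containing three of the four points contains all coordinate points, which is absurd: if
    [ell k] and two of them lie on it, the third is obtained by solving for it, as all coordinates
    of [ell k] are nonzero. *)
Lemma general_position_of_cross k : a0 k != 0 -> a1 k != 0 -> a2 k != 0 ->
    Z =i [:: <[ell k]>%VS; P0; P1; P2] ->
  size Z = 4%N /\ no_three_collinear Z.
Proof.
move=> k0 k1 k2 ZE; have kn := two_coordinates_notin k0 k1.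
split.
  have := uniq_size_uniq (four_points_uniq kn) (fun x => esym (ZE x)).
  by rewrite undup_uniq => /esym /eqP.
move=> p q r pZ qZ rZ u [M dM hM].
pose s := [seq p <- [:: <[ell k]>%VS; P0; P1; P2] | (p <= M)%VS].
have : (size [:: p; q; r] <= size s)%N.
  apply: uniq_leq_size => // x xp; rewrite mem_filter hM // -ZE.
  by move: xp; rewrite !inE => /or3P[] /eqP ->.
have kE := frame_dual fr (ell k).
have solve (x y z f : dual W) a b c : f = a *: x + b *: y + c *: z -> c != 0 ->
    f \in M -> x \in M -> y \in M -> z \in M.
  move=> E c0 fM xM yM; have -> : z = c^-1 *: (f - (a *: x + b *: y)).
    by rewrite E addrC addKr scalerA mulVf // scale1r.
  by rewrite memvZ // rpredB // rpredD // memvZ.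
have nf := frame_not_in_plane fr dM.
rewrite /s size_filter /= -!memvE addn0.
case mk: (ell k \in M); case m0: (ell s0 \in M); case m1: (ell s1 \in M);
  case m2: (ell s2 \in M) => // _.
- exact: nf.
- by apply: nf => //; apply: (solve (ell s0) (ell s1) _ (ell k) (a0 k) (a1 k) (a2 k)).
- apply: nf => //; apply: (solve (ell s0) (ell s2) _ (ell k) (a0 k) (a2 k) (a1 k)) => //.
  by rewrite addrAC.
- apply: nf => //; apply: (solve (ell s1) (ell s2) _ (ell k) (a1 k) (a2 k) (a0 k)) => //.
  by rewrite addrC addrA.
exact: nf.
Qed.

End SeveralConics.

(** All vectors of cross terms are multiples of one vector [n]. If all of them vanish, [Z] consists
    of the coordinate points. If some [ell k] has exactly two nonzero coordinates, [n] has a single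
    nonzero entry, and a permuted frame gives a line and a point. If all coordinates of [ell k] are
    nonzero, the only other points are the coordinate points. *)
Lemma several_conics_trichotomy : in_several_conics Z ->
  [\/ size Z = 3%N, size Z = 4%N /\ no_three_collinear Z
    | (4 <= size Z)%N /\ all_but_one_on_line Z].
Proof.
move=> sc; have [s0 [s1 [s2 [e0 [e1 [e2 fr]]]]]] := frame_from_configuration dimW ell_inj.
have [n0 [n1 [n2 [nn hn]]]] := several_conics_cross fr sc.
pose a0 i := ev (ell i) e0; pose a1 i := ev (ell i) e1; pose a2 i := ev (ell i) e2.
have single i : ell i != 0 -> a0 i * a1 i = 0 -> a0 i * a2 i = 0 -> a1 i * a2 i = 0 ->
    <[ell i]>%VS \in [:: <[ell s0]>%VS; <[ell s1]>%VS; <[ell s2]>%VS].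
  exact: (single_coordinate fr).
case: (pickP (fun i => [|| a0 i * a1 i != 0, a0 i * a2 i != 0 | a1 i * a2 i != 0])) => [k hk|h0].
  have [c [k01 k02 k12]] := hn k; rewrite -/(a0 k) -/(a1 k) -/(a2 k) in k01 k02 k12.
  have c0 : c != 0.
    by apply: contraTneq hk => c0; rewrite k01 k02 k12 c0 !mul0r eqxx.
  have k0 : ell k != 0.
    by apply: contraTneq hk => k0; rewrite /a0 /a1 /a2 k0 !ev0l !mul0r eqxx.
  have nz x : c * x = 0 -> x = 0 by move/eqP; rewrite mulf_eq0 (negbTE c0) => /eqP.
  have [z0|x0] := eqVneq (a0 k) 0.
    rewrite z0 !mul0r eqxx /= mulf_eq0 negb_or in hk; case/andP: hk => x1 x2.
    have e00 : n0 = 0 by apply: nz; rewrite -k01 z0 mul0r.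
    have e10 : n1 = 0 by apply: nz; rewrite -k02 z0 mul0r.
    apply: Or33; apply: (all_but_one_of_cross (frame_swap12 (frame_swap01 fr)) k0 x1 x2) => i.
    have [d [d0 d1 _]] := hn i; rewrite e00 mulr0 in d0; rewrite e10 mulr0 in d1.
    by split; rewrite mulrC.
  have [z1|x1] := eqVneq (a1 k) 0.
    rewrite z1 mulr0 mul0r eqxx /= orbF mulf_eq0 negb_or in hk; case/andP: hk => _ x2.
    have e00 : n0 = 0 by apply: nz; rewrite -k01 z1 mulr0.
    have e20 : n2 = 0 by apply: nz; rewrite -k12 z1 mul0r.
    apply: Or33; apply: (all_but_one_of_cross (frame_swap12 fr) k0 x0 x2) => i.
    have [d [d0 _ d2]] := hn i; rewrite e00 mulr0 in d0; rewrite e20 mulr0 in d2.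
    by split=> //; rewrite mulrC.
  have [z2|x2] := eqVneq (a2 k) 0.
    have e10 : n1 = 0 by apply: nz; rewrite -k02 z2 mulr0.
    have e20 : n2 = 0 by apply: nz; rewrite -k12 z2 mulr0.
    apply: Or33; apply: (all_but_one_of_cross fr k0 x0 x1) => i.
    by have [d [_ d1 d2]] := hn i; rewrite d1 d2 e10 e20 !mulr0.
  apply: Or32; apply: (general_position_of_cross fr x0 x1 x2) => p.
  apply/idP/idP => [/mem_configuration [i i0 ->]|]; last exact: (four_points_sub fr k0).
  have [d [i01 i02 i12]] := hn i; rewrite -/(a0 i) -/(a1 i) -/(a2 i) in i01 i02 i12.
  have [d0|d0] := eqVneq d 0.
    by rewrite in_cons single ?orbT // ?i01 ?i02 ?i12 d0 mul0r.
  have n0z : n0 != 0.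
    by apply: contraTneq (mulf_neq0 x0 x1) => n0z; rewrite k01 n0z mulr0 eqxx.
  have n1z : n1 != 0.
    by apply: contraTneq (mulf_neq0 x0 x2) => n1z; rewrite k02 n1z mulr0 eqxx.
  have [y0 y1] : a0 i != 0 /\ a1 i != 0.
    by apply/andP; rewrite -negb_or -mulf_eq0 i01 mulf_neq0.
  have y2 : a2 i != 0.
    by apply: contraTneq (mulf_neq0 d0 n1z) => y2; rewrite -i02 y2 mulr0 eqxx.
  (* When no coordinate is zero, the cross products determine the point, as in the standard
     quadratic Cremona involution. After multiplication by [a2 k * a2 i] both sides are products of
     cross terms of [k] and [i], and these are proportional. *)
  have m01 : a0 k * a1 i = a1 k * a0 i.
    apply: (mulfI (mulf_neq0 x2 y2)).
    have -> : a2 k * a2 i * (a0 k * a1 i) = (a0 k * a2 k) * (a1 i * a2 i) by ring.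
    have -> : a2 k * a2 i * (a1 k * a0 i) = (a1 k * a2 k) * (a0 i * a2 i) by ring.
    by rewrite i02 i12 k02 k12; ring.
  have m02 : a0 k * a2 i = a2 k * a0 i.
    apply: (mulfI (mulf_neq0 x1 y1)).
    have -> : a1 k * a1 i * (a0 k * a2 i) = (a0 k * a1 k) * (a1 i * a2 i) by ring.
    have -> : a1 k * a1 i * (a2 k * a0 i) = (a1 k * a2 k) * (a0 i * a1 i) by ring.
    by rewrite i01 i12 k01 k12; ring.
  have m12 : a1 k * a2 i = a2 k * a1 i.
    apply: (mulfI (mulf_neq0 x0 y0)).
    have -> : a0 k * a0 i * (a1 k * a2 i) = (a0 k * a1 k) * (a0 i * a2 i) by ring.
    have -> : a0 k * a0 i * (a2 k * a1 i) = (a0 k * a2 k) * (a0 i * a1 i) by ring.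
    by rewrite i01 i02 k01 k02; ring.
  have [|m [E0 E1 E2]] := proportional_of_minors _ m01 m02 m12; first by rewrite x0.
  have iE : ell i = m *: ell k.
    rewrite (frame_dual fr (ell i)) (frame_dual fr (ell k)) !scalerDr !scalerA.
    by rewrite -/(a0 i) -/(a1 i) -/(a2 i) E0 E1 E2.
  rewrite in_cons iE vline_scale ?eqxx //.
  by apply: contraNneq i0 => m0; rewrite iE m0 scale0r.
apply: Or31; apply/eqP; rewrite eqn_leq.
rewrite (uniq_leq_size (frame_uniq fr) (frame_points fr)) andbT.
apply: (uniq_leq_size (s2 := [:: <[ell s0]>%VS; <[ell s1]>%VS; <[ell s2]>%VS]) (undup_uniq _)).
move=> p /mem_configuration [i i0 ->].
have := h0 i => /negbT; rewrite !negb_or !negbK => /and3P[/eqP h01 /eqP h02 /eqP h12].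
exact: single.
Qed.

(** Three coordinate points never lie on one line, so the exceptional point is one of them;
    permuting the frame makes it the third. *)
Lemma line_and_point_case : (4 <= size Z)%N -> all_but_one_on_line Z ->
  (4 <= N)%N /\ minimally_generated I (nseq (N - 4) 1%N ++ [:: 2%N]).
Proof.
move=> sZ [M dM [p0 p0Z hM]].
have [s0 [s1 [s2 [e0 [e1 [e2 fr]]]]]] := frame_from_configuration dimW ell_inj.
have sub := frame_points fr.
have inM s : <[ell s]>%VS \in [:: <[ell s0]>%VS; <[ell s1]>%VS; <[ell s2]>%VS] ->
    <[ell s]>%VS != p0 -> ell s \in M.
  by move=> /sub sZ' sp; rewrite memvE; apply/(hM _ sZ').
have [E2|n2] := eqVneq <[ell s2]>%VS p0.
  by apply: (all_but_one_case fr sZ); exists M; rewrite // E2.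
have [E1|n1] := eqVneq <[ell s1]>%VS p0.
  by apply: (all_but_one_case (frame_swap12 fr) sZ); exists M; rewrite // E1.
have [E0|n0] := eqVneq <[ell s0]>%VS p0.
  by apply: (all_but_one_case (frame_swap12 (frame_swap01 fr)) sZ); exists M; rewrite // E0.
case: (frame_not_in_plane fr dM); apply: inM => //.
- by rewrite inE eqxx.
- by rewrite !inE eqxx orbT.
- by rewrite !inE eqxx !orbT.
Qed.
End Cases.

Theorem theorem4p9 (R : realType) (n : nat)
    (L : {vspace 'rV[R[i]]_n.+1}) (dimL : \dim L = 3%N)
    (W : vectType R[i]) (dimW : \dim {:W} = 3%N)
    (ell : 'I_n.+1 -> 'Hom(W, R[i]^o))
    (ell_embedding : forall w, (forall i, ell i w = 0) -> w = 0)
    (ell_image : forall x, x \in L <-> exists w, x = \row_i ell i w) :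
  let I := vanishing_ideal (coord_square L) in
  let Z := configuration ell in
  [/\
    (in_no_conic Z ->
       (5 <= n)%N /\ minimally_generated I (nseq (n - 5) 1%N ++ nseq 6 2%N)),

    (forall Q, unique_conic_through Z Q ->
       (4 <= n)%N /\
       (irreducible_conic Q ->
          minimally_generated I (nseq (n - 4) 1%N ++ nseq 7 3%N)) /\
       (~ irreducible_conic Q ->
          complete_intersection (coord_square L)
            (nseq (n - 4) 1%N ++ nseq 2 2%N)))

  & (in_several_conics Z ->
       [/\ [\/ size Z = 3%N,
               size Z = 4%N /\ no_three_collinear Z
             | (4 <= size Z)%N /\ all_but_one_on_line Z],
           size Z = 3%N ->
             (2 <= n)%N /\ minimally_generated I (nseq (n - 2) 1%N),
           size Z = 4%N -> no_three_collinear Z ->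
             (3 <= n)%N /\ minimally_generated I (nseq (n - 3) 1%N ++ [:: 4%N])
         & (4 <= size Z)%N -> all_but_one_on_line Z ->
             (3 <= n)%N /\ minimally_generated I (nseq (n - 3) 1%N ++ [:: 2%N])])].
Proof.
have L0 : L != 0%VS by rewrite -dimv_eq0 dimL.
have ell_inj : forall w, (forall i, ev (ell i) w = 0) -> w = 0 by [].
have ell_im : forall x, x \in L <-> exists w, x = \row_i ev (ell i) w by [].
move=> I Z; have [s0 [s1 [s2 [e0 [e1 [e2 fr]]]]]] := frame_from_configuration dimW ell_inj.
split.
(* The cases are stated for [N = n.+1] coordinates; [6 <= n.+1] and [n.+1 - 6] are convertible to
   [5 <= n] and [n - 5], and likewise below. *)
- exact: (no_conic_case L0 dimW ell_im).
- move=> Q uQ; have red := reducible_case L0 dimW ell_inj ell_im uQ.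
  have irr := irreducible_case L0 dimW ell_inj ell_im uQ.
  split; last by split=> [/irr []|/red []].
  (* The bound is claimed before the two kinds of conic are separated, so it takes excluded
     middle. *)
  by case: (boolp.pselect (irreducible_conic Q)) => [/irr []|/red []].
move=> sc; split.
- exact: (several_conics_trichotomy dimW ell_inj sc).
- exact: (three_points_case L0 ell_im fr).
- exact: (four_points_case L0 ell_im fr).
exact: (line_and_point_case L0 dimW ell_inj ell_im).
Qed.
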